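(* Let $h$ be a positive integer. Then $N(n;h) > n^{1/29.6}$ for all sufficiently large $n$.
   Context: For integers $n>h>0$, an incomplete latin square of order $n$ with a single hole $H\subseteq[n]$, $|H|=h$, is an $n\times n$ array with cell $(i,j)$ empty iff $(i,j)\in H\times H$ and otherwise containing a symbol of $[n]$, each row/column containing each symbol at most once, and symbols of $H$ not appearing in rows or columns indexed by $H$; two such squares with the same hole are orthogonal if superimposing them gives every ordered pair of symbols not both in $H$ exactly once. $N(n;h)$ is the maximum number of pairwise orthogonal such incomplete latin squares with a common hole of size $h$. *)

(* Defs.v *)
From HB Require Import structures.
From mathcomp Require Import all_boot all_order all_algebra.
From mathcomp Require Import reals exp.

Set Implicit Arguments.
Unset Strict Implicit.
Unset Printing Implicit Defensive.

(* An array of order n is a matrix over [option 'I_n]; [None] is an empty cell. *)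
Definition ils (n : nat) (H : {set 'I_n}) (L : 'M[option 'I_n]_n) : bool :=
  [&& [forall i, forall j, (L i j == None) == ((i \in H) && (j \in H))],
      [forall i, forall s, #|[set j | L i j == Some s]| <= 1],
      [forall j, forall s, #|[set i | L i j == Some s]| <= 1] &
      [forall i, forall j, forall s,
         (s \in H) && ((i \in H) || (j \in H)) ==> (L i j != Some s)]].

Definition ils_orthogonal (n : nat) (H : {set 'I_n})
    (L M : 'M[option 'I_n]_n) : bool :=
  [forall s, forall t, ~~ ((s \in H) && (t \in H)) ==>
     (#|[set c : 'I_n * 'I_n | (L c.1 c.2 == Some s) && (M c.1 c.2 == Some t)]|
        == 1)].

Definition moils (n : nat) (H : {set 'I_n})
    (F : {set 'M[option 'I_n]_n}) : bool :=
  [forall L in F, ils H L] &&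
  [forall L in F, forall M in F, (L != M) ==> ils_orthogonal H L M].

(* N(n;h).  Families are taken as sets: for 0 < h < n no square is orthogonal
   to itself, since a pair (s, t) with s outside H and t in H would have to
   occur, so a pairwise orthogonal family has no repetition. *)
Definition moils_max (n h : nat) : nat :=
  \max_(H : {set 'I_n} | #|H| == h)
    \max_(F : {set 'M[option 'I_n]_n} | moils H F) #|F|.

(* Main.v *)
From Stdlib Require Import NArith.
Require Import Defs.
From HB Require Import structures.
From mathcomp Require Import all_boot all_order all_algebra all_field.
From mathcomp Require Import boolp reals sequences exp zify ring lra.
Set Implicit Arguments.
Unset Strict Implicit.
Unset Printing Implicit Defensive.
Import Order.TTheory GRing.Theory Num.Theory.

(* Call a number good if all its maximal prime power divisors are at least
   q, slightly above n^(1/29.6); MacNeish's product of affine planes gives q - 2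
   orthogonal squares of every good order.  Wilson's construction turns good m,
   m + 1, t into incomplete squares of order m t + w with a hole of size w <= t;
   applied twice, it yields the hole h once n = m t + m' t' + h with m, m + 1,
   m', m' + 1, t, t' all good and m' t' + h <= t.  With z a little larger than
   q, first m is found by sifting k and 2^a k - 1 by the primes below z, where
   2^a is about z.  Then t' is a power of 3 or a prime near z, and m' runs
   through a progression modulo 2^a m, along which m', m' + 1 and t are sifted.
   The Brun-Hooley sieve succeeds in dimension 2 on intervals of length z^7.06
   and in dimension 3 on z^10.96, so that n >= z^29.1 up to a constant is enough. *)

(** * Transversal designs with a hole *)

(** A single Wilson step with hole h would need n - h itself to factor as m t. In the nested form
    the free term m' t' is adjusted by a congruence modulo m so that m divides n - h - m' t'; this
    is why t' must be prime to m. Since m (m + 1) and m' (m' + 1) are even, a high power of 2 has to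
    divide one factor of each: hence 2^a, while the parity of m' is taken opposite to that of n - h,
    which makes t odd. At the prime 3 the sifted numbers m', m' + 1 and t could exclude every
    residue: only m' = 1 mod 3 is admissible, and then 3 must not divide n - h - t'. So t' is a
    prime when 3 divides n - h and a power of 3 otherwise. If X2 and X3 are the lengths of the two
    sieved intervals, then m is at most about 2^a X2, m' about 2^a m X3, and the condition m' t' + h
    <= t asks for n of order m^2 2^a X3 t'. *)

(* A transversal design with k groups, all identified with V, and a hole of
   the same shape H in every group; its blocks are the columns of an
   orthogonal array. *)
Definition itd (k : nat) (V : Type) (H : pred V) : Prop :=
  exists (B : Type) (f : B -> 'I_k -> V), forall i j : 'I_k, i != j ->
    (forall x y, ~~ (H x && H y) -> exists! b, f b i = x /\ f b j = y) /\
    (forall b, ~~ (H (f b i) && H (f b j))).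

Definition itdn (k n h : nat) := @itd k 'I_n (fun i => i < h).

Lemma card_matching (V W : finType) (H : pred V) (H' : pred W) :
    #|V| = #|W| -> #|H| = #|H'| ->
  exists g : V -> W, bijective g /\ forall x, H' (g x) = H x.
Proof.
move=> eqVW eqH.
(* Listing the hole first in both types makes matching by position respect the holes. *)
pose sV := enum H ++ enum (predC H); pose sW := enum H' ++ enum (predC H').
have usV : uniq sV.
  rewrite cat_uniq !enum_uniq andbT /= -all_predC; apply/allP => x.
  by rewrite /= !mem_enum.
have usW : uniq sW.
  rewrite cat_uniq !enum_uniq andbT /= -all_predC; apply/allP => x.
  by rewrite /= !mem_enum.
have inV x : x \in sV by rewrite mem_cat !mem_enum !inE orbN.
have inW x : x \in sW by rewrite mem_cat !mem_enum !inE orbN.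
have szV : size sV = #|V| by rewrite size_cat -!cardE cardC.
have szW : size sW = #|W| by rewrite size_cat -!cardE cardC.
have [x0|V0] := pickP (mem V); last first.
  have cW : #|W| = 0 by rewrite -eqVW; apply: eq_card0 => x; have := V0 x.
  have nV (x : V) : False by have := V0 x.
  have nW (x : W) : False by have := card0_eq cW x; rewrite inE.
  exists (fun x => match nV x return W with end); split; last by move=> x; case: (nV x).
  by exists (fun x => match nW x return V with end) => x; [case: (nV x)|case: (nW x)].
move=> _.
have [y0|W0] := pickP (mem W); last first.
  have cW : #|W| = 0 by apply: eq_card0 => x; have := W0 x.
  by move: eqVW; rewrite cW => /card0_eq /(_ x0); rewrite inE.
move=> _.
exists (fun x => nth y0 sW (index x sV)); split.
  exists (fun y => nth x0 sV (index y sW)) => [x|y].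
    by rewrite index_uniq ?nth_index // szW -eqVW -szV index_mem.
  by rewrite index_uniq ?nth_index // szV eqVW -szW index_mem.
move=> x; rewrite nth_cat -cardE -eqH index_cat mem_enum.
have -> : (x \in H) = H x by [].
case Hx : (H x).
  have lt : index x (enum H) < #|H| by rewrite cardE index_mem mem_enum.
  rewrite lt; have : nth y0 (enum H') (index x (enum H)) \in enum H'.
    by rewrite mem_nth // -cardE -eqH.
  by rewrite mem_enum.
rewrite -cardE ltnNge leq_addr /= addKn.
have : nth y0 (enum (predC H')) (index x (enum (predC H))) \in enum (predC H').
  rewrite mem_nth // -cardE.
  have -> : #|predC H'| = #|predC H|.
    by apply/eqP; rewrite -(eqn_add2l #|H'|) cardC -eqH cardC eqVW.
  by rewrite cardE index_mem mem_enum inE /= Hx.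
by rewrite mem_enum inE /= => /negbTE.
Qed.

Lemma itd_bij k (V W : Type) (H : pred V) (H' : pred W) (g : V -> W) :
  bijective g -> (forall x, H' (g x) = H x) -> itd k H -> itd k H'.
Proof.
move=> [g' gK g'K] Hg [B [f fP]]; exists B, (fun b i => g (f b i)) => i j ij.
have [ex no] := fP i j ij; split => [x y|b]; last by rewrite !Hg.
rewrite -(g'K x) -(g'K y) !Hg => /ex [b [[<- <-] bu]].
exists b; split=> // b' [/(can_inj gK) e1 /(can_inj gK) e2].
by apply: bu; split.
Qed.

(** Only the cardinals matter, so each construction may choose its own point type and hole. *)
Lemma itdnP k n h (V : finType) (H : pred V) :
  #|V| = n -> #|H| = h -> itdn k n h <-> itd k H.
Proof.
move=> cV cH.
have hn : h <= n by rewrite -cV -cH max_card.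
have cI : #|(fun i : 'I_n => i < h)| = h.
  rewrite -sum1_card (eq_bigl (fun i : 'I_n => i < h)) //.
  by rewrite (big_ord_narrow hn) sum1_card card_ord.
split=> d.
  have [||g [gb gH]] := @card_matching 'I_n V (fun i => i < h) H.
  - by rewrite card_ord.
  - by rewrite cI.
  exact: itd_bij gb gH d.
have [||g [gb gH]] := @card_matching V 'I_n H (fun i => i < h).
- by rewrite card_ord.
- by rewrite cI.
exact: itd_bij gb gH d.
Qed.

Lemma tdn_itd k n (V : finType) : #|V| = n -> itdn k n 0 <-> @itd k V xpred0.
Proof. by move=> cV; apply: itdnP => //; exact: eq_card0. Qed.

Lemma itd_unit k : @itd k unit xpred0.
Proof.
exists unit, (fun _ _ => tt) => i j ij; split=> // x y _.
by exists tt; split; [case: x; case: y|case].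
Qed.

(** The affine plane: group [i] is the vertical line of abscissa [x i], and a block is a line given
    by intercept and slope. Two points with distinct abscissae determine it. *)
Lemma itd_field k (F : finFieldType) : k <= #|F| -> @itd k F xpred0.
Proof.
move=> kF; pose x (i : 'I_k) : F := enum_val (widen_ord kF i).
have xI : injective x by move=> i j /enum_val_inj /(congr1 val) /= /val_inj.
exists (F * F)%type, (fun ab i => ab.1 + ab.2 * x i)%R => i j ij; split=> // u v _.
have xij : (x i - x j != 0)%R by rewrite subr_eq0 (inj_eq xI).
pose b := ((u - v) / (x i - x j))%R.
have eb : (b * (x i - x j) = u - v)%R by rewrite /b divfK.
exists (u - b * x i, b)%R; split => /=.
  split; first by rewrite subrK.
  have -> : (u - b * x i + b * x j = u - b * (x i - x j))%R by ring.
  by rewrite eb; ring.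
case=> a' b' /= [eu ev].
have : (b' * (x i - x j) = b * (x i - x j))%R by rewrite eb -eu -ev; ring.
by move/(mulIf xij) => eb'; rewrite -eb' -eu; congr pair; ring.
Qed.

Lemma itd_prod k (V W : Type) :
  @itd k V xpred0 -> @itd k W xpred0 -> @itd k (V * W)%type xpred0.
Proof.
move=> [B [f fP]] [C [g gP]].
exists (B * C)%type, (fun bc i => (f bc.1 i, g bc.2 i)) => i j ij; split=> //.
move=> [x1 x2] [y1 y2] _.
have [b [[e1 e2] bu]] := (fP i j ij).1 x1 y1 isT.
have [c [[e3 e4] cu]] := (gP i j ij).1 x2 y2 isT.
exists (b, c); split => /=; first by rewrite e1 e2 e3 e4.
case=> b' c' /= [[h1 h2] [h3 h4]]; congr pair; first by apply: bu; split.
by apply: cu; split.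
Qed.

Definition good (q n : nat) : Prop :=
  0 < n /\ forall p, prime p -> p %| n -> q <= p ^ logn p n.

(** Strong induction: split off the full power of the smallest prime divisor, which is the order of
    a field with at least [q] elements, and take the product design. *)
Lemma good_tdn q k n : k <= q -> good q n -> itdn k n 0.
Proof.
move=> kq; have [N] := ubnP n; elim: N n => // N IH n; rewrite ltnS => nN [n0 gn].
have [n1|n1] := leqP n 1.
  have -> : n = 1 by lia.
  apply/(@tdn_itd _ _ unit); [exact: card_unit|exact: itd_unit].
have [p_pr pn] : prime (pdiv n) /\ pdiv n %| n by rewrite pdiv_prime // pdiv_dvd.
set p := pdiv n in p_pr pn.
have v0 : 0 < logn p n by rewrite logn_gt0 mem_primes p_pr n0.
have en : p ^ logn p n * n`_p^' = n by rewrite -p_part partnC.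
have g' : good q n`_p^'.
  split=> [|r r_pr rn]; first exact: part_gt0.
  have rp : r \in p^'.
    by apply: (pnatPpi (part_pnat p^' n)); rewrite mem_primes r_pr part_gt0.
  have -> : logn r n`_p^' = logn r n.
    rewrite -[in RHS]en lognM ?expn_gt0 ?pdiv_gt0 ?part_gt0 //.
    rewrite lognX [logn r p]logn_coprime ?muln0 ?add0n //.
    by rewrite prime_coprime // dvdn_prime2 //; move: rp; rewrite !inE.
  by apply: gn => //; exact: dvdn_trans rn (dvdn_part _ _).
have lt' : n`_p^' < n.
  rewrite -{2}en ltn_Pmull ?part_gt0 //.
  by rewrite -{1}(expn0 p) ltn_exp2l // prime_gt1.
have d' : itdn k n`_p^' 0 by apply: IH g'; apply: leq_trans lt' nN.
have [F _ cF] := PrimePowerField p_pr v0.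
rewrite -en; apply/(@tdn_itd _ _ (F * 'I_(n`_p^'))%type).
  by rewrite card_prod cF card_ord.
apply: itd_prod; last by apply/tdn_itd/d'; rewrite card_ord.
by apply: itd_field; rewrite cF (leq_trans kq) // gn.
Qed.

(* Relabelling every group separately, any block can be moved to the diagonal. *)
Lemma tdn_point_hole k m : 1 < k -> itdn k m.+1 0 ->
  @itd k (option 'I_m) (fun x => x == None).
Proof.
move=> k1 d.
have {d} : @itd k (option 'I_m) xpred0.
  by apply/tdn_itd/d; rewrite card_option card_ord.
case=> B [f fP].
pose i0 := Ordinal (ltnW k1); pose i1 := Ordinal k1.
have [b0 _] := (fP i0 i1 isT).1 None None isT.
pose s i x : option 'I_m := if x == f b0 i then None else if x == None then f b0 i else x.
have sK i : involutive (fun x => if x == None then f b0 i else if x == f b0 i then None else x).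
  move=> x; case: (eqVneq x None) => [->|xN]; rewrite ?eqxx.
    by case: eqP => [->|].
  by case: (eqVneq x (f b0 i)) => [->|xb]; rewrite ?eqxx // (negbTE xN) (negbTE xb).
(* The transposition of [None] with the point of [b0] in group [i]. It turns [b0] into the
   all-[None] block, which is then deleted. *)
pose sw i x := if x == None then f b0 i else if x == f b0 i then None else x.
have swb i x : (sw i x == None) = (x == f b0 i).
  rewrite /sw; case: (eqVneq x None) => [->|xN]; first by rewrite eq_sym.
  by case: (eqVneq x (f b0 i)) => // _; exact: negbTE.
exists {b : B | b <> b0}, (fun b i => sw i (f (sval b) i)) => i j ij.
split=> [x y|[b /= bb0]]; last first.
  rewrite !swb; apply/negP => /andP[/eqP e1 /eqP e2]; apply: bb0.
  have [b' [_ bu]] := (fP i j ij).1 (f b0 i) (f b0 j) isT.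
  by rewrite -(bu b) ?(bu b0) //; split.
move=> xy.
have [b [[e1 e2] bu]] := (fP i j ij).1 (sw i x) (sw j y) isT.
have bb0 : b <> b0.
  move=> eb; move/negP: xy; apply; move: e1 e2; rewrite eb => e1 e2.
  by rewrite -(sK i x) -(sK j y) -!/(sw _ _) -!/(sw _ _) !swb -e1 -e2 !eqxx.
exists (exist _ b bb0); split => /=; first by rewrite e1 e2; split; exact: sK.
case=> b' b'b0 /= [h1 h2]; apply: eq_exist => /=.
by apply: bu; split; [rewrite -h1|rewrite -h2]; rewrite [RHS]sK.
Qed.

(* Wilson's construction: the points of the truncated last group of a
   TD(k+1,t) become the hole, the points of the other groups get weight m. *)
Lemma itdn_wilson k m t w : 1 < k -> itdn k m 0 -> itdn k m.+1 0 ->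
  itdn k.+1 t 0 -> w <= t -> itdn k (m * t + w) w.
Proof.
move=> k1 dm dm1 [B [f fP]] wt.
case: dm => C [g gP].
have [D [h hP]] := tdn_point_hole k1 dm1.
pose V := ('I_t * 'I_m + 'I_w)%type.
pose H (x : V) := if x is inr _ then true else false.
apply/(@itdnP _ _ _ V H).
- by rewrite card_sum card_prod !card_ord mulnC.
- rewrite -sum1_card big_sumType /= big_pred0 // add0n.
  by rewrite (eq_bigl xpredT) // sum1_card card_ord.
pose l (i : 'I_k) : 'I_k.+1 := widen_ord (leqnSn k) i.
have lI : injective l by move=> i j /(congr1 val) /= /val_inj.
have lm i : l i != ord_max.
  by apply/eqP => /(congr1 val) /= e; have := ltn_ord i; rewrite e ltnn.
have fu i j b b' : i != j -> f b i = f b' i -> f b j = f b' j -> b = b'.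
  move=> ij e1 e2; have [b'' [_ bu]] := (fP i j ij).1 (f b i) (f b j) isT.
  by rewrite -(bu b) // -(bu b').
have gu i j b b' : i != j -> g b i = g b' i -> g b j = g b' j -> b = b'.
  move=> ij e1 e2; have [b'' [_ bu]] := (gP i j ij).1 (g b i) (g b j) isT.
  by rewrite -(bu b) // -(bu b').
have hu i j b b' : i != j -> h b i = h b' i -> h b j = h b' j -> b = b'.
  move=> ij e1 e2; have [b'' [_ bu]] := (hP i j ij).1 (h b i) (h b j) ((hP i j ij).2 b).
  by rewrite -(bu b) // -(bu b').
(* Blocks in [P] keep their last point: they are inflated by a design of order m + 1 whose point
   [None] stands for that last point. Blocks in [Q] lose it and are inflated by a design of order
   m. *)
pose P := {b : B | f b ord_max < w}; pose Q := {b : B | ~~ (f b ord_max < w)}.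
pose F (x : P * D + Q * C) (i : 'I_k) : V := match x with
  | inl bd => match h bd.2 i with
      | Some y => inl (f (sval bd.1) (l i), y)
      | None => inr (Ordinal (svalP bd.1)) end
  | inr bc => inl (f (sval bc.1) (l i), g bc.2 i) end.
exists (P * D + Q * C)%type, F => i j ij.
have lij : l i != l j by rewrite (inj_eq lI).
split; last first.
  case=> [[[b bw] d]|[[b bw] c]] //=.
  have := (hP i j ij).2 d.
  by case: (h d i) => [y|]; case: (h d j) => [y'|].
move=> x y xy.
suff [b [[bx b_y] bu]] : exists b, (F b i = x /\ F b j = y) /\
    forall b', F b' i = x -> F b' j = y -> b = b'.
  by exists b; split=> // b' [? ?]; apply: bu.
have cs (b : P) (d d' : D) : d = d' ->
   inl (b, d) = inl (b, d') :> P * D + Q * C by move=> ->.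
have eP (b b' : B) pb pb' : b = b' -> exist (fun b => f b ord_max < w) b pb = exist _ b' pb'.
  by move=> e; apply: eq_exist.
have eQ (b b' : B) pb pb' : b = b' -> exist (fun b => ~~ (f b ord_max < w)) b pb = exist _ b' pb'.
  by move=> e; apply: eq_exist.
case: x y xy => [[x1 x2]|x] [[y1 y2]|y] //= _.
- have [b [[e1 e2] _]] := (fP (l i) (l j) lij).1 x1 y1 isT.
  case bw : (f b ord_max < w).
    have [|d [[e3 e4] _]] := (hP i j ij).1 (Some x2) (Some y2); first by [].
    exists (inl (exist _ b bw, d)) => /=; rewrite e3 e4 e1 e2; split=> //.
    case=> [[[b' bw'] d']|[[b' bw'] c']] /=.
      case h1 : (h d' i) => [u|] // [f1 u1]; case h2 : (h d' j) => [v|] // [f2 v1].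
      have eb : b = b' by apply: (fu _ _ _ _ lij); rewrite ?e1 ?e2.
      rewrite (eP _ _ bw bw' eb); congr (inl (_, _)).
      by apply: (hu _ _ _ _ ij); rewrite ?e3 ?e4 ?h1 ?h2 ?u1 ?v1.
    move=> [f1 u1] [f2 v1].
    have eb : b = b' by apply: (fu _ _ _ _ lij); rewrite ?e1 ?e2.
    by case/negP: (bw'); rewrite -eb.
  have [c [[e3 e4] _]] := (gP i j ij).1 x2 y2 isT.
  exists (inr (exist _ b (negbT bw), c)) => /=; rewrite e3 e4 e1 e2; split=> //.
  case=> [[[b' bw'] d']|[[b' bw'] c']] /=.
    case h1 : (h d' i) => [u|] // [f1 u1]; case h2 : (h d' j) => [v|] // [f2 v1].
    have eb : b = b' by apply: (fu _ _ _ _ lij); rewrite ?e1 ?e2.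
    by exfalso; move: (bw'); rewrite -eb bw.
  move=> [f1 u1] [f2 v1].
  have eb : b = b' by apply: (fu _ _ _ _ lij); rewrite ?e1 ?e2.
  rewrite (eQ _ _ (negbT bw) bw' eb); congr (inr (_, _)).
  by apply: (gu _ _ _ _ ij); rewrite ?e3 ?e4 ?u1 ?v1.
(* One point lies in the hole: the master block through it, read as a point of the last group, and
   through the other point belongs to [P]. *)
- have [b [[e1 e2] _]] := (fP (l i) ord_max (lm i)).1 x1 (widen_ord wt y) isT.
  have bw : f b ord_max < w by rewrite e2 /=.
  have [|d [[e3 e4] _]] := (hP i j ij).1 (Some x2) None; first by [].
  exists (inl (exist _ b bw, d)) => /=; rewrite e3 e4 e1; split.
    by split=> //; congr inr; apply: val_inj; rewrite /= e2.
  case=> [[[b' bw'] d']|[[b' bw'] c']] //=.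
  case h1 : (h d' i) => [u|] // [f1 u1]; case h2 : (h d' j) => [v|] // [v1].
  have eb : b = b'.
    apply: (fu _ _ _ _ (lm i)); first by rewrite e1 f1.
    by apply: val_inj; rewrite e2 /= -v1.
  rewrite (eP _ _ bw bw' eb); congr (inl (_, _)).
  by apply: (hu _ _ _ _ ij); rewrite ?e3 ?e4 ?h1 ?h2 ?u1.
- have [b [[e1 e2] _]] := (fP (l j) ord_max (lm j)).1 y1 (widen_ord wt x) isT.
  have bw : f b ord_max < w by rewrite e2 /=.
  have [|d [[e3 e4] _]] := (hP i j ij).1 None (Some y2); first by [].
  exists (inl (exist _ b bw, d)) => /=; rewrite e3 e4 e1; split.
    by split=> //; congr inr; apply: val_inj; rewrite /= e2.
  case=> [[[b' bw'] d']|[[b' bw'] c']] //=.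
  case h1 : (h d' i) => [u|] // [v1]; case h2 : (h d' j) => [v|] // [f1 u1].
  have eb : b = b'.
    apply: (fu _ _ _ _ (lm j)); first by rewrite e1 f1.
    by apply: val_inj; rewrite e2 /= -v1.
  rewrite (eP _ _ bw bw' eb); congr (inl (_, _)).
  by apply: (hu _ _ _ _ ij); rewrite ?e3 ?e4 ?h1 ?h2 ?u1.
Qed.

(** Pairs inside the old hole are missed by every block of the first design, and the blocks of the
    second cover no other pairs. *)
Lemma itdn_fill k n w h : itdn k n w -> itdn k w h -> h <= w -> w <= n -> itdn k n h.
Proof.
move=> [B [f fP]] [C [g gP]] hw wn.
exists (B + C)%type, (fun x i => match x with
  | inl b => f b i | inr c => widen_ord wn (g c i) end) => i j ij.
have [fe fn] := fP i j ij; have [ge gn] := gP i j ij; split; last first.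
  case=> [b|c]; last exact: gn.
  by apply: contra (fn b) => /andP[/leq_trans-> // /leq_trans->].
move=> x y xy; case: (boolP ((x < w) && (y < w))) => [/andP[xw yw]|xyw].
  have [|c [[e1 e2] cu]] := ge (Ordinal xw) (Ordinal yw); first by [].
  exists (inr c); split; first by rewrite e1 e2; split; apply: val_inj.
  case=> [b|c'] [e3 e4]; first by have := fn b; rewrite e3 e4 xw yw.
  by congr inr; apply: cu; split; apply: val_inj => /=; [rewrite -e3|rewrite -e4].
have [b [[e1 e2] bu]] := fe x y xyw.
exists (inl b); split=> //; case=> [b'|c] [e3 e4]; first by congr inl; apply: bu.
by move: xyw; rewrite -e3 -e4 /= !ltn_ord.
Qed.

(** Groups 0 and 1 index rows and columns, a block is a filled cell, and each further group supplies
    the symbols of one square. *)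
Lemma itdn_moils_max k n h : 0 < h -> h < n -> itdn k.+2 n h -> k <= moils_max n h.
Proof.
move=> h0 hn [B [f fP]].
have fu i j b b' : i != j -> f b i = f b' i -> f b j = f b' j -> b = b'.
  move=> ij e1 e2; have [b'' [_ bu]] := (fP i j ij).1 (f b i) (f b j) ((fP i j ij).2 b).
  by rewrite -(bu b) // -(bu b').
pose c0 : 'I_k.+2 := ord0; pose c1 : 'I_k.+2 := lift ord0 ord0.
pose cs (r : 'I_k) : 'I_k.+2 := lift ord0 (lift ord0 r).
have c01 : c0 != c1 by [].
have c0s r : c0 != cs r by [].
have c1s r : c1 != cs r by rewrite (inj_eq lift_inj).
have csI r r' : (cs r != cs r') = (r != r') by rewrite !(inj_eq lift_inj).
pose H := [set i : 'I_n | i < h].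
have cH : #|H| == h.
  rewrite cardsE -sum1_card (eq_bigl (fun i : 'I_n => i < h)) //.
  by rewrite (big_ord_narrow (ltnW hn)) sum1_card card_ord.
pose Q r i j s := exists b, [/\ f b c0 = i, f b c1 = j & f b (cs r) = s].
pose L r : 'M[option 'I_n]_n := (\matrix_(i, j) [pick s | `[< Q r i j s >]])%R.
have LP r i j s : reflect (Q r i j s) (L r i j == Some s).
  apply: (iffP idP); rewrite mxE; case: pickP => [s' /asboolP [b [e1 e2 e3]]|nQ] //.
  - by move=> /eqP [<-]; exists b.
  - by move=> [b' [h1 h2 h3]]; rewrite -e3 -h3 (fu c0 c1 b b') ?e1 ?e2.
  - by move=> /asboolP; rewrite nQ.
have LE r i j : ~~ ((i \in H) && (j \in H)) -> exists s, L r i j = Some s.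
  rewrite !inE => ij; have [b [[e1 e2] _]] := (fP c0 c1 c01).1 i j ij.
  by exists (f b (cs r)); apply/eqP/LP; exists b.
have Lils r : ils H (L r).
  apply/and4P; split.
  - apply/forallP => i; apply/forallP => j.
    case: (boolP (_ && _)) => ij; last by have [s ->] := LE r i j ij.
    case e : (L r i j) => [s|] //; have /LP [b [e1 e2 _]] : L r i j == Some s by rewrite e.
    by move: ij; rewrite !inE -e1 -e2 (negbTE ((fP c0 c1 c01).2 b)).
  - apply/forallP => i; apply/forallP => s; apply/card_le1_eqP => j j'.
    rewrite !inE => /LP [b [e1 e2 e3]] /LP [b' [h1 h2 h3]].
    by rewrite -e2 -h2 (fu c0 (cs r) b b') ?e1 ?e3.
  - apply/forallP => j; apply/forallP => s; apply/card_le1_eqP => i i'.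
    rewrite !inE => /LP [b [e1 e2 e3]] /LP [b' [h1 h2 h3]].
    by rewrite -e1 -h1 (fu c1 (cs r) b b') ?e2 ?e3.
  - apply/forallP => i; apply/forallP => j; apply/forallP => s.
    apply/implyP => /andP[sH ijH]; apply/LP => -[b [e1 e2 e3]].
    move: sH ijH; rewrite !inE -e1 -e2 -e3 => sH /orP[] iH.
      by have := (fP c0 (cs r) (c0s r)).2 b; rewrite sH iH.
    by have := (fP c1 (cs r) (c1s r)).2 b; rewrite sH iH.
have Lort r r' : r != r' -> ils_orthogonal H (L r) (L r').
  rewrite -csI => rr'; apply/forallP => s; apply/forallP => t; apply/implyP.
  rewrite !inE => st; have [b [[e1 e2] bu]] := (fP _ _ rr').1 s t st.
  apply/cards1P; exists (f b c0, f b c1); apply/setP => -[i j]; rewrite !inE /=.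
  apply/andP/eqP => [[/LP [b1 [h1 h2 h3]] /LP [b2 [g1 g2 g3]]]|[-> ->]].
    have e12 : b1 = b2 by apply: (fu c0 c1); rewrite ?h1 ?h2.
    by rewrite (bu b1) ?h1 ?h2 //; split=> //; rewrite e12.
  by split; apply/LP; exists b.
(* Two groups giving the same square would make it orthogonal to itself. As h lies outside the hole,
   the pair (h, 0) must occur, which puts h and 0 in one cell. *)
have LI : injective L.
  move=> r r' eL; apply/eqP/negPn/negP => rr'.
  have n0 : 0 < n by exact: leq_trans h0 (ltnW hn).
  have /forallP /(_ (Ordinal hn)) /forallP /(_ (Ordinal n0)) := Lort _ _ rr'.
  rewrite !inE /= ltnn /= => /cards1P [c /setP /(_ c)].
  by rewrite !inE eqxx eL => /andP[/eqP -> /eqP [] ] h00; move: h0; rewrite h00.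
pose F := [set L r | r : 'I_k].
have cF : #|F| = k by rewrite card_imset // card_ord.
have mF : moils H F.
  apply/andP; split; first by apply/forall_inP => _ /imsetP[r _ ->]; exact: Lils.
  apply/forall_inP => _ /imsetP[r _ ->]; apply/forall_inP => _ /imsetP[r' _ ->].
  by rewrite (inj_eq LI); apply/implyP; exact: Lort.
apply: (@leq_trans (\max_(F : {set 'M[option 'I_n]_n} | moils H F) #|F|)).
  by rewrite -{1}cF; exact: (@leq_bigmax_cond _ _ (fun F : {set 'M[option 'I_n]_n} => #|F|)).
exact: (@leq_bigmax_cond _ (fun H : {set 'I_n} => #|H| == h)
  (fun H => \max_(F : {set 'M[option 'I_n]_n} | moils H F) #|F|)).
Qed.

(* The hole w of the outer Wilson design is itself a Wilson design with hole h. *)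
Lemma good_moils_max k h m t m' t' : 0 < h -> h <= t' -> m' * t' + h <= t -> 0 < m ->
  good k.+3 m -> good k.+3 m.+1 -> good k.+3 t ->
  good k.+3 m' -> good k.+3 m'.+1 -> good k.+3 t' ->
  k <= moils_max (m * t + (m' * t' + h)) h.
Proof.
move=> h0 ht' wt m0 gm gm1 gt gm' gm1' gt'.
have [m'0 t'0] : 0 < m' /\ 0 < t' by split; [case: gm'|case: gt'].
have mt' : 0 < m' * t' by rewrite muln_gt0 m'0.
(* [k] squares take k + 2 groups; a design whose last group is truncated needs one more. *)
have td a : good k.+3 a -> itdn k.+2 a 0 by apply: good_tdn.
have td1 a : good k.+3 a -> itdn k.+3 a 0 by apply: good_tdn.
apply: itdn_moils_max => //; first lia.
apply: (@itdn_fill _ _ (m' * t' + h)); [|apply: itdn_wilson|lia|lia]; auto.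
by apply: itdn_wilson; auto.
Qed.

(** * Mertens' estimates *)

(** The two equal middle coefficients are both terms of the expansion of 2^(2m + 1). *)
Lemma bin_central m : 'C(m.*2.+1, m) <= 4 ^ m.
Proof.
have e : 2 ^ m.*2.+1 = \sum_(i < m.*2.+2) 'C(m.*2.+1, i).
  rewrite -[2]/(1 + 1) expnDn; apply: eq_bigr => i _.
  by rewrite !exp1n !muln1.
have m1 : m < m.*2.+2 by lia.
have m2 : m.+1 < m.*2.+2 by lia.
rewrite (bigD1 (Ordinal m1)) //= (bigD1 (Ordinal m2)) in e; last first.
  by rewrite -val_eqE /= neq_ltn ltnSn orbT.
have e2 : 'C(m.*2.+1, m.+1) = 'C(m.*2.+1, m).
  by rewrite -bin_sub; [congr binomial; lia|lia].
have e4 : 2 ^ m.*2.+1 = 2 * 4 ^ m by rewrite expnS -mul2n expnM.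
move: e; rewrite /= e2 e4; lia.
Qed.

(** Erdos' argument: for n = 2m + 1 the primes from m + 2 to n divide the binomial coefficient of n
    over m, which is at most 4^m; the smaller primes are left to induction. *)
Lemma primorial_le n : \prod_(0 <= p < n.+1 | prime p) p <= 4 ^ n.
Proof.
have [N] := ubnP n; elim: N n => // N IH n; rewrite ltnS => nN.
have [n2|n2] := leqP n 2.
  case: n n2 nN => [|[|[|//]]] _ _;
    by rewrite big_mkcond /= unlock.
have [on|en] := boolP (odd n); last first.
  rewrite big_mkcond big_nat_recr //= -big_mkcond /=.
  have -> : prime n = false.
    by apply/negbTE/negP => /even_prime []; [lia|rewrite (negbTE en)].
  rewrite muln1 -[n in X in X <= _](prednK (ltnW (ltnW n2))).
  apply: (leq_trans (IH _ _)); first lia.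
  by rewrite leq_exp2l //; lia.
pose m := n./2; have nE : n = m.*2.+1 by rewrite /m -[LHS]odd_double_half on.
have m1 : 0 < m by lia.
rewrite (@big_cat_nat _ _ _ m.+2) //=; last lia.
apply: (@leq_trans (4 ^ m.+1 * 4 ^ m)); last by rewrite -expnD leq_exp2l //; lia.
apply: leq_mul; first by apply: IH; lia.
apply: leq_trans (bin_central m); apply: dvdn_leq; first by rewrite bin_gt0; lia.
have pw : pairwise coprime [seq id p | p <- index_iota m.+2 n.+1 & prime p].
  rewrite map_id.
  have : all prime [seq p <- index_iota m.+2 n.+1 | prime p] by exact: filter_all.
  have : uniq [seq p <- index_iota m.+2 n.+1 | prime p] by rewrite filter_uniq ?iota_uniq.
  elim: [seq p <- index_iota m.+2 n.+1 | prime p] => //= a s IHs /andP[ans us] /andP[pa ps].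
  rewrite IHs // andbT; apply/allP => b bs.
  rewrite prime_coprime // dvdn_prime2 //; last exact: (allP ps).
  by apply: contraNneq ans => ->.
apply/(@unstable.Gauss_dvd_prod _ _ prime id _ pw) => p.
rewrite mem_index_iota => /andP[p1 p2] p_pr.
have fE : 'C(n, m) * (m`! * (n - m)`!) = n`! by rewrite bin_fact //; lia.
have : p %| n`! by apply: dvdn_fact; rewrite prime_gt0 //; lia.
rewrite -fE !Euclid_dvdM //.
have nd a : a < p -> ~~ (p %| a`!).
  move=> ap; rewrite fact_prod (big_morph _ (fun x y => Euclid_dvdM x y p_pr) (_ : p %| 1 = false)).
    apply/negP; rewrite big_has_cond => /hasP[i]; rewrite mem_index_iota => ia /=.
    by move/dvdn_leq; lia.
  by rewrite dvdn1; case: p p_pr {p1 p2 ap} => [|[|]].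
by rewrite (negbTE (nd m _)) ?(negbTE (nd (n - m) _)) ?orbF -?nE //; lia.
Qed.

Section mertens.
Variable R : realType.
Local Open Scope ring_scope.

Definition lnn (n : nat) : R := ln n%:R.

Lemma lnn_ge0 n : 0 <= lnn n.
Proof.
by case: n => [|n]; [rewrite /lnn ln0|rewrite /lnn ln_ge0 // ler1n].
Qed.

Lemma lnn_le m n : (0 < m)%N -> (m <= n)%N -> lnn m <= lnn n.
Proof.
by move=> m0 mn; rewrite /lnn ler_ln ?ler_nat // posrE ltr0n //; lia.
Qed.

Lemma lnnM m n : (0 < m)%N -> (0 < n)%N -> lnn (m * n) = lnn m + lnn n.
Proof. by move=> m0 n0; rewrite /lnn natrM lnM // posrE ltr0n. Qed.

Lemma lnnX m n : (0 < m)%N -> lnn (m ^ n) = n%:R * lnn m.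
Proof. by move=> m0; rewrite /lnn natrX lnXn ?ltr0n // mulr_natl. Qed.

Lemma lnn_prod (I : Type) (s : seq I) (P : pred I) (F : I -> nat) :
  (forall i, P i -> (0 < F i)%N) ->
  lnn (\prod_(i <- s | P i) F i) = \sum_(i <- s | P i) lnn (F i).
Proof.
move=> F0; elim: s => [|a s IH]; first by rewrite !big_nil /lnn ln1.
rewrite !big_cons; case: ifP => // Pa; rewrite lnnM ?F0 ?IH //.
by rewrite prodn_cond_gt0.
Qed.

Lemma ln_le_sub1 (x : R) : 0 < x -> ln x <= x - 1.
Proof.
by move=> x0; have := @le_ln1Dx R (x - 1); rewrite addrCA subrr addr0; apply; lra.
Qed.

Lemma lnn4 : lnn 4 <= 2.
Proof.
have : lnn 2 <= 2 - 1 by apply: ln_le_sub1.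
have -> : lnn 4 = lnn 2 + lnn 2 by rewrite -lnnM.
lra.
Qed.

Lemma theta_le n : \sum_(0 <= p < n.+1 | prime p) lnn p <= 2 * n%:R.
Proof.
rewrite -lnn_prod => [|p /prime_gt0 //].
apply: (@le_trans _ _ (lnn (4 ^ n))).
  by apply: lnn_le (primorial_le n); apply: prodn_cond_gt0 => p /prime_gt0.
by rewrite lnnX // mulrC ler_wpM2r ?ler0n ?lnn4.
Qed.

Lemma ln_fact n : lnn n`! = \sum_(0 <= p < n.+1 | prime p) (logn p n`!)%:R * lnn p.
Proof.
have f0 := fact_gt0 n.
rewrite -[in LHS](partnT f0) (@widen_partn n`!) //.
rewrite lnn_prod => [|p _]; last first.
  by rewrite expn_gt0; case: p => //; rewrite lognE.
have E : \sum_(0 <= p < n`!.+1 | p \in predT) lnn (p ^ logn p n`!) =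
         \sum_(0 <= p < n`!.+1 | prime p) (logn p n`!)%:R * lnn p.
  rewrite [RHS]big_mkcond /=; apply: eq_bigr => p _; case: ifP => pp.
    by rewrite lnnX // prime_gt0.
  by rewrite lognE pp /= expn0 /lnn ln1.
have nf : (n <= n`!)%N.
  by case: (n) => // m; rewrite factS leq_pmulr ?fact_gt0.
rewrite E (@big_cat_nat _ _ _ n.+1) //= [X in _ + X]big1_seq ?addr0 // => p.
rewrite mem_index_iota => /and3P[pp np _].
suff -> : logn p n`! = 0%N by rewrite mul0r.
rewrite logn_fact // big_nat big1 // => k /andP[k1 _].
apply: divn_small; apply: leq_trans np _.
by apply: (@leq_pexp2l p 1 k) => //; exact: prime_gt0.
Qed.

Lemma ln_fact_ge n : n%:R * lnn n - n%:R <= lnn n`!.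
Proof.
elim: n => [|n IH]; first by rewrite fact0 /lnn ln1 ln0 // mul0r subr0.
rewrite factS lnnM ?fact_gt0 //.
case: n IH => [|n] IH; first by rewrite fact0 /lnn ln1; lra.
set x := lnn n.+1 in IH *; set y := lnn n.+2.
suff : n.+1%:R * (y - x) <= 1 by rewrite -[n.+2%:R]natr1 mulrDl mulrBr; move: IH; lra.
have n0 : 0 < n.+1%:R :> R by rewrite ltr0n.
have : y - x <= n.+2%:R / n.+1%:R - 1.
  by rewrite /y /x /lnn -ln_div ?posrE ?ltr0n // ln_le_sub1 // divr_gt0 ?ltr0n.
have -> : n.+2%:R / n.+1%:R - 1 = n.+1%:R^-1 :> R.
  by rewrite -[n.+2%:R]natr1 mulrDl divff ?gt_eqF // mul1r addrAC subrr add0r.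
by move=> /(ler_wpM2l (ltW n0)); rewrite mulfV ?gt_eqF.
Qed.



End mertens.

Section mertens_sums.
Variable R : realType.
Local Open Scope ring_scope.
Notation lnn := (@lnn R).
Lemma ln_fact_le n : lnn n`! <= n%:R * lnn n.
Proof.
elim: n => [|n IH]; first by rewrite fact0 /lnn ln1 mul0r.
rewrite factS lnnM ?fact_gt0 // -natr1 mulrDl mul1r addrC lerD2r.
apply: le_trans IH _; rewrite ler_wpM2l ?ler0n //.
by case: n => [|n]; [rewrite /lnn ln1 ln0|apply: lnn_le].
Qed.

Definition mertens_sum (n : nat) : R := \sum_(0 <= p < n.+1 | prime p) lnn p / p%:R.

(** From ln n! <= n ln n: the exponent of p in n! is at least n / p - 1, and the total deficit is
    Chebyshev's theta(n) <= 2 n. *)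
Lemma mertens_sum_le n : (0 < n)%N -> mertens_sum n <= lnn n + 2.
Proof.
move=> n0; have n0' : 0 < n%:R :> R by rewrite ltr0n.
rewrite -(ler_pM2l n0') mulrDr [n%:R * 2]mulrC.
apply: (@le_trans _ _ (lnn n`! + \sum_(0 <= p < n.+1 | prime p) lnn p)); last first.
  by rewrite lerD ?ln_fact_le ?theta_le.
rewrite ln_fact /mertens_sum mulr_sumr -big_split /= big_nat_cond [leRHS]big_nat_cond.
apply: ler_sum => p /andP[/andP[_ pn] pp]; have p0 := prime_gt0 pp.
rewrite mulrCA -[X in _ + X]mul1r -mulrDl mulrC ler_wpM2r ?lnn_ge0 //.
rewrite ler_pdivrMr ?ltr0n // natr1 -natrM ler_nat.
have pn' : (p <= n)%N by lia.
rewrite logn_fact // big_ltn; last by lia.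
rewrite expn1 -addSn mulnDl; apply: leq_trans (leq_addr _ _).
by apply: ltnW; apply: ltn_ceil.
Qed.

Lemma sum_geometric_inv (p m : nat) : (1 < p)%N ->
  \sum_(1 <= k < m.+1) (p ^ k)%:R^-1 <= (p%:R - 1)^-1 :> R.
Proof.
move=> p1; have p1' : 0 < p%:R - 1 :> R by rewrite subr_gt0 ltr1n.
suff : \sum_(1 <= k < m.+1) (p ^ k)%:R^-1 * (p%:R - 1) = 1 - (p ^ m)%:R^-1 :> R.
  by rewrite -mulr_suml => e; rewrite -[leRHS]mul1r ler_pdivlMr // e gerBl invr_ge0 ler0n.
elim: m => [|m IH]; first by rewrite big_geq // expn0 invr1 subrr.
rewrite big_nat_recr //= IH expnS natrM invfM.
have pz : p%:R != 0 :> R by rewrite pnatr_eq0; lia.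
have pmz : (p ^ m)%:R != 0 :> R by rewrite pnatr_eq0 -lt0n expn_gt0; lia.
by field; rewrite pz pmz.
Qed.

(** The right side vanishes at n = 1 and its increments dominate the terms. The explicit negative
    part lets the induction close; what matters later is the bound 2. *)
Lemma sum_ln_le n : (0 < n)%N ->
  \sum_(2 <= j < n.+1) lnn j / (j%:R * (j%:R - 1)) <= 2 - (lnn n + 2) / n%:R.
Proof.
elim: n => // -[|n] IH _; first by rewrite big_geq // /lnn ln1 divr1; lra.
rewrite big_nat_recr //=; have /(_ isT) := IH; set S := \sum_(_ <= _ < _) _ => hS.
set a : R := n.+1%:R; have a0 : 0 < a by rewrite ltr0n.
have -> : n.+2%:R = a + 1 :> R by rewrite natr1.
have : lnn n.+2 <= lnn n.+1 + a^-1.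
  rewrite -lerBlDl /lnn -ln_div ?posrE ?ltr0n //.
  apply: le_trans (ln_le_sub1 _) _; first by rewrite divr_gt0 ?ltr0n.
  by rewrite -[n.+2%:R]natr1 mulrDl divff ?gt_eqF // mul1r addrAC subrr add0r.
move: hS; rewrite -/a; set x := lnn n.+1; set y := lnn n.+2 => hS hy.
apply: le_trans (_ : 2 - (x + 2) / a + y / ((a + 1) * (a + 1 - 1)) <= _).
  by rewrite lerD2r.
have a1 : 1 <= a by rewrite ler1n.
clearbody a x y.
rewrite -subr_ge0.
have -> : 2 - (y + 2) / (a + 1) - (2 - (x + 2) / a + y / ((a + 1) * (a + 1 - 1))) =
   ((x - y) * (a + 1) + 2) / (a * (a + 1)) :> R.
  by field; apply/andP; split; lra.
apply: divr_ge0; last by apply: mulr_ge0; lra.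
have : (y - x) * (a + 1) <= a^-1 * (a + 1) by apply: ler_wpM2r; lra.
have : a^-1 * (a + 1) <= 2.
  by rewrite mulrDr mulVf ?gt_eqF // mulr1; have ia : a^-1 <= 1; [by rewrite invf_le1|lra].
lra.
Qed.

(** From ln n! >= n ln n - n: the exponent of p is at most n / (p - 1), and 1 / (p - 1) = 1 / p + 1
    / (p (p - 1)), where the second part contributes at most 2. Hence 3 = 1 + 2. *)
Lemma mertens_sum_ge n : (0 < n)%N -> lnn n - 3 <= mertens_sum n.
Proof.
move=> n0; have n0' : 0 < n%:R :> R by rewrite ltr0n.
rewrite -(ler_pM2l n0') mulrBr.
have := ln_fact_ge R n; rewrite ln_fact => h.
suff : \sum_(0 <= p < n.+1 | prime p) (logn p n`!)%:R * lnn p <= n%:R * mertens_sum n + n%:R * 2.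
  by move: h; lra.
apply: (@le_trans _ _ (n%:R * mertens_sum n + n%:R * \sum_(2 <= j < n.+1) lnn j / (j%:R * (j%:R - 1)))); last first.
  rewrite lerD2l ler_pM2l //; apply: le_trans (sum_ln_le n0) _.
  by rewrite gerBl divr_ge0 ?ler0n // addr_ge0 ?lnn_ge0.
apply: (@le_trans _ _ (n%:R * mertens_sum n + n%:R * \sum_(0 <= j < n.+1 | prime j) lnn j / (j%:R * (j%:R - 1)))); last first.
  rewrite lerD2l ler_pM2l // big_mkcond /= (@big_cat_nat _ _ _ 2) //=.
  rewrite big_nat_recr //= big_nat1 /= !add0r; apply: ler_sum_nat => j /andP[j2 _]; case: ifP => // _.
  rewrite divr_ge0 ?lnn_ge0 // mulr_ge0 ?ler0n // subr_ge0 ler1n; lia.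
rewrite -mulrDr /mertens_sum -big_split /= mulr_sumr.
apply: ler_sum => p pp; have p1 := prime_gt1 pp.
have p1' : 0 < p%:R - 1 :> R by rewrite subr_gt0 ltr1n.
have p0' : 0 < p%:R :> R by rewrite ltr0n; lia.
have -> : lnn p / p%:R + lnn p / (p%:R * (p%:R - 1)) = lnn p * (p%:R - 1)^-1.
  by field; apply/andP; split; lra.
rewrite [lnn p * _]mulrC mulrA ler_wpM2r ?lnn_ge0 //.
apply: le_trans (_ : n%:R * (\sum_(1 <= k < n.+1) (p ^ k)%:R^-1) <= _); last first.
  by rewrite ler_pM2l // sum_geometric_inv.
rewrite logn_fact // natr_sum mulr_sumr; apply: ler_sum_nat => k _.
rewrite ler_pdivlMr ?ltr0n ?expn_gt0 ?prime_gt0 // -natrM ler_nat; exact: leq_divM.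
Qed.
End mertens_sums.

Section mertens_blocks.
Variable R : realType.
Local Open Scope ring_scope.
Notation lnn := (@lnn R).
Implicit Types a b : R.

Lemma expR_le_inv (x : R) : x < 1 -> expR x <= (1 - x)^-1.
Proof.
move=> x1; have : 1 + - x <= expR (- x) by exact: expR_ge1Dx.
rewrite expRN => h; rewrite -[leLHS]invrK lef_pV2 ?posrE ?invr_gt0 ?expR_gt0 //; lra.
Qed.

Definition in_block a b (p : nat) := [&& prime p, a <= lnn p & lnn p < b].

(** A difference of two Mertens sums: 6 collects their errors 2 and 3, and a loss of 1 from rounding
    e^a down to an integer. *)
Lemma mertens_block_weighted a b N : 2 <= a -> a <= b ->
  \sum_(0 <= p < N | in_block a b p) lnn p / p%:R <= b - a + 6.
Proof.
move=> a2 ab.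
pose M := Num.truncn (expR b); pose m := Num.truncn (expR a).
have /andP[M1 M2] := truncn_itv (expR_ge0 b); rewrite -/M in M1 M2.
have /andP[m1 m2] := truncn_itv (expR_ge0 a); rewrite -/m in m1 m2.
have F0 p : 0 <= lnn p / p%:R by rewrite divr_ge0 ?lnn_ge0 ?ler0n.
have ea4 : 4 <= expR a.
  have e2 : 2 <= expR 1 :> R by have := @expR_ge1Dx R 1; lra.
  have : expR (1 + 1) <= expR a by rewrite ler_expR; lra.
  rewrite expRD; have : 2 * 2 <= expR 1 * expR 1 :> R by apply: ler_pM; lra.
  lra.
have m3 : (3 < m)%N.
  by rewrite -ltnS -(ltr_nat R); exact: le_lt_trans ea4 m2.
have mM : (m <= M)%N.
  rewrite -ltnS -(ltr_nat R); apply: le_lt_trans m1 _.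
  by apply: le_lt_trans M2; rewrite ler_expR.
have blk p : in_block a b p -> (m <= p < M.+1)%N.
  move=> /and3P[pp ap pb]; have p0 : 0 < p%:R :> R by rewrite ltr0n prime_gt0.
  rewrite -!(ltr_nat R) -(ler_nat R); apply/andP; split.
    by apply: le_trans m1 _; rewrite -[leRHS]lnK ?posrE // ler_expR.
  by apply: lt_trans M2; rewrite -[ltLHS]lnK ?posrE // ltr_expR.
have E : \sum_(0 <= p < N | in_block a b p) lnn p / p%:R <=
    \sum_(m <= p < M.+1 | prime p) lnn p / p%:R.
  apply: (@le_trans _ _ (\sum_(0 <= p < (N + M.+1)%N | in_block a b p) lnn p / p%:R)).
    rewrite [leRHS](@big_cat_nat _ _ _ N) //= ?leq_addr // lerDl.
    by apply: sumr_ge0.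
  rewrite (@big_cat_nat _ _ _ M.+1) //= ?leq_addl // [X in _ + X]big1_seq; last first.
    by move=> p; rewrite mem_index_iota => /andP[/blk]; lia.
  rewrite addr0 (@big_cat_nat _ _ _ m) //=; last lia.
  rewrite [X in X + _]big1_seq; last first.
    by move=> p; rewrite mem_index_iota => /andP[/blk]; lia.
  rewrite add0r big_mkcond [leRHS]big_mkcond /=; apply: ler_sum => p _.
  by case: ifP => [/and3P[->]|] //; case: ifP.
apply: le_trans E _.
have : mertens_sum R M = mertens_sum R m.-1 + \sum_(m <= p < M.+1 | prime p) lnn p / p%:R.
  by rewrite /mertens_sum prednK -?big_cat_nat //; lia.
have : mertens_sum R M <= lnn M + 2 by apply: mertens_sum_le; lia.
have : lnn m.-1 - 3 <= mertens_sum R m.-1 by apply: mertens_sum_ge; lia.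
have : lnn M <= b.
  by rewrite -[leRHS]expRK /lnn ler_ln ?posrE ?expR_gt0 ?ltr0n //; lia.
have : a - 1 <= lnn m.-1.
  have h : expR a <= m.-1%:R * 2.
    have : m.-1%:R = m%:R - 1 :> R by rewrite -subn1 natrB //; exact: leq_trans m3.
    move=> ->; have : m.+1%:R = m%:R + 1 :> R by rewrite natr1.
    have : 4 <= m%:R :> R by rewrite ler_nat.
    lra.
  have : a <= ln (m.-1%:R * 2) by rewrite -[leLHS]expRK ler_ln ?posrE ?expR_gt0 ?mulr_gt0 ?ltr0n //; lia.
  rewrite lnM ?posrE ?ltr0n //; last lia.
  have : ln 2 <= 2 - 1 :> R by apply: ln_le_sub1.
  rewrite -/(lnn m.-1); lra.
lra.
Qed.

Definition block_sum a b N : R := \sum_(0 <= p < N | in_block a b p) p%:R^-1.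

Lemma block_sum_le a b N : 2 <= a -> a <= b -> block_sum a b N <= (b - a + 6) / a.
Proof.
move=> a2 ab; have a0 : 0 < a by lra.
rewrite ler_pdivlMr //; apply: le_trans (mertens_block_weighted N a2 ab).
rewrite /block_sum mulr_suml; apply: ler_sum => p /and3P[_ ap _].
by rewrite mulrC ler_wpM2r // invr_ge0 ler0n.
Qed.

Lemma block_sum_cat a b c N : a <= b -> b <= c ->
  block_sum a c N <= block_sum a b N + block_sum b c N.
Proof.
move=> ab bc; rewrite /block_sum !(big_mkcond (in_block _ _)) -big_split /=.
apply: ler_sum => p _; rewrite /in_block.
have i0 : 0 <= p%:R^-1 :> R by rewrite invr_ge0 ler0n.
case: (prime p) => //=; last by rewrite addr0.
case: (leP a (lnn p)) => //= h1; case: (ltP (lnn p) c) => //= h2; case: (ltP (lnn p) b) => //= h3;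
  case: (leP b (lnn p)) => //= h4; rewrite ?addr0 ?add0r ?lerDl ?addr_ge0 //; lra.
Qed.

Lemma block_sum_geometric a mu K N : 2 <= a -> 1 <= mu ->
  block_sum a (mu ^+ K * a) N <= K%:R * (mu - 1 + 6 / a).
Proof.
move=> a2 mu1; have a0 : 0 < a by lra.
elim: K => [|K IH].
  rewrite expr0 mul1r mul0r /block_sum big1 // => p /and3P[_ h1 h2].
  by move: (le_lt_trans h1 h2); rewrite ltxx.
have muK : 1 <= mu ^+ K by apply: exprn_ege1.
set x := mu ^+ K in muK IH *.
have xa : a <= x * a by rewrite ler_peMl // ltW.
have xmu : x * a <= mu * (x * a) by rewrite ler_peMl //; lra.
rewrite exprS -mulrA; apply: le_trans (block_sum_cat _ xa xmu) _.
rewrite -natr1 mulrDl mul1r lerD //.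
apply: le_trans (block_sum_le _ _ xmu) _; first lra.
have x0 : 0 < x by lra.
have y0 : 0 < x * a by rewrite mulr_gt0.
move: (x * a) y0 xa {xmu} => y y0 xa.
have -> : (mu * y - y + 6) / y = mu - 1 + 6 / y by field; rewrite gt_eqF.
by rewrite lerD2l ler_wpM2l // lef_pV2 ?posrE.
Qed.

(* Mertens' second theorem on the range from e^a to e^(la), where it reads
   log l + o(1) uniformly for bounded l. *)
Lemma block_sum_mertens (La eps : R) : 1 < La -> 0 < eps -> exists2 a0, 2 <= a0 &
  forall a la N, a0 <= a -> 1 <= la -> la <= La ->
    block_sum a (la * a) N <= ln la + eps.
Proof.
move=> La1 e0; pose l := ln La; have l0 : 0 < l by rewrite ln_gt0.
(* The block is cut into [K] pieces of ratio mu = e^t with t = ln la / K. The first summand makes K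
   (mu - 1) exceed ln la by at most eps / 2, the second gives t <= 1/2; the threshold on [a] then
   makes the [K] terms 6 / a sum to at most eps / 2. *)
pose K := (Num.truncn (4 * l ^+ 2 / eps + 2 * l)).+1.
have q0 : 0 <= 4 * l ^+ 2 / eps by rewrite divr_ge0 ?mulr_ge0 ?sqr_ge0 // ltW.
have KK : 4 * l ^+ 2 / eps + 2 * l < K%:R.
  have z0 : 0 <= 4 * l ^+ 2 / eps + 2 * l by lra.
  by case/andP: (truncn_itv z0).
have K0 : 0 < K%:R :> R by rewrite ltr0n.
exists (2 + 12 * K%:R / eps); first by rewrite lerDl divr_ge0 ?mulr_ge0 // ltW.
move=> a la N aa la1 laL.
have p1 : 0 < 12 * K%:R / eps by rewrite divr_gt0 // mulr_gt0.
have a2 : 2 <= a by lra.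
pose x := ln la; have x0 : 0 <= x by rewrite ln_ge0.
have xl : x <= l by rewrite ler_ln ?posrE //; lra.
pose t := x / K%:R; have t0 : 0 <= t by rewrite divr_ge0 // ltW.
have t2 : t <= 2^-1 by rewrite ler_pdivrMr //; lra.
pose mu := expR t.
have mu1 : 1 <= mu by rewrite -expR0 ler_expR.
have muK : mu ^+ K = la.
  rewrite /mu -expRM_natl -[in RHS](@lnK _ la) ?posrE; last lra.
  by congr expR; rewrite /t -/x mulr_natl -mulr_natr divfK // gt_eqF.
rewrite -muK; apply: le_trans (block_sum_geometric _ _ a2 mu1) _; rewrite muK -/x.
have mut : mu - 1 <= t + 2 * t ^+ 2.
  have h1 : mu <= (1 - t)^-1 by apply: expR_le_inv; clear -t2; lra.
  suff h2 : (1 - t)^-1 <= 1 + t + 2 * t ^+ 2.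
    by have h3 := le_trans h1 h2; clear -h3; lra.
  rewrite -[leLHS]mul1r ler_pdivrMr; last by clear -t2; lra.
  rewrite -subr_ge0.
  have -> : (1 + t + 2 * t ^+ 2) * (1 - t) - 1 = t ^+ 2 * (1 - 2 * t) by ring.
  by rewrite mulr_ge0 ?sqr_ge0 //; clear -t2; lra.
have Kt : K%:R * t = x by rewrite /t mulrC divfK // gt_eqF.
have Ktt : K%:R * (2 * t ^+ 2) <= eps / 2.
  have -> : K%:R * (2 * t ^+ 2) = 2 * x ^+ 2 / K%:R.
    by rewrite /t; field; rewrite gt_eqF.
  rewrite ler_pdivrMr //.
  have h1 : x ^+ 2 <= l ^+ 2 by rewrite lerXn2r ?nnegrE // (le_trans x0).
  have h2 : 4 * l ^+ 2 <= K%:R * eps.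
    by rewrite -ler_pdivrMr //; clear -KK l0; lra.
  clear -h1 h2; lra.
have Ka : K%:R * (6 / a) <= eps / 2.
  rewrite mulrA ler_pdivrMr; last by clear -a2; lra.
  have h1 : 12 * K%:R / eps <= a by clear -aa; lra.
  by move: h1; rewrite ler_pdivrMr // => h1; clear -h1; lra.
rewrite mulrDr; apply: (@le_trans _ _ (K%:R * (t + 2 * t ^+ 2) + K%:R * (6 / a))).
  by rewrite lerD2r ler_pM2l.
rewrite mulrDr Kt; clear -Ktt Ka; lra.
Qed.

End mertens_blocks.

(** * The Brun-Hooley sieve *)

Section sieve_polynomials.
Variable R : realType.
Local Open Scope ring_scope.

(* A squarefree polynomial in variables indexed by primes: a list of monomials
   c * prod_(p in D) X_p.  Evaluated at the indicators of "p is bad for x", at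
   the densities, and (with absolute values) at the numbers of bad residues,
   it gives the sieve weight, its main term and its remainder. *)
Definition spol := seq (R * seq nat).
Implicit Types (l : spol) (v : nat -> R) (s : seq nat) (bl : seq (seq nat * nat)).

Definition sev v l : R := \sum_(t <- l) t.1 * \prod_(p <- t.2) v p.
Definition srem v l : R := \sum_(t <- l) `|t.1| * \prod_(p <- t.2) v p.
Definition smul l1 l2 : spol := [seq (t.1 * u.1, t.2 ++ u.2) | t <- l1, u <- l2].
Definition ssub l1 l2 : spol := l1 ++ [seq (- t.1, t.2) | t <- l2].

(** Inclusion-exclusion over the primes of [s], truncated after products of [b] primes. *)
Fixpoint bonferroni (b : nat) s : spol :=
  if s is p :: s' then
    if b is b'.+1 then bonferroni b s' ++ [seq (- t.1, p :: t.2) | t <- bonferroni b' s']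
    else [:: (1, [::])]
  else [:: (1, [::])].

Fixpoint elem_sym (i : nat) s : spol :=
  if i is i'.+1 then
    if s is p :: s' then elem_sym i s' ++ [seq (t.1, p :: t.2) | t <- elem_sym i' s']
    else [::]
  else [:: (1, [::])].

Lemma sev1 v : sev v [:: (1, [::])] = 1.
Proof. by rewrite /sev big_seq1 /= big_nil mulr1. Qed.

Lemma srem1 v : srem v [:: (1, [::])] = 1.
Proof. by rewrite /srem big_seq1 /= big_nil mulr1 normr1. Qed.

Lemma sev_cat v l1 l2 : sev v (l1 ++ l2) = sev v l1 + sev v l2.
Proof. by rewrite /sev big_cat. Qed.

Lemma srem_cat v l1 l2 : srem v (l1 ++ l2) = srem v l1 + srem v l2.
Proof. by rewrite /srem big_cat. Qed.

Lemma sev_smul v l1 l2 : sev v (smul l1 l2) = sev v l1 * sev v l2.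
Proof.
rewrite /sev /smul big_allpairs_dep mulr_suml; apply: eq_bigr => t _.
by rewrite mulr_sumr; apply: eq_bigr => u _; rewrite /= big_cat /=; ring.
Qed.

Lemma srem_smul v l1 l2 : srem v (smul l1 l2) = srem v l1 * srem v l2.
Proof.
rewrite /srem /smul big_allpairs_dep mulr_suml; apply: eq_bigr => t _.
by rewrite mulr_sumr; apply: eq_bigr => u _; rewrite /= big_cat normrM /=; ring.
Qed.

Lemma sev_ssub v l1 l2 : sev v (ssub l1 l2) = sev v l1 - sev v l2.
Proof.
rewrite sev_cat; congr (_ + _); rewrite /sev big_map -sumrN.
by apply: eq_bigr => t _; rewrite /= mulNr.
Qed.

Lemma srem_ssub v l1 l2 : srem v (ssub l1 l2) = srem v l1 + srem v l2.
Proof.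
rewrite srem_cat; congr (_ + _); rewrite /srem big_map.
by apply: eq_bigr => t _; rewrite /= normrN.
Qed.

Lemma sev_bonferroni_cons v b p s :
  sev v (bonferroni b.+1 (p :: s)) = sev v (bonferroni b.+1 s) - v p * sev v (bonferroni b s).
Proof.
rewrite [bonferroni _ _]/= sev_cat; congr (_ + _); rewrite /sev big_map mulr_sumr -sumrN.
by apply: eq_bigr => t _; rewrite /= big_cons; ring.
Qed.

Lemma srem_bonferroni_cons v b p s :
  srem v (bonferroni b.+1 (p :: s)) = srem v (bonferroni b.+1 s) + v p * srem v (bonferroni b s).
Proof.
rewrite [bonferroni _ _]/= srem_cat; congr (_ + _); rewrite /srem big_map mulr_sumr.
by apply: eq_bigr => t _; rewrite /= big_cons normrN; ring.
Qed.

Lemma sev_elem_sym_cons v i p s :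
  sev v (elem_sym i.+1 (p :: s)) = sev v (elem_sym i.+1 s) + v p * sev v (elem_sym i s).
Proof.
rewrite [elem_sym _ _]/= sev_cat; congr (_ + _); rewrite /sev big_map mulr_sumr.
by apply: eq_bigr => t _; rewrite /= big_cons; ring.
Qed.

Lemma srem_elem_sym_cons v i p s :
  srem v (elem_sym i.+1 (p :: s)) = srem v (elem_sym i.+1 s) + v p * srem v (elem_sym i s).
Proof.
rewrite [elem_sym _ _]/= srem_cat; congr (_ + _); rewrite /srem big_map mulr_sumr.
by apply: eq_bigr => t _; rewrite /= big_cons; ring.
Qed.

Lemma sev_elem_sym0 v s : sev v (elem_sym 0 s) = 1.
Proof. by case: s => [|p s]; rewrite /= sev1. Qed.

Lemma sev_elem_sym_nil v i : sev v (elem_sym i.+1 [::]) = 0.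
Proof. by rewrite /= /sev big_nil. Qed.

Lemma bonferroni0 s : bonferroni 0 s = [:: (1, [::])].
Proof. by case: s. Qed.

Lemma sev_bonferroniS v b s :
  sev v (bonferroni b.+1 s) = sev v (bonferroni b s) + (-1) ^+ b.+1 * sev v (elem_sym b.+1 s).
Proof.
elim: s b => [|p s IH] b.
  by rewrite sev_elem_sym_nil mulr0 addr0 /=; case: b.
rewrite sev_bonferroni_cons IH sev_elem_sym_cons.
case: b => [|b]; first by rewrite !bonferroni0 sev_elem_sym0 sev1 expr1; ring.
by rewrite sev_bonferroni_cons (IH b) !exprS; ring.
Qed.

Definition in01 v s := forall p, p \in s -> 0 <= v p <= 1.

Lemma in01_cons v p s : in01 v (p :: s) -> 0 <= v p <= 1 /\ in01 v s.
Proof.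
by move=> h; split=> [|q qs]; apply: h; rewrite inE ?eqxx // qs orbT.
Qed.

(** Bonferroni's inequalities for arbitrary weights in [0, 1], since they are applied to densities
    as well as to indicators. When a prime is added, the two truncations in the recursion have
    opposite parity and enter with opposite signs. *)
Lemma bonferroni_bounds v b s : in01 v s ->
  if odd b then sev v (bonferroni b s) <= \prod_(p <- s) (1 - v p)
  else \prod_(p <- s) (1 - v p) <= sev v (bonferroni b s).
Proof.
elim: s b => [|p s IH] b h.
  by rewrite big_nil; case: b => [|b] /=; rewrite sev1 //; case: ifP.
have [/andP[p0 p1] hs] := in01_cons h.
have P01 : 0 <= \prod_(p <- s) (1 - v p) <= 1.
  rewrite big_seq; apply: (big_ind (fun x => 0 <= x <= 1)).
  - by rewrite ler01 lexx.
  - by move=> x y /andP[x0 x1] /andP[y0 y1]; rewrite mulr_ge0 ?mulr_ile1.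
  - by move=> q /hs /andP[q0 q1]; rewrite subr_ge0 q1 gerBl.
case: b => [|b].
  rewrite /= sev1 big_cons; case/andP: P01 => P0 P1.
  by rewrite -[leRHS]mulr1; apply: ler_pM => //; lra.
rewrite sev_bonferroni_cons big_cons mulrBl mul1r; have := IH b hs; have := IH b.+1 hs.
rewrite /=; case: (odd b) => /= h1 h2.
  by apply: lerB => //; apply: ler_wpM2l.
by apply: lerB => //; apply: ler_wpM2l.
Qed.

Lemma elem_sym_ge0 v i s : in01 v s -> 0 <= sev v (elem_sym i s).
Proof.
elim: s i => [|p s IH] [|i] h; rewrite ?sev_elem_sym0 // ?sev_elem_sym_nil //.
have [/andP[p0 p1] hs] := in01_cons h.
by rewrite sev_elem_sym_cons addr_ge0 ?mulr_ge0 ?IH.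
Qed.

(** The first two binomial terms; they absorb the recursions of [elem_sym] and [bonferroni] when a
    prime is added. *)
Lemma bernoulli_pow (x y : R) n : 0 <= x -> 0 <= y ->
  x ^+ n.+1 + n.+1%:R * y * x ^+ n <= (x + y) ^+ n.+1.
Proof.
move=> x0 y0; elim: n => [|n IH]; first by rewrite !expr1 expr0; lra.
have := ler_wpM2l (addr_ge0 x0 y0) IH; rewrite -exprS => h; apply: le_trans h.
rewrite -subr_ge0.
have -> : (x + y) * (x ^+ n.+1 + n.+1%:R * y * x ^+ n) -
   (x ^+ n.+2 + n.+2%:R * y * x ^+ n.+1) = n.+1%:R * (y ^+ 2 * x ^+ n).
  by rewrite -[n.+2%:R]natr1 !exprS expr0; ring.
by rewrite !mulr_ge0 ?sqr_ge0 ?exprn_ge0.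
Qed.

Lemma elem_sym_le v i s : in01 v s ->
  sev v (elem_sym i s) <= (\sum_(p <- s) v p) ^+ i / i`!%:R.
Proof.
elim: s i => [|p s IH] i h.
  by case: i => [|i]; rewrite ?sev_elem_sym0 ?sev_elem_sym_nil ?expr0 ?fact0 ?divr1 // big_nil exprS mul0r mul0r.
have [/andP[p0 p1] hs] := in01_cons h.
case: i => [|i]; first by rewrite sev_elem_sym0 expr0 fact0 divr1.
rewrite sev_elem_sym_cons big_cons addrC; set S := \sum_(_ <- _) _ in IH *.
have S0 : 0 <= S by rewrite /S big_seq sumr_ge0 // => q /hs /andP[].
apply: (@le_trans _ _ (v p * (S ^+ i / i`!%:R) + S ^+ i.+1 / i.+1`!%:R)).
  by apply: lerD; [apply: ler_wpM2l => //; exact: IH|exact: IH].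
have f0 : 0 < i`!%:R :> R by rewrite ltr0n fact_gt0.
have := bernoulli_pow i S0 p0; rewrite [S + _]addrC factS natrM => hB.
have n0 : 0 < i.+1%:R :> R by rewrite ltr0n.
rewrite ler_pdivlMr ?mulr_gt0 //.
move: (i.+1%:R) (i`!%:R) n0 f0 hB => n f n0 f0 hB.
apply: le_trans hB; rewrite le_eqVlt; apply/orP; left; apply/eqP; field.
by rewrite !gt_eqF.
Qed.

Lemma srem_bonferroni_le v b s : (forall p, 0 <= v p) ->
  srem v (bonferroni b s) <= (1 + \sum_(p <- s) v p) ^+ b.
Proof.
move=> v0; elim: s b => [|p s IH] b.
  by case: b => [|b]; rewrite /= srem1 big_nil addr0 expr1n.
case: b => [|b]; first by rewrite /= srem1 expr0.
rewrite srem_bonferroni_cons big_cons; set S := \sum_(_ <- _) _ in IH *.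
have S0 : 0 <= S by rewrite sumr_ge0.
have x1 : 0 <= 1 + S by lra.
have -> : 1 + (v p + S) = (1 + S) + v p by ring.
apply: le_trans (bernoulli_pow b x1 (v0 p)).
apply: lerD; first exact: IH.
rewrite mulrC; apply: le_trans (ler_wpM2r (v0 p) (IH b)) _.
rewrite mulrC ler_wpM2r ?exprn_ge0 // ler_peMl // ?ler1n //.
Qed.

Lemma srem_elem_sym_le v b s : (forall p, 0 <= v p) ->
  srem v (elem_sym b s) <= (1 + \sum_(p <- s) v p) ^+ b.
Proof.
move=> v0; elim: s b => [|p s IH] b.
  by case: b => [|b]; rewrite /= ?srem1 big_nil addr0 expr1n // /srem big_nil.
case: b => [|b]; first by rewrite /= srem1 expr0.
rewrite srem_elem_sym_cons big_cons; set S := \sum_(_ <- _) _ in IH *.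
have S0 : 0 <= S by rewrite sumr_ge0.
have x1 : 0 <= 1 + S by lra.
have -> : 1 + (v p + S) = (1 + S) + v p by ring.
apply: le_trans (bernoulli_pow b x1 (v0 p)).
apply: lerD; first exact: IH.
rewrite mulrC; apply: le_trans (ler_wpM2r (v0 p) (IH b)) _.
rewrite mulrC ler_wpM2r ?exprn_ge0 // ler_peMl // ?ler1n //.
Qed.

Lemma srem_ge0 v l : (forall p, 0 <= v p) -> 0 <= srem v l.
Proof. by move=> v0; apply: sumr_ge0 => t _; rewrite mulr_ge0 // prodr_ge0. Qed.

Fixpoint upper_sieve bl : spol :=
  if bl is (s, b) :: bl' then smul (bonferroni b s) (upper_sieve bl') else [:: (1, [::])].

(** Unrolled: the product of the Bonferroni sums of all blocks minus, for each block, the same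
    product with the sum of that block replaced by its next elementary symmetric function. *)
Fixpoint lower_sieve bl : spol :=
  if bl is (s, b) :: bl' then
    ssub (smul (bonferroni b s) (lower_sieve bl')) (smul (elem_sym b.+1 s) (upper_sieve bl'))
  else [:: (1, [::])].

Definition block_primes bl := flatten [seq x.1 | x <- bl].
Definition even_blocks bl := all (fun x => ~~ odd x.2) bl.

Lemma in01_cat v s1 s2 : in01 v (s1 ++ s2) -> in01 v s1 /\ in01 v s2.
Proof. by move=> h; split=> p ps; apply: h; rewrite mem_cat ps ?orbT. Qed.

(* With 0 <= x <= u for the old indicator and y - e <= x' <= y for the new one,
   x' x = y x - (y - x') x >= y l - e u. *)
Lemma sieve_bounds v bl : even_blocks bl -> in01 v (block_primes bl) ->
  let P := \prod_(p <- block_primes bl) (1 - v p) in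
  sev v (lower_sieve bl) <= P /\ P <= sev v (upper_sieve bl).
Proof.
elim: bl => [|[s b] bl IH] /= ev h; first by rewrite big_nil sev1.
move: ev h => /andP[eb ev]; rewrite /block_primes /= => h.
have [hs hbl] := in01_cat h; have [IL IU] := IH ev hbl.
rewrite big_cat /= sev_ssub !sev_smul.
have P0 s' : in01 v s' -> 0 <= \prod_(p <- s') (1 - v p).
  move=> h'; rewrite big_seq; apply: prodr_ge0 => q /h' /andP[_].
  by rewrite subr_ge0.
have := bonferroni_bounds b hs; rewrite (negbTE eb) => y1.
have := bonferroni_bounds b.+1 hs; rewrite /= eb => y2.
rewrite sev_bonferroniS -signr_odd /= eb expr1 mulN1r in y2.
have e0 := elem_sym_ge0 b.+1 hs.
have x0 := P0 _ hs; have X0 := P0 _ hbl; rewrite -/(block_primes bl) in X0 *.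
set x' := \prod_(p <- s) _ in x0 y1 y2 *; set x := \prod_(p <- _) _ in X0 IL IU *.
set y := sev v (bonferroni b s) in y1 y2 *; set e := sev v (elem_sym b.+1 s) in y2 e0 *.
split; last by apply: ler_pM.
have y0 : 0 <= y by exact: le_trans y1.
apply: (@le_trans _ _ (y * x - e * x)); last first.
  by rewrite -mulrBl ler_wpM2r.
by apply: lerB; apply: ler_wpM2l.
Qed.

Lemma sev_upper_sieve v bl :
  sev v (upper_sieve bl) = \prod_(x <- bl) sev v (bonferroni x.2 x.1).
Proof.
elim: bl => [|[s b] bl IH] /=; first by rewrite big_nil sev1.
by rewrite sev_smul IH big_cons.
Qed.

(** Factoring out the upper sieve turns positivity of the main term into a condition on a sum with
    one ratio per block. *)
Lemma sev_lower_sieve v bl :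
  (forall x, x \in bl -> sev v (bonferroni x.2 x.1) != 0) ->
  sev v (lower_sieve bl) = sev v (upper_sieve bl) *
    (1 - \sum_(x <- bl) sev v (elem_sym x.2.+1 x.1) / sev v (bonferroni x.2 x.1)).
Proof.
elim: bl => [|[s b] bl IH] /= h; first by rewrite big_nil sev1 subr0 mul1r.
have h1 := h (s, b) (mem_head _ _).
rewrite sev_ssub !sev_smul big_cons /= IH => [|x xs]; last by apply: h; rewrite inE xs orbT.
set S := \sum_(_ <- _) _; set U := sev v (upper_sieve bl).
by move: h1 => /= h1; field.
Qed.

Lemma srem_upper_sieve v bl : (forall p, 0 <= v p) ->
  srem v (upper_sieve bl) <= \prod_(x <- bl) (1 + \sum_(p <- x.1) v p) ^+ x.2.
Proof.
move=> v0; elim: bl => [|[s b] bl IH] /=; first by rewrite big_nil srem1.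
by rewrite srem_smul big_cons ler_pM ?srem_ge0 ?srem_bonferroni_le.
Qed.

(** Each subtracted product has degree one higher in a single block, which costs one extra factor
    belonging to that block. *)
Lemma srem_lower_sieve v bl : (forall p, 0 <= v p) ->
  srem v (lower_sieve bl) <= \prod_(x <- bl) (1 + \sum_(p <- x.1) v p) ^+ x.2 *
    (1 + \sum_(x <- bl) (1 + \sum_(p <- x.1) v p)).
Proof.
move=> v0; elim: bl => [|[s b] bl IH] /=; first by rewrite !big_nil srem1 addr0 mulr1.
rewrite srem_ssub !srem_smul !big_cons /=.
set Y := 1 + \sum_(p <- s) v p.
have Y0 : 0 <= Y by rewrite addr_ge0 // sumr_ge0.
have hB : srem v (bonferroni b s) <= Y ^+ b by exact: srem_bonferroni_le.
have hE : srem v (elem_sym b.+1 s) <= Y ^+ b.+1 by exact: srem_elem_sym_le.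
have hU := srem_upper_sieve bl v0.
set Q := \prod_(_ <- bl) _ in hU IH *; set T := \sum_(_ <- bl) _ in IH *.
have -> : Y ^+ b * Q * (1 + (Y + T)) = Y ^+ b * (Q * (1 + T)) + Y ^+ b.+1 * Q.
  by rewrite exprS; ring.
by apply: lerD; apply: ler_pM; rewrite ?srem_ge0.
Qed.

End sieve_polynomials.

(** * Counting integers by their residues *)

Lemma card_count_iota (P : pred nat) n : #|[pred i : 'I_n | P i]| = count P (iota 0 n).
Proof.
have -> : iota 0 n = index_iota 0 n by rewrite /index_iota subn0.
by rewrite -sum1_card -sum1_count big_mkord.
Qed.

Lemma count_coprime (A B : pred nat) m n : 0 < m -> 0 < n -> coprime m n ->
    (forall x, A (x %% m) = A x) -> (forall x, B (x %% n) = B x) ->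
  count (predI A B) (iota 0 (m * n)) = count A (iota 0 m) * count B (iota 0 n).
Proof.
move=> m0 n0 mn hA hB; rewrite -!card_count_iota -cardX.
pose f (x : 'I_(m * n)) : 'I_m * 'I_n :=
  (Ordinal (ltn_pmod x m0), Ordinal (ltn_pmod x n0)).
have fI : injective f.
  move=> x y [e1 e2]; apply: val_inj => /=.
  have := chinese_remainder mn x y.
  by rewrite e1 e2 !eqxx /= !modn_small // => /eqP.
rewrite -(card_image fI); apply: eq_card => -[i j]; rewrite !inE /=.
have [g fg gf] : bijective f by apply: inj_card_bij; rewrite // card_prod !card_ord.
rewrite -(gf (i, j)); rewrite fintype.mem_image // inE /=.
have := congr1 (fun u : 'I_m * 'I_n => (val u.1, val u.2)) (gf (i, j)).
by move=> [<- <-] /=; rewrite hA hB.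
Qed.

Lemma count_period (P : pred nat) Q q r : (forall x, P (x %% Q) = P x) ->
  count P (iota 0 (q * Q + r)) = q * count P (iota 0 Q) + count P (iota 0 r).
Proof.
move=> hP; elim: q => [|q IH] //.
rewrite mulSn -addnA iotaD count_cat mulSn -addnA; congr (_ + _).
rewrite -IH add0n -[Q in iota Q]addn0 iotaDl count_map; apply: eq_count => x /=.
by rewrite -hP modnDl hP.
Qed.

Section sieve_counting.
Variables (R : realType) (bad : nat -> pred nat).
Hypothesis bad_mod : forall p x, bad p (x %% p) = bad p x.
Local Open Scope ring_scope.

Definition bad_residues p := count (bad p) (iota 0 p).
Definition bad_density p : R := (bad_residues p)%:R / p%:R.
Definition bad_ind x p : R := (bad p x)%:R.

Lemma bad_mod_all (D : seq nat) x :
  all (bad^~ (x %% \prod_(p <- D) p)%N) D = all (bad^~ x) D.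
Proof.
apply: eq_in_all => p pD /=; rewrite -bad_mod modn_dvdm ?bad_mod //.
by rewrite (big_rem p pD) /= dvdn_mulr.
Qed.

Lemma count_bad_all (D : seq nat) : uniq D -> all prime D ->
  count (fun x => all (bad^~ x) D) (iota 0 (\prod_(p <- D) p)) = (\prod_(p <- D) bad_residues p)%N.
Proof.
elim: D => [|p D IH] /=; first by rewrite !big_nil.
move=> /andP[pD uD] /andP[pp Dp]; rewrite !big_cons -(IH uD Dp).
have D0 : (0 < \prod_(q <- D) q)%N.
  by rewrite big_seq prodn_cond_gt0 // => q qD; rewrite prime_gt0 // (allP Dp).
apply: (@count_coprime (bad p) (fun x => all (bad^~ x) D)) => //.
- exact: prime_gt0.
- elim: D pD Dp {IH uD D0} => [|q D IH]; first by rewrite big_nil coprimen1.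
  rewrite inE negb_or /= => /andP[pq pD] /andP[qp Dp].
  by rewrite big_cons coprimeMr IH // andbT prime_coprime // dvdn_prime2.
- exact: bad_mod_all.
Qed.

(** Over complete periods the count is exact by the Chinese remainder theorem. On the incomplete
    last one both the count and its expected value lie between 0 and the number of bad classes. *)
Lemma count_bad_err (D : seq nat) X : uniq D -> all prime D ->
  `| (count (fun x => all (bad^~ x) D) (iota 0 X))%:R - X%:R * \prod_(p <- D) bad_density p |
    <= \prod_(p <- D) (bad_residues p)%:R.
Proof.
move=> uD Dp; set P := fun x => all _ D.
pose Q := (\prod_(p <- D) p)%N; pose N := (\prod_(p <- D) bad_residues p)%N.
have Q0 : (0 < Q)%N.
  by rewrite /Q big_seq prodn_cond_gt0 // => q qD; rewrite prime_gt0 // (allP Dp).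
have hP x : P (x %% Q)%N = P x by exact: bad_mod_all.
have -> : \prod_(p <- D) (bad_residues p)%:R = N%:R :> R by rewrite /N natr_prod.
have -> : \prod_(p <- D) bad_density p = N%:R / Q%:R :> R.
  rewrite /bad_density prodf_div; congr (_ / _); first by rewrite /N natr_prod.
  by rewrite /Q natr_prod.
have Q0' : 0 < Q%:R :> R by rewrite ltr0n.
have cQ : count P (iota 0 Q) = N by exact: count_bad_all.
pose r := (X %% Q)%N; pose q := (X %/ Q)%N.
have XE : X = (q * Q + r)%N by exact: divn_eq.
have rQ : (r < Q)%N by exact: ltn_pmod.
have cr : (count P (iota 0 r) <= N)%N.
  by rewrite -cQ -[Q](subnKC (ltnW rQ)) iotaD count_cat leq_addr.
rewrite {1}XE count_period // cQ natrD natrM.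
have -> : X%:R * (N%:R / Q%:R) = q%:R * N%:R + r%:R / Q%:R * N%:R :> R.
  by rewrite XE natrD natrM; field; rewrite gt_eqF.
have rq : 0 <= (r%:R / Q%:R : R) <= 1.
  by rewrite divr_ge0 //= ler_pdivrMr // mul1r ler_nat ltnW.
have N0 : 0 <= N%:R :> R by [].
have c0 : 0 <= (count P (iota 0 r))%:R :> R by [].
have cN : (count P (iota 0 r))%:R <= N%:R :> R by rewrite ler_nat.
case/andP: rq => rq0 rq1.
have t0 : 0 <= (r%:R / Q%:R * N%:R : R) by rewrite mulr_ge0.
have t1 : (r%:R / Q%:R * N%:R : R) <= N%:R by rewrite ler_piMl.
move: (r%:R / Q%:R * N%:R : R) ((count P (iota 0 r))%:R : R) t0 t1 c0 cN => t c t0 t1 c0 cN.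
by rewrite ler_norml; apply/andP; clear -t0 t1 c0 cN; split; lra.
Qed.

(** Squarefree monomials in the variables of [S]: the case in which [count_bad_err] applies to each
    monomial. *)
Definition swf (S : seq nat) (l : spol R) :=
  all (fun t : R * seq nat => uniq t.2 && all (mem S) t.2) l.

Lemma swf_cat S l1 l2 : swf S (l1 ++ l2) = swf S l1 && swf S l2.
Proof. exact: all_cat. Qed.

Lemma swf_sub S1 S2 l : {subset S1 <= S2} -> swf S1 l -> swf S2 l.
Proof.
move=> S12; apply: sub_all => t /andP[-> h] /=.
by apply: sub_all h => p; exact: S12.
Qed.

Lemma swf_consv S p l (f : R -> R) : p \notin S -> swf S l ->
  swf (p :: S) [seq (f t.1, p :: t.2) | t <- l].
Proof.
move=> pS /allP h; apply/allP => _ /mapP[t /h /andP[ut tS] ->] /=.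
rewrite ut mem_head andbT /=; apply/andP; split.
  by apply: contra pS => /(allP tS).
by apply/allP => q /(allP tS) /= qS; rewrite inE qS orbT.
Qed.

Lemma swf_bonferroni b S : uniq S -> swf S (bonferroni R b S).
Proof.
elim: S b => [|p S IH] [|b] //= /andP[pS uS].
rewrite swf_cat swf_consv ?IH // andbT.
by apply: swf_sub (IH b.+1 uS) => q qS; rewrite inE qS orbT.
Qed.

Lemma swf_elem_sym b S : uniq S -> swf S (elem_sym R b S).
Proof.
elim: S b => [|p S IH] [|b] //= /andP[pS uS].
rewrite swf_cat (@swf_consv S p _ id) ?IH // andbT.
by apply: swf_sub (IH b.+1 uS) => q qS; rewrite inE qS orbT.
Qed.

Lemma swf_smul S1 S2 l1 l2 : uniq (S1 ++ S2) -> swf S1 l1 -> swf S2 l2 ->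
  swf (S1 ++ S2) (smul l1 l2).
Proof.
rewrite cat_uniq => /and3P[_ /hasPn dis _] /allP h1 /allP h2.
apply/allP => _ /allpairsP[[t u] /= [/h1 /andP[ut tS] /h2 /andP[uu uS] ->]] /=.
rewrite cat_uniq ut uu andbT /= all_cat; apply/and3P; split.
- apply/hasPn => q /(allP uS) /dis /=; apply: contra; exact: (allP tS).
- by apply: sub_all tS => q /= qS; rewrite mem_cat qS.
- by apply: sub_all uS => q /= qS; rewrite mem_cat qS orbT.
Qed.

Lemma swf_ssub S l1 l2 : swf S l1 -> swf S l2 -> swf S (ssub l1 l2).
Proof. by move=> h1 h2; rewrite /ssub swf_cat h1 /= /swf all_map. Qed.

Lemma swf_sieve bl : uniq (block_primes bl) ->
  swf (block_primes bl) (upper_sieve R bl) && swf (block_primes bl) (lower_sieve R bl).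
Proof.
elim: bl => [|[s b] bl IH] //=; rewrite /block_primes /= -/(block_primes bl) => u.
move: (u); rewrite cat_uniq => /and3P[us _ ubl]; have /andP[h1 h2] := IH ubl.
rewrite swf_smul ?swf_bonferroni // swf_ssub // swf_smul //.
  exact: swf_bonferroni.
exact: swf_elem_sym.
Qed.

Lemma sum_sev_err S (l : spol R) X : all prime S -> swf S l ->
  `| \sum_(0 <= x < X) sev (bad_ind x) l - X%:R * sev bad_density l |
    <= srem (fun p => (bad_residues p)%:R) l.
Proof.
move=> Sp wf; rewrite /sev exchange_big mulr_sumr -sumrB.
apply: le_trans (ler_norm_sum _ _ _) _; rewrite /srem big_seq [leRHS]big_seq.
apply: ler_sum => t /(allP wf) /andP[ut tS].
have tp : all prime t.2 by apply/allP => p /(allP tS) /(allP Sp).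
rewrite -mulr_sumr mulrCA -mulrBr normrM ler_wpM2l //.
apply: le_trans (count_bad_err X ut tp); rewrite le_eqVlt; apply/orP; left; apply/eqP.
congr (`|_ - _|).
have -> : (count (fun x => all (bad^~ x) t.2) (iota 0 X))%:R =
    \sum_(0 <= x < X) (all (bad^~ x) t.2)%:R :> R.
  rewrite -sum1_count natr_sum big_mkcond /= /index_iota subn0.
  by apply: eq_bigr => x _; case: ifP.
apply: eq_bigr => x _.
elim: (t.2) => [|p D IH]; first by rewrite big_nil.
by rewrite big_cons IH /= /bad_ind; case: (bad p x); rewrite /= ?mul1r ?mul0r.
Qed.

(** If every x < X had a bad prime, the exact product, and so the lower sieve, would be nonpositive
    at every x; but its sum is at least main term minus remainder. *)
Lemma sieve_exists bl X : even_blocks bl -> uniq (block_primes bl) ->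
    all prime (block_primes bl) ->
    srem (fun p => (bad_residues p)%:R) (lower_sieve R bl) <
      X%:R * sev bad_density (lower_sieve R bl) ->
  exists2 x, (x < X)%N & forall p, p \in block_primes bl -> ~~ bad p x.
Proof.
move=> ev u pr lt.
have /andP[_ wf] := swf_sieve u.
have err := sum_sev_err X pr wf.
set T := \sum_(0 <= x < X) _ in err.
have T0 : 0 < T.
  move: err; rewrite distrC => /(le_trans (ler_norm _)) err.
  by rewrite -(ltrD2l (X%:R * sev bad_density (lower_sieve R bl) - T)) addr0 subrK; apply: le_lt_trans lt.
case: (boolP (has (fun x => all (fun p => ~~ bad p x) (block_primes bl)) (iota 0 X))).
  move=> /hasP[x]; rewrite mem_iota add0n => /andP[_ xX] /allP h.
  by exists x => // p /h.
move=> /hasPn h; have : T <= 0; last by rewrite leNgt T0.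
rewrite /T /index_iota subn0 big_seq; apply: sumr_le0 => x xX.
have /allPn [p pbl bp] := h x xX; rewrite negbK in bp.
have i01 : in01 (bad_ind x) (block_primes bl).
  by move=> q _; rewrite /bad_ind; case: (bad q x); rewrite ?ler01 ?lexx.
apply: le_trans (sieve_bounds ev i01).1 _.
by rewrite (big_rem p) //= /bad_ind bp subrr mul0r.
Qed.

End sieve_counting.

(** * Densities on one block of primes *)

Section block_estimates.
Variable R : realType.
Local Open Scope ring_scope.
Implicit Types (v : nat -> R) (s : seq nat).

Lemma elem_sym_small v i s : (size s < i)%N -> sev v (elem_sym R i s) = 0.
Proof.
elim: s i => [|p s IH] [|i] //; first by rewrite sev_elem_sym_nil.
by rewrite ltnS => h; rewrite sev_elem_sym_cons !IH ?mulr0 ?addr0 // ltnW.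
Qed.

Lemma sev_elem_sym1 v s : sev v (elem_sym R 1 s) = \sum_(p <- s) v p.
Proof.
elim: s => [|p s IH]; first by rewrite sev_elem_sym_nil big_nil.
by rewrite sev_elem_sym_cons sev_elem_sym0 IH big_cons mulr1 addrC.
Qed.

Lemma sev_elem_sym2 v s :
  sev v (elem_sym R 2 s) * 2 = (\sum_(p <- s) v p) ^+ 2 - \sum_(p <- s) v p ^+ 2.
Proof.
elim: s => [|p s IH]; first by rewrite sev_elem_sym_nil !big_nil; ring.
rewrite sev_elem_sym_cons sev_elem_sym1 !big_cons mulrDl IH; ring.
Qed.

(** The truncated sum is 1 - S + e with 2 e = S^2 - Q, where the sum of squares Q is at most eta.
    Since 1 - S + S^2 / 2 decreases for S <= 1, L may replace S. *)
Lemma bonferroni2_ge v s (eta L : R) : in01 v s -> (forall p, p \in s -> v p <= eta) ->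
  0 <= eta -> \sum_(p <- s) v p <= L -> L <= 1 ->
  1 - L + L ^+ 2 / 2 - eta / 2 <= sev v (bonferroni R 2 s).
Proof.
move=> h he eta0 SL L1.
rewrite !sev_bonferroniS bonferroni0 sev1 expr1 -signr_odd /= expr0 mulN1r mul1r sev_elem_sym1.
have := sev_elem_sym2 v s; set S := \sum_(p <- s) v p in SL *.
have S0 : 0 <= S by rewrite /S big_seq sumr_ge0 // => p /h /andP[].
have sq : \sum_(p <- s) v p ^+ 2 <= eta * S.
  rewrite mulr_sumr big_seq [leRHS]big_seq; apply: ler_sum => p ps.
  by have /andP[v0 _] := h p ps; rewrite expr2 ler_wpM2r ?he.
set Q := \sum_(p <- s) _ in sq *; set e := sev _ _ => he2.
have e0 : e = (S ^+ 2 - Q) / 2 by rewrite -he2 mulfK // pnatr_eq0.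
have q2 : Q <= eta.
  by apply: le_trans sq _; rewrite ler_piMr //; clear -SL L1; lra.
have m : 0 <= (L - S) * (2 - L - S) by rewrite mulr_ge0 //; clear -SL L1; lra.
rewrite -subr_ge0 e0.
have -> : 1 - S + (S ^+ 2 - Q) / 2 - (1 - L + L ^+ 2 / 2 - eta / 2) =
   ((L - S) * (2 - L - S) + (eta - Q)) / 2 by field.
by rewrite divr_ge0 // addr_ge0 // subr_ge0.
Qed.

Lemma expRN_le_1B (x eta : R) : 0 <= x -> x <= eta -> eta <= 2^-1 ->
  expR (- ((1 + 2 * eta) * x)) <= 1 - x.
Proof.
move=> x0 xe e2; have x1 : 0 < 1 - x by clear -xe e2; lra.
have h1 : expR (- (x / (1 - x))) <= 1 - x.
  rewrite expRN -[leRHS]invrK lef_pV2 ?posrE ?invr_gt0 ?expR_gt0 //.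
  apply: le_trans (expR_ge1Dx _).
  have -> : 1 + x / (1 - x) = (1 - x)^-1 by field; rewrite gt_eqF.
  exact: lexx.
apply: le_trans h1; rewrite ler_expR lerN2 ler_pdivrMr // mulrAC -subr_ge0.
have -> : (1 + 2 * eta) * (1 - x) * x - x = (2 * (eta - x) + x * (1 - 2 * eta)) * x by ring.
apply: mulr_ge0 => //; apply: addr_ge0; first by clear -xe; lra.
by apply: mulr_ge0 => //; clear -e2; lra.
Qed.

Lemma prod_1B_ge v s (eta : R) : (forall p, 0 <= v p) ->
    (forall p, p \in s -> v p <= eta) -> eta <= 2^-1 ->
  expR (- ((1 + 2 * eta) * \sum_(p <- s) v p)) <= \prod_(p <- s) (1 - v p).
Proof.
move=> v0; elim: s => [|p s IH] h e2; first by rewrite !big_nil mulr0 oppr0 expR0.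
rewrite !big_cons mulrDr opprD expRD.
have hs q : q \in s -> v q <= eta by move=> qs; apply: h; rewrite inE qs orbT.
by rewrite ler_pM ?expR_ge0 ?IH ?expRN_le_1B ?h ?mem_head.
Qed.

Lemma block_ok (kappa : nat) (theta : R) : (0 < kappa)%N -> 0 < theta -> theta <= 1 ->
  exists2 a0, 2 <= a0 & forall (a la : R) N v, a0 <= a -> 1 <= la -> la <= 4 ->
    (forall p, 0 <= v p) -> (forall p, prime p -> v p <= kappa%:R / p%:R) ->
    let s := [seq p <- iota 0 N | in_block a (la * a) p] in
    [/\ \sum_(p <- s) v p <= kappa%:R * (ln la + theta / 2),
        forall p, p \in s -> v p <= theta / 16 &
        expR (- (kappa%:R * (ln la + theta))) <= \prod_(p <- s) (1 - v p)].
Proof.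
move=> k0 t0 t1; have k0' : 0 < kappa%:R :> R by rewrite ltr0n.
have th2 : 0 < theta / 2 by clear -t0; lra.
have l14 : 1 < 4 :> R by lra.
have [a1 a12 a1P] := block_sum_mertens l14 th2.
(* The second threshold makes each density on the block at most kappa / p <= theta / 16, so that 1 -
   v is close to exp (- v). *)
exists (Num.max a1 (ln (16 * kappa%:R / theta))); first by rewrite le_max a12.
move=> a la N v; rewrite ge_max => /andP[aa1 aa2] la1 la4 v0 vk s.
have sum1 : \sum_(p <- s) v p <= kappa%:R * (ln la + theta / 2).
  apply: le_trans (_ : kappa%:R * block_sum a (la * a) N <= _); last first.
    by rewrite ler_pM2l // a1P.
  rewrite /s big_filter /block_sum mulr_sumr /index_iota subn0.
  by apply: ler_sum => p /and3P[pp _ _]; exact: vk.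
have small p : p \in s -> v p <= theta / 16.
  rewrite mem_filter => /andP[/and3P[pp ap _] _]; apply: le_trans (vk p pp) _.
  have p0 : 0 < p%:R :> R by rewrite ltr0n prime_gt0.
  have q0 : 0 < 16 * kappa%:R / theta by rewrite divr_gt0 // mulr_gt0.
  have : 16 * kappa%:R / theta <= p%:R.
    by rewrite -ler_ln ?posrE //; apply: le_trans aa2 _.
  rewrite ler_pdivrMr // => h; rewrite ler_pdivrMr //.
  by clear -h; lra.
split=> //.
have e2 : theta / 16 <= 2^-1 by clear -t1; lra.
apply: le_trans (prod_1B_ge v0 small e2); rewrite ler_expR lerN2.
have l0 : 0 <= ln la by rewrite ln_ge0.
have l2 : ln la <= 2.
  apply: (le_trans _ (lnn4 R)); rewrite /lnn ler_ln ?posrE //.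
  by clear -la1; lra.
have c0 : 0 <= 1 + 2 * (theta / 16) by clear -t0; lra.
apply: le_trans (ler_wpM2l c0 sum1) _; rewrite mulrCA ler_pM2l //.
have m : ln la * theta <= 2 * theta by rewrite ler_wpM2r // ltW.
have m2 : theta * theta <= theta by rewrite ler_piMr // ltW.
have -> : (1 + 2 * (theta / 16)) * (ln la + theta / 2) =
  ln la + theta / 2 + ln la * theta / 8 + theta * theta / 16 by field.
by clear -m m2 t0; lra.
Qed.

End block_estimates.

Lemma expR_gt_poly (R : realType) (c C : R) (m : nat) : (0 < c)%R ->
  exists2 Y : R, (1 <= Y)%R & forall y, (Y <= y)%R -> (C * y ^+ m < expR (c * y))%R.
Proof.
move=> c0; pose d := (c / m.+1%:R)%R.
have d0 : (0 < d)%R by rewrite divr_gt0 // ltr0n.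
exists (1 + `|C| / d ^+ m.+1)%R; first by rewrite lerDl divr_ge0 // exprn_ge0 // ltW.
move=> y yY; have D0 : (0 < d ^+ m.+1)%R by rewrite exprn_gt0.
have q0 : (0 <= `|C| / d ^+ m.+1)%R by rewrite divr_ge0 // ltW.
have y0 : (0 < y)%R by clear -yY q0; lra.
have -> : (c * y = m.+1%:R * (d * y))%R.
  by rewrite /d mulrA mulrCA mulfV ?mulr1 // pnatr_eq0.
rewrite expRM_natl.
have h : ((d * y) ^+ m.+1 <= expR (d * y) ^+ m.+1)%R.
  have dy : (0 <= d * y)%R by rewrite ltW // mulr_gt0.
  rewrite lerXn2r ?nnegrE ?expR_ge0 //.
  by apply: le_trans (expR_ge1Dx _); rewrite lerDr.
apply: lt_le_trans h; rewrite exprMn [(y ^+ m.+1)%R]exprS mulrA ltr_pM2r ?exprn_gt0 //.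
apply: (@le_lt_trans _ _ `|C|%R); first exact: ler_norm.
rewrite -ltr_pdivrMl // mulrC; clear -yY; lra.
Qed.

Lemma lnn_unbounded (R : realType) (Y : R) :
  exists Z : nat, forall z, (Z <= z)%N -> (Y <= lnn R z)%R.
Proof.
exists (Num.truncn (expR Y)).+1 => z Zz.
have /andP[_ h] := truncn_itv (expR_ge0 Y).
have z0 : (0 < z)%N by exact: leq_ltn_trans Zz.
have hz : (expR Y <= z%:R)%R by apply: le_trans (ltW h) _; rewrite ler_nat.
by rewrite -[leLHS]expRK ler_ln ?posrE ?expR_gt0 ?ltr0n.
Qed.

(** * The Brun-Hooley sieve with a growing number of blocks *)

Section brun_hooley.
Variable R : realType.
Local Open Scope ring_scope.
Variables (kappa : nat) (theta delta B : R) (lam : nat -> R) (bb : nat -> nat) (Slow : nat -> R).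

(** Block i will hold the primes from z^(1 / scale (i + 1)) to z^(1 / scale i), so [lam i] is the
    ratio of the logarithms of its ends. By Mertens [ell i] bounds the sum of its densities, with
    [theta] absorbing the error. *)
Definition scale (i : nat) : R := \prod_(0 <= j < i) lam j.
Definition ell (i : nat) : R := kappa%:R * (ln (lam i) + theta).

Hypotheses (k0 : (0 < kappa)%N) (t0 : 0 < theta) (t1 : theta <= 1) (d0 : 0 < delta).
Hypothesis lamP : forall i, [/\ theta <= ln (lam i), 1 < lam i & lam i <= 4].
Hypothesis bbE : forall i, ~~ odd (bb i).
(* Lower bounds for the truncated inclusion-exclusion sums of the blocks. *)
Hypothesis SlowP : forall i, 0 < Slow i /\
  [\/ bb i = 0%N /\ Slow i <= 1,
      [/\ bb i = 2, ell i <= 1 & Slow i + theta <= 1 - ell i + ell i ^+ 2 / 2] |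
      Slow i <= expR (- ell i)].
(** Bounds the ratios of [sev_lower_sieve] uniformly in the number of blocks, so that a fraction
    [delta] of the main term survives. *)
Hypothesis errP : forall r,
  \sum_(0 <= i < r) ell i ^+ (bb i).+1 / (bb i).+1`!%:R / Slow i <= 1 - delta.
(** Block i, with at most z^(1 / scale i) primes taken [bb i] at a time, brings about z^(bb i /
    scale i) into the remainder. *)
Hypothesis levelP : forall r, \sum_(0 <= i < r) (bb i)%:R / scale i <= B.

Lemma lam_gt0 i : 0 < lam i. Proof. by have [_ h _] := lamP i; exact: lt_trans h. Qed.
Lemma scale_gt0 i : 0 < scale i. Proof. by apply: prodr_gt0 => j _; exact: lam_gt0. Qed.
Lemma scaleS i : scale i.+1 = scale i * lam i. Proof. by rewrite /scale big_nat_recr. Qed.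

Lemma ln_scale r : ln (scale r) = \sum_(0 <= i < r) ln (lam i).
Proof.
elim: r => [|r IH]; first by rewrite /scale !big_nil ln1.
by rewrite big_nat_recr //= scaleS lnM ?posrE ?scale_gt0 ?lam_gt0 // IH.
Qed.

(** The scales grow geometrically, so finitely many blocks bring the primes down to any given
    bound. *)
Lemma theta_scale r : r%:R * theta <= ln (scale r).
Proof.
rewrite ln_scale -[r in r%:R]subn0 -[r in (r - 0)%N]subn0 mulr_natl -sumr_const_nat subn0.
by apply: ler_sum => i _; have [] := lamP i.
Qed.

Section fixed_z.
Variables (z : nat) (a0 : R) (rho : nat -> nat).
Hypothesis rhoP : forall p, prime p -> (rho p <= kappa)%N /\ (rho p < p)%N.
Let y := lnn R z.
Let u i := y / scale i.
Let g p : R := (rho p)%:R / p%:R.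

Definition block_seq i := [seq p <- iota 0 z | in_block (y / scale i.+1) (y / scale i) p].

Lemma block_seqE i :
  block_seq i = [seq p <- iota 0 z | in_block (u i.+1) (lam i * u i.+1) p].
Proof.
rewrite /block_seq; suff -> : y / scale i = lam i * u i.+1 by [].
have s0 := scale_gt0 i; have l0 := lam_gt0 i; rewrite /u scaleS.
by field; rewrite !gt_eqF.
Qed.

Definition block_cat r := flatten [seq block_seq i | i <- iota 0 r].

Lemma block_catS r : block_cat r.+1 = block_cat r ++ block_seq r.
Proof. by rewrite /block_cat -[in LHS]addn1 iotaD map_cat flatten_cat /= cats0. Qed.

Lemma mem_blocks r : 0 <= y ->
  uniq (block_cat r) /\ forall p, (p \in block_cat r) = (p < z)%N && in_block (u r) (u 0) p.
Proof.
move=> y0; elim: r => [|r [uF mF]].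
  split=> // p; rewrite in_nil; symmetry; apply/negbTE/negP => /andP[_ /and3P[_ h1 h2]].
  by have := le_lt_trans h1 h2; rewrite ltxx.
rewrite block_catS.
have mem_s p : (p \in block_seq r) = (p < z)%N && in_block (u r.+1) (u r) p.
  by rewrite mem_filter mem_iota add0n /= andbC.
have ur : u r.+1 <= u r.
  rewrite /u ler_wpM2l // lef_pV2 ?posrE ?scale_gt0 // scaleS ler_peMr ?ltW ?scale_gt0 //.
  by have [_ h _] := lamP r.
have ur0 : u r <= u 0.
  rewrite /u ler_wpM2l // lef_pV2 ?posrE ?scale_gt0 // {1}/scale big_nil.
  by rewrite -ler_ln ?posrE ?scale_gt0 // ln1; apply: le_trans (theta_scale r); rewrite mulr_ge0 // ltW.
split.
  rewrite cat_uniq uF filter_uniq ?iota_uniq // andbT /=.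
  apply/hasPn => p; rewrite mem_s => /andP[_ /and3P[_ _ h]].
  by rewrite mF; apply/negP => /andP[_ /and3P[_ /(lt_le_trans h)]]; rewrite ltxx.
move=> p; rewrite mem_cat mF mem_s -andb_orr; congr (_ && _).
rewrite /in_block; case: (prime p) => //=.
case: (leP (u r) (lnn R p)) => h1; case: (ltP (lnn R p) (u 0)) => h2;
  rewrite ?andbT ?andbF ?orbF ?orbT //=.
  by rewrite (le_trans ur h1).
by have := lt_le_trans h1 (le_trans ur0 h2); rewrite ltxx.
Qed.

Hypothesis blockOK : forall (a la : R) N (v : nat -> R), a0 <= a -> 1 <= la -> la <= 4 ->
  (forall p, 0 <= v p) -> (forall p, prime p -> v p <= kappa%:R / p%:R) ->
  let s := [seq p <- iota 0 N | in_block a (la * a) p] in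
  [/\ \sum_(p <- s) v p <= kappa%:R * (ln la + theta / 2),
      forall p, p \in s -> v p <= theta / 16 &
      expR (- (kappa%:R * (ln la + theta))) <= \prod_(p <- s) (1 - v p)].

Lemma g_ge0 p : 0 <= g p. Proof. by rewrite divr_ge0. Qed.

Lemma g_in01 s : all prime s -> in01 g s.
Proof.
move=> /allP sp p /sp pp; rewrite g_ge0 /= ler_pdivrMr ?ltr0n ?prime_gt0 // mul1r ler_nat.
by rewrite ltnW // (rhoP pp).2.
Qed.

Lemma block_seq_prime i : all prime (block_seq i).
Proof. by apply/allP => p; rewrite mem_filter => /andP[/andP[]]. Qed.

(** The truncated sum is 1 for b = 0 and obeys the quadratic bound for b = 2; in the remaining case,
    b being even, it is at least the full product and hence exp (- ell i). *)
Lemma block_seq_est i : a0 <= u i.+1 ->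
  [/\ Slow i <= sev g (bonferroni R (bb i) (block_seq i)),
      sev g (elem_sym R (bb i).+1 (block_seq i)) <= ell i ^+ (bb i).+1 / (bb i).+1`!%:R &
      expR (- ell i) <= \prod_(p <- block_seq i) (1 - g p)].
Proof.
move=> ai; have [thi l1 l4] := lamP i.
have gk p : prime p -> g p <= kappa%:R / p%:R.
  move=> pp; rewrite ler_wpM2r ?invr_ge0 // ler_nat; exact: (rhoP pp).1.
have g01 := g_in01 (block_seq_prime i).
have [] := blockOK z ai (ltW l1) l4 g_ge0 gk; rewrite -block_seqE => S1 small P1.
set S := \sum_(p <- _) _ in S1.
have S0 : 0 <= S by apply: sumr_ge0 => p _; exact: g_ge0.
have Sl : S <= ell i.
  apply: le_trans S1 _; rewrite ler_pM2l ?ltr0n // lerD2l.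
  by have h0 := t0; lra.
split=> //.
- have [_] := SlowP i; case=> [[-> h]|[-> h1 h2]|h].
  + by rewrite bonferroni0 sev1.
  + have e0 : 0 <= theta / 16 by have h0 := t0; lra.
    apply: le_trans (bonferroni2_ge g01 small e0 Sl h1).
    by have h0 := t0; lra.
  apply: le_trans h _; apply: le_trans P1 _.
  by have := bonferroni_bounds (bb i) g01; rewrite (negbTE (bbE i)).
- apply: le_trans (elem_sym_le (bb i).+1 g01) _.
  rewrite ler_wpM2r ?invr_ge0 // lerXn2r ?nnegrE //; exact: le_trans Sl.
Qed.

Lemma u_antimono i j : (i <= j)%N -> 0 <= y -> u j <= u i.
Proof.
move=> ij y0; rewrite /u ler_wpM2l // lef_pV2 ?posrE ?scale_gt0 //.
elim: j ij => [|j IH]; first by rewrite leqn0 => /eqP ->.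
rewrite leq_eqVlt => /predU1P[-> //|]; rewrite ltnS => /IH h; apply: le_trans h _.
by rewrite scaleS ler_peMr ?ltW ?scale_gt0 //; have [_ h _] := lamP j.
Qed.

Variables (r M0 : nat).
Hypotheses (y0 : 0 < y) (ar : a0 <= u r) (M0P : forall p, prime p -> lnn R p < u r -> (p < M0)%N).

Definition small_seq := [seq p <- iota 0 z | prime p && (lnn R p < y / scale r)].

(** Primes too small for Mertens' estimate form one last block. It has at most [M0] elements, so
    truncation at 2 M0 is full inclusion-exclusion and causes no error; doubling keeps the
    truncation even. *)
Definition sieve_blocks :=
  [seq (block_seq i, bb i) | i <- iota 0 r] ++ [:: (small_seq, M0.*2)].

Lemma block_primes_sieve : block_primes sieve_blocks = block_cat r ++ small_seq.
Proof.
rewrite /block_primes /sieve_blocks map_cat flatten_cat /= cats0 -map_comp.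
by congr (flatten _ ++ _); apply: eq_map.
Qed.

Lemma sieve_blocks_even : even_blocks sieve_blocks.
Proof.
rewrite /even_blocks all_cat /= odd_double !andbT.
by apply/allP => _ /mapP[i _ ->] /=; exact: bbE.
Qed.

Lemma sieve_blocks_uniq : uniq (block_primes sieve_blocks).
Proof.
have [uF mF] := mem_blocks r (ltW y0).
rewrite block_primes_sieve cat_uniq uF filter_uniq ?iota_uniq // andbT /=.
apply/hasPn => p; rewrite mem_filter => /andP[/andP[_ h] _].
by rewrite mF; apply/negP => /andP[_ /and3P[_ /(lt_le_trans h)]]; rewrite ltxx.
Qed.

Lemma sieve_blocks_prime : all prime (block_primes sieve_blocks).
Proof.
have [_ mF] := mem_blocks r (ltW y0).
rewrite block_primes_sieve; apply/allP => p; rewrite mem_cat mF mem_filter.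
by move=> /orP[/andP[_ /and3P[]]|/andP[/andP[]]].
Qed.

Lemma mem_sieve_blocks p : prime p -> (p < z)%N -> p \in block_primes sieve_blocks.
Proof.
move=> pp pz; have [_ mF] := mem_blocks r (ltW y0).
rewrite block_primes_sieve mem_cat mF mem_filter mem_iota pz pp /=.
case: (ltP (lnn R p) (y / scale r)) => h; first by rewrite orbT.
rewrite orbF /in_block pp h /= /u /scale big_nil divr1 /y.
have p0 := prime_gt0 pp; have z0 : (0 < z)%N by exact: leq_ltn_trans pz.
by rewrite ltr_ln ?posrE ?ltr0n ?ltr_nat.
Qed.

Lemma size_small : (size small_seq <= M0)%N.
Proof.
rewrite -(size_iota 0 M0); apply: uniq_leq_size; first by rewrite filter_uniq ?iota_uniq.
move=> p; rewrite mem_filter => /andP[/andP[pp h] _].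
by rewrite mem_iota add0n (M0P pp h).
Qed.

Lemma small_seq_prime : all prime small_seq.
Proof. by apply/allP => p; rewrite mem_filter => /andP[/andP[]]. Qed.

(** Some residue class survives modulo each p, so every factor is at least 1 / p >= 1 / M0. *)
Lemma small_prod_ge : (M0%:R^-1) ^+ M0 <= \prod_(p <- small_seq) (1 - g p).
Proof.
have [M00|M00] := posnP M0.
  have := size_small; rewrite M00 leqn0 size_eq0 => /eqP ->.
  by rewrite big_nil expr0.
have M0' : 0 < M0%:R :> R by rewrite ltr0n.
apply: (@le_trans _ _ (M0%:R^-1 ^+ size small_seq)).
  rewrite ler_wiXn2l ?size_small ?invr_ge0 ?ler0n //.
  by rewrite invf_le1 // ler1n.
have : forall p, p \in small_seq -> M0%:R^-1 <= 1 - g p.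
  move=> p; rewrite mem_filter => /andP[/andP[pp h] _]; have pM := M0P pp h.
  have p0 : 0 < p%:R :> R by rewrite ltr0n prime_gt0.
  apply: (@le_trans _ _ p%:R^-1); first by rewrite lef_pV2 ?posrE // ler_nat ltnW.
  have -> : 1 - g p = (p - rho p)%:R / p%:R.
    rewrite natrB; last exact: ltnW (rhoP pp).2.
    by rewrite mulrBl divff // gt_eqF.
  by rewrite -[leLHS]mul1r ler_wpM2r ?invr_ge0 // ler1n subn_gt0 (rhoP pp).2.
elim: small_seq => [|p s IH] h; first by rewrite big_nil expr0.
rewrite big_cons exprS ler_pM ?exprn_ge0 ?invr_ge0 ?h ?mem_head //.
by apply: IH => q qs; apply: h; rewrite inE qs orbT.
Qed.

(** As theta <= ln (lam i), the [ell i] sum to at most 2 kappa ln (scale r). With scale r below ln z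
    the main term loses only a power of ln z. *)
Lemma sieve_main_ge :
  delta * (expR (- (2 * kappa%:R * ln (scale r))) * M0%:R^-1 ^+ M0) <=
  sev g (lower_sieve R sieve_blocks).
Proof.
have est i : (i < r)%N -> a0 <= u i.+1.
  by move=> ir; apply: le_trans ar _; exact: u_antimono (ltW y0).
have M0r : 0 <= M0%:R^-1 ^+ M0 :> R by rewrite exprn_ge0 // invr_ge0.
have smT : M0%:R^-1 ^+ M0 <= sev g (bonferroni R M0.*2 small_seq).
  apply: le_trans small_prod_ge _.
  by have := bonferroni_bounds M0.*2 (g_in01 small_seq_prime); rewrite odd_double.
have M0pos : 0 < M0%:R^-1 ^+ M0 :> R.
  case: (posnP M0) => [->|h]; first by rewrite expr0.
  by rewrite exprn_gt0 // invr_gt0 ltr0n.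
have Tpos x : x \in sieve_blocks -> 0 < sev g (bonferroni R x.2 x.1).
  rewrite mem_cat mem_seq1 => /orP[/mapP[i]|/eqP -> /=]; last exact: lt_le_trans smT.
  rewrite mem_iota add0n => /andP[_ ir] -> /=.
  have [h _ _] := block_seq_est (est i ir); apply: lt_le_trans h.
  by have [] := SlowP i.
rewrite sev_lower_sieve => [|x /Tpos /lt0r_neq0 //].
have U0 : expR (- (2 * kappa%:R * ln (scale r))) * M0%:R^-1 ^+ M0 <= sev g (upper_sieve R sieve_blocks).
  rewrite sev_upper_sieve big_cat big_seq1 /= big_map.
  apply: ler_pM => //; first exact: expR_ge0.
  apply: (@le_trans _ _ (\prod_(i <- iota 0 r) expR (- ell i))).
    have -> : iota 0 r = index_iota 0 r by rewrite /index_iota subn0.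
    rewrite -expR_sum ler_expR sumrN lerN2 -mulr_sumr big_split /= -ln_scale.
    rewrite sumr_const_nat subn0 -mulrA mulrCA ler_pM2l ?ltr0n //.
    by have := theta_scale r; rewrite mulr_natl => h; lra.
  rewrite big_seq [leRHS]big_seq; apply: ler_prod => i.
  rewrite mem_iota add0n => /andP[_ ir]; rewrite expR_ge0 /=.
  have [_ _ h] := block_seq_est (est i ir); apply: le_trans h _.
  have := bonferroni_bounds (bb i) (g_in01 (block_seq_prime i)).
  by rewrite (negbTE (bbE i)).
have E1 : delta <= 1 - \sum_(x <- sieve_blocks)
    sev g (elem_sym R x.2.+1 x.1) / sev g (bonferroni R x.2 x.1).
  rewrite big_cat big_seq1 /= elem_sym_small; last first.
    by rewrite ltnS -addnn; apply: leq_trans size_small (leq_addr _ _).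
  rewrite mul0r addr0 big_map lerBrDr -lerBrDl.
  apply: le_trans (errP r); rewrite /index_iota subn0 big_seq [leRHS]big_seq.
  apply: ler_sum => i; rewrite mem_iota add0n => /andP[_ ir].
  have [h1 h2 _] := block_seq_est (est i ir); have [S0 _] := SlowP i.
  have e0 := elem_sym_ge0 (bb i).+1 (g_in01 (block_seq_prime i)).
  apply: ler_pM => //; first by rewrite invr_ge0; apply: le_trans h1; exact: ltW.
  by rewrite lef_pV2 ?posrE //; exact: lt_le_trans h1.
rewrite mulrC; apply: ler_pM => //; last exact: ltW.
by rewrite mulr_ge0 ?expR_ge0.
Qed.

Lemma count_lt_expR (P : pred nat) (w : R) : 0 <= w ->
  (forall p, P p -> (0 < p)%N /\ lnn R p < w) -> (size (filter P (iota 0 z)))%:R <= expR w.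
Proof.
move=> w0 hP; have e0 := expR_ge0 w.
have /andP[h1 h2] := truncn_itv e0; apply: le_trans h1; rewrite ler_nat.
rewrite -(size_iota 1 (Num.truncn (expR w))); apply: uniq_leq_size.
  by rewrite filter_uniq ?iota_uniq.
move=> p; rewrite mem_filter => /andP[/hP[p0 pw] _]; rewrite mem_iota p0 /= add1n.
rewrite -(ltr_nat R); apply: lt_trans h2; rewrite -[ltLHS]lnK ?posrE ?ltr0n //.
by rewrite ltr_expR.
Qed.

Lemma sum_rho_le s : all prime s -> \sum_(p <- s) (rho p)%:R <= kappa%:R * (size s)%:R :> R.
Proof.
elim: s => [|p s IH] /=; first by rewrite big_nil mulr0.
move=> /andP[pp /IH h]; rewrite big_cons -natr1 mulrDr mulr1 addrC lerD //.
by rewrite ler_nat (rhoP pp).1.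
Qed.

(** In the last factor every block is crudely allowed [z] primes; this is the source of the 1 in the
    exponent 1 + B + eps of the sieve. *)
Lemma sieve_rem_le :
  srem (fun p => (rho p)%:R) (lower_sieve R sieve_blocks) <=
  (1 + kappa%:R * M0%:R) ^+ M0.*2 * \prod_(0 <= i < r) (1 + kappa%:R * expR (u i)) ^+ bb i *
  (1 + r.+1%:R * (1 + kappa%:R * z%:R)).
Proof.
apply: le_trans (@srem_lower_sieve R (fun p => (rho p)%:R) _ _) _ => //.
have blk x : x \in sieve_blocks -> all prime x.1 /\ (size x.1 <= z)%N.
  rewrite mem_cat mem_seq1 => /orP[/mapP[i _ ->]|/eqP ->] /=.
    by rewrite block_seq_prime size_filter -[z in (_ <= z)%N](size_iota 0) count_size.
  by rewrite small_seq_prime size_filter -[z in (_ <= z)%N](size_iota 0) count_size.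
have k0' : 0 <= kappa%:R :> R by [].
have S0 (s : seq nat) : 0 <= 1 + \sum_(p <- s) (rho p)%:R :> R by rewrite addr_ge0 ?sumr_ge0.
have XL (a b : R) n : 0 <= a -> a <= b -> a ^+ n <= b ^+ n.
  by move=> a0' ab; rewrite lerXn2r ?nnegrE //; exact: le_trans ab.
have Sz s : all prime s -> 1 + \sum_(p <- s) (rho p)%:R <= 1 + kappa%:R * (size s)%:R :> R.
  by move=> sp; rewrite lerD2l sum_rho_le.
apply: ler_pM.
- by apply: prodr_ge0 => x _; rewrite exprn_ge0.
- by rewrite addr_ge0 // sumr_ge0.
- rewrite big_cat big_seq1 /= big_map mulrC; apply: ler_pM.
  + by rewrite exprn_ge0.
  + by apply: prodr_ge0 => x _; rewrite exprn_ge0.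
  + apply: XL => //; apply: le_trans (Sz _ small_seq_prime) _.
    by rewrite lerD2l ler_wpM2l // ler_nat size_small.
  rewrite /index_iota subn0; apply: ler_prod => i _; rewrite exprn_ge0 //=.
  apply: XL => //; apply: le_trans (Sz _ (block_seq_prime i)) _; rewrite lerD2l ler_wpM2l //.
  apply: count_lt_expR; first by rewrite divr_ge0 ?(ltW y0) ?(ltW (scale_gt0 _)).
  by move=> p /and3P[pp _ h]; rewrite prime_gt0.
rewrite lerD2l.
apply: (@le_trans _ _ (\sum_(x <- sieve_blocks) (1 + kappa%:R * z%:R))).
  rewrite big_seq [leRHS]big_seq; apply: ler_sum => x /blk [xp xz].
  apply: le_trans (Sz _ xp) _; rewrite lerD2l ler_wpM2l // ler_nat //.
rewrite big_const_seq count_predT iter_addr addr0 size_cat size_map size_iota /= addn1.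
by rewrite [leRHS]mulr_natl.
Qed.

End fixed_z.
Theorem brun_hooley_sieve (eps : R) : 0 < eps ->
  exists Z0 : nat, forall (z : nat) (bad : nat -> pred nat), (Z0 <= z)%N ->
    (forall p x, bad p (x %% p)%N = bad p x) ->
    (forall p, prime p -> (bad_residues bad p <= kappa)%N /\ (bad_residues bad p < p)%N) ->
    forall X : nat, expR ((1 + B + eps) * lnn R z) <= X%:R ->
    exists2 x, (x < X)%N & forall p, prime p -> (p < z)%N -> ~~ bad p x.
Proof.
move=> eps0.
have B0 : 0 <= B by have := levelP 0; rewrite big_geq.
have kR : 0 < kappa%:R :> R by rewrite ltr0n.
(* The exponent spent on absorbing [kappa]: 1 + kappa e^u <= e^((1 + e1) u) once u >= ln (kappa + 1)
   / e1. It costs e1 B <= eps / 2 in all; the other half of [eps] beats the powers of ln z. *)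
pose e1 := eps / (2 * (B + 1)).
have B1 : 0 < B + 1 by lra.
have e10 : 0 < e1 by rewrite divr_gt0 // mulr_gt0.
have e1B : e1 * B <= eps / 2.
  have -> : e1 * B = eps / 2 * (B / (B + 1)) by rewrite /e1; field; rewrite gt_eqF.
  by rewrite ler_piMr ?divr_ge0 ?(ltW eps0) // ler_pdivrMr // mul1r lerDl.
have [a1 a12 blk] := block_ok k0 t0 t1.
pose a0 := Num.max a1 (ln (kappa%:R + 1) / e1).
have [a01 a0k] : a1 <= a0 /\ ln (kappa%:R + 1) / e1 <= a0.
  by split; rewrite le_max lexx ?orbT.
have a02 : 2 <= a0 by exact: le_trans a01.
(* The scale following the last block lies below [a0], and lam r <= 4, so the leftover primes are
   below e^(4 a0) whatever z is. *)
pose M0 := (Num.truncn (expR (4 * a0))).+1.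
have M0gt : expR (4 * a0) < M0%:R by have /andP[] := truncn_itv (expR_ge0 (4 * a0)).
have M00 : 0 < M0%:R :> R by rewrite ltr0n.
pose c1 : R := M0%:R^-1 ^+ M0.
have c10 : 0 < c1 by rewrite exprn_gt0 // invr_gt0.
pose c2 : R := (1 + kappa%:R * M0%:R) ^+ M0.*2.
have c20 : 0 < c2 by rewrite exprn_gt0 // ltr_wpDr // mulr_ge0.
pose C3 : R := 1 + (theta^-1 + 1) * (1 + kappa%:R).
have ti0 : 0 < theta^-1 by rewrite invr_gt0.
have C30 : 0 < C3 by rewrite addr_gt0 // mulr_gt0 // addr_gt0.
pose C := c2 * C3 / (delta * c1).
have eps2 : 0 < eps / 2 by rewrite divr_gt0.
(* The power 2 kappa of y is lost in the main term, one more comes from the number of blocks. *)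
have [Y Y1 YP] := expR_gt_poly C (2 * kappa).+1 eps2.
have [Z0 Z0P] := lnn_unbounded (Num.max Y a0).
exists Z0 => z bad Zz bad_mod badP X XP.
have := Z0P z Zz; rewrite ge_max; set y := lnn R z => /andP[yY ya0].
have y1 : 1 <= y by exact: le_trans Y1 yY.
have y0 : 0 < y by exact: lt_le_trans y1.
pose u i := y / scale i.
have blkz (a la : R) N (v : nat -> R) : a0 <= a -> _ := fun h => blk a la N v (le_trans a01 h).
have exr : exists r, u r.+1 < a0.
  pose r := (Num.truncn (y / theta)).+1.
  have hr : y / theta < r%:R.
    by have /andP[] := truncn_itv (divr_ge0 (ltW y0) (ltW t0)).
  exists r.-1; rewrite prednK // ltr_pdivrMr ?scale_gt0 //.
  have h1 : y < r%:R * theta by rewrite -ltr_pdivrMr.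
  have h2 := theta_scale r; have h3 := ln_le_sub1 (scale_gt0 r).
  have h4 : y < scale r by apply: (lt_le_trans h1); apply: le_trans h2 _; apply: le_trans h3 _; rewrite gerBl.
  by apply: lt_trans h4 _; rewrite ltr_pMl ?scale_gt0 //; apply: lt_le_trans a02; rewrite ltr1n.
(* By minimality u r is still at least [a0]: all [r] blocks lie in the range of Mertens'
   estimate. *)
have [r rP rmin] := ex_minnP exr.
have ur : a0 <= u r.
  case: (r) rmin => [|r'] rmin; first by rewrite /u /scale big_nil divr1.
  by rewrite leNgt; apply/negP => /rmin; rewrite ltnn.
have M0P p : prime p -> lnn R p < u r -> (p < M0)%N.
  move=> pp h; rewrite -(ltr_nat R); apply: lt_trans M0gt.
  have p0 : 0 < p%:R :> R by rewrite ltr0n prime_gt0.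
  rewrite -[ltLHS]lnK ?posrE // ltr_expR; apply: lt_trans h _.
  have -> : u r = lam r * u r.+1.
    have s0 := scale_gt0 r; have l0 := lam_gt0 r; rewrite /u scaleS.
    by field; rewrite !gt_eqF.
  have [_ _ l4] := lamP r.
  apply: (@lt_le_trans _ _ (lam r * a0)); first by rewrite ltr_pM2l ?lam_gt0.
  by rewrite ler_wpM2r // (le_trans _ a02).
have s_y : scale r <= y.
  have : a0 * scale r <= y by rewrite -ler_pdivlMr ?scale_gt0.
  by apply: le_trans; rewrite ler_peMl ?(ltW (scale_gt0 r)) // (le_trans _ a02) // ler1n.
have main := sieve_main_ge badP blkz y0 ur M0P.
have srem_le := sieve_rem_le badP y0 M0P.
have ev := sieve_blocks_even z r M0.
have un := @sieve_blocks_uniq z r M0 y0.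
have pr := @sieve_blocks_prime z r M0 y0.
have lt : srem (fun p => (bad_residues bad p)%:R) (lower_sieve R (sieve_blocks z r M0)) <
    X%:R * sev (bad_density R bad) (lower_sieve R (sieve_blocks z r M0)); last first.
  have [x xX xP] := sieve_exists bad_mod ev un pr lt.
  by exists x => // p pp pz; apply: xP; exact: (@mem_sieve_blocks z r M0 y0).
pose E1 := expR ((1 + e1) * B * y).
have zE : z%:R = expR y.
  rewrite lnK // posrE ltr0n lt0n; apply/negP => /eqP z0.
  by move: y1; rewrite /y z0 /lnn ln0 // ler10.
have prodE : \prod_(0 <= i < r) (1 + kappa%:R * expR (u i)) ^+ bb i <= E1.
  apply: (@le_trans _ _ (\prod_(0 <= i < r) expR ((1 + e1) * y * ((bb i)%:R / scale i)))).
    rewrite big_nat [leRHS]big_nat; apply: ler_prod => i /andP[_ ir].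
    have x0 : 0 <= 1 + kappa%:R * expR (u i) by rewrite addr_ge0 // mulr_ge0 ?expR_ge0.
    rewrite exprn_ge0 //=.
    have -> : (1 + e1) * y * ((bb i)%:R / scale i) = (bb i)%:R * ((1 + e1) * u i).
      by rewrite /u; ring.
    rewrite expRM_natl.
    suff h : 1 + kappa%:R * expR (u i) <= expR ((1 + e1) * u i).
      by rewrite lerXn2r ?nnegrE ?expR_ge0.
    have ui : a0 <= u i.
      by apply: le_trans ur _; exact: (@u_antimono z i r (ltnW ir) (ltW y0)).
    have u0 : 0 <= u i by apply: le_trans ui; exact: le_trans a02.
    have g1 : 1 <= expR (u i) by rewrite -expR0 ler_expR.
    apply: (@le_trans _ _ ((kappa%:R + 1) * expR (u i))).
      by rewrite mulrDl mul1r addrC lerD2l.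
    have kp : 0 < kappa%:R + 1 :> R by rewrite addr_gt0.
    rewrite -[kappa%:R + 1]lnK ?posrE // -expRD ler_expR mulrDl mul1r [leRHS]addrC lerD2r.
    by apply: (le_trans _ (ler_wpM2l (ltW e10) ui)); rewrite mulrC -ler_pdivrMr.
  rewrite -expR_sum ler_expR -mulr_sumr /E1.
  have -> : (1 + e1) * B * y = (1 + e1) * y * B by ring.
  by rewrite ler_wpM2l ?levelP // mulr_ge0 ?(ltW y0) // addr_ge0 // ltW.
have third : 1 + r.+1%:R * (1 + kappa%:R * z%:R) <= C3 * (y * expR y).
  have ey : 1 <= expR y by rewrite -expR0 ler_expR ltW.
  have ln_y : ln (scale r) <= y.
    apply: le_trans (ln_le_sub1 (scale_gt0 r)) _; apply: le_trans s_y.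
    by rewrite gerBl.
  have ry : r.+1%:R <= (theta^-1 + 1) * y.
    rewrite -natr1 mulrDl mul1r lerD // mulrC ler_pdivlMr //.
    exact: le_trans (theta_scale r) ln_y.
  have kz : 1 + kappa%:R * z%:R <= (1 + kappa%:R) * expR y.
    by rewrite zE mulrDl mul1r lerD2r.
  rewrite /C3 mulrDl mul1r; apply: lerD.
    by rewrite -[1]mulr1 ler_pM.
  have -> : (theta^-1 + 1) * (1 + kappa%:R) * (y * expR y) =
     (theta^-1 + 1) * y * ((1 + kappa%:R) * expR y) by ring.
  by apply: ler_pM => //; rewrite addr_ge0 // mulr_ge0.
have yk : (y ^+ (2 * kappa))^-1 <= expR (- (2 * kappa%:R * ln (scale r))).
  rewrite expRN lef_pV2 ?posrE ?expR_gt0 ?exprn_gt0 //.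
  have -> : 2 * kappa%:R * ln (scale r) = (2 * kappa)%:R * ln (scale r) by rewrite natrM.
  rewrite expRM_natl lnK ?posrE ?scale_gt0 //.
  by rewrite lerXn2r ?nnegrE ?(ltW y0) ?(ltW (scale_gt0 r)).
have yk0 : 0 < y ^+ (2 * kappa) by rewrite exprn_gt0.
have E10 : 0 < E1 by exact: expR_gt0.
apply: (@le_lt_trans _ _ (c2 * E1 * (C3 * (y * expR y)))).
  apply: le_trans srem_le _; apply: ler_pM => //.
  - rewrite mulr_ge0 ?(ltW c20) //; apply: prodr_ge0 => i _.
    by rewrite exprn_ge0 // addr_ge0 // mulr_ge0 ?expR_ge0.
  - by rewrite addr_ge0 // mulr_ge0 // addr_ge0 // mulr_ge0.
  - by rewrite ler_wpM2l // ltW.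
have XE : E1 * expR y * expR (eps / 2 * y) <= X%:R.
  apply: le_trans XP; rewrite -!expRD ler_expR -subr_ge0.
  have -> : (1 + B + eps) * y - ((1 + e1) * B * y + y + eps / 2 * y) =
      (eps / 2 - e1 * B) * y by field.
  by rewrite mulr_ge0 ?subr_ge0 // ltW.
apply: (@lt_le_trans _ _ (E1 * expR y * expR (eps / 2 * y) * (delta * ((y ^+ (2 * kappa))^-1 * c1)))).
  have -> : c2 * E1 * (C3 * (y * expR y)) =
      E1 * expR y * (C * y ^+ (2 * kappa).+1) * (delta * ((y ^+ (2 * kappa))^-1 * c1)).
    rewrite exprS /C; move: (y ^+ (2 * kappa)) yk0 => w w0.
    by field; rewrite !gt_eqF.
  rewrite ltr_pM2r; last by rewrite !mulr_gt0 ?invr_gt0.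
  by rewrite ltr_pM2l ?YP // mulr_gt0 ?expR_gt0.
apply: ler_pM => //.
- by rewrite !mulr_ge0 ?expR_ge0.
- by rewrite !mulr_ge0 ?invr_ge0 ?(ltW d0) ?(ltW c10) ?(ltW yk0).
apply: le_trans main; rewrite ler_pM2l // ler_wpM2r //; exact: ltW.
Qed.

End brun_hooley.

(** * Numerical tables for the sieve *)

(* Binary fixed-point arithmetic with unit 10^-8, rounding so that every result
   is an upper bound (a lower bound for [fx_slow]). *)
Definition fx_one : N := 100000000%num.
Definition fx_theta : N := 10000%num.
Definition fx_mul (x y : N) : N := (x * y / fx_one + 1)%num.
Definition fx_div (x y : N) : N := (x * fx_one / y + 1)%num.

Fixpoint fx_pow (n : nat) : N := if n is m.+1 then (fx_pow m * 26 / 25 + 1)%num else fx_one.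
Fixpoint fx_powV (n : nat) : N := if n is m.+1 then (fx_powV m * 25 / 26 + 1)%num else fx_one.

Fixpoint fx_pow_fact (n : nat) (x : N) : N :=
  if n is m.+1 then (fx_pow_fact m x * x / (fx_one * N.of_nat n) + 1)%num else fx_one.

(** 3925000 encodes 0.03925, an upper bound for ln (26/25). *)
Definition fx_ell (k c : nat) : N := (N.of_nat k * (N.of_nat c * 3925000 + fx_theta))%num.

Definition fx_slow (x : N) : N := (fx_one + x * x / (2 * fx_one) - (x + fx_theta))%num.

(** The term of one block in [errP]. For b other than 0 and 2 its denominator is exp (- ell), whose
    inverse is at most (26/25)^(k c) (1 + 2 k theta). *)
Definition fx_err (k c b : nat) : N :=
  let x := fx_ell k c in
  if b == 0 then x
  else if b == 2 then fx_div (fx_pow_fact 3 x) (fx_slow x)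
  else fx_mul (fx_pow_fact b.+1 x) (fx_mul (fx_pow (k * c)) (fx_one + 2 * N.of_nat k * fx_theta)%num).

(** The closing term is the whole tail: the sum of (b + 2 i) / 2^i over all i is 2 b + 4. *)
Fixpoint fx_level (C : nat) (tab : seq (nat * nat)) (b : nat) : N :=
  if tab is (c, b') :: tab' then (N.of_nat b' * fx_powV C + fx_level (C + c) tab' b)%num
  else (N.of_nat (2 * b + 4) * fx_powV C)%num.

Definition fx_row (k c b : nat) : bool :=
  [&& ~~ odd b, 0 < c, (fx_pow c <=? 4 * fx_one)%num &
   (b == 2) ==> ((fx_ell k c <=? fx_one) &&
     (fx_ell k c + fx_theta <? fx_one + fx_ell k c * fx_ell k c / (2 * fx_one)))%num].

(* A row (c, b) describes a block with ratio (26/25)^c and truncation b; beyond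
   the table the ratio is (26/25)^18 > 2 and b increases by 2 at each block. *)
Definition sieve_table (k : nat) (tab : seq (nat * nat)) (b : nat) (lev : nat) : bool :=
  [&& 0 < k <= 3, all (fun x => fx_row k x.1 x.2) tab, 3 < b, fx_row k 18 b,
      (fx_ell k 18 <=? 3 * fx_one)%num,
      (foldr (fun x s => fx_err k x.1 x.2 + s) (2 * fx_err k 18 b) tab + 1 <=? fx_one)%num &
      (fx_level 0 tab b * 100 <=? N.of_nat lev * fx_one)%num].


Fact nr_key : unit. Proof. exact: tt. Qed.

Section tables.
Variable R : realType.
Local Open Scope ring_scope.

(* Locked, so that conversion never unfolds large binary constants into unary ones. *)
Definition nr (x : N) : R := locked_with nr_key (N.to_nat x)%:R.
Definition fx (x : N) : R := nr x / nr fx_one.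

Lemma nrE x : nr x = (N.to_nat x)%:R.
Proof. by rewrite /nr unlock. Qed.

Lemma nrD x y : nr (x + y)%num = nr x + nr y.
Proof. by rewrite !nrE N2Nat.inj_add natrD. Qed.

Lemma nrM x y : nr (x * y)%num = nr x * nr y.
Proof. by rewrite !nrE N2Nat.inj_mul natrM. Qed.

Lemma nr_of_nat n : nr (N.of_nat n) = n%:R.
Proof. by rewrite nrE Nat2N.id. Qed.

Lemma nr_ge0 x : 0 <= nr x. Proof. by rewrite nrE ler0n. Qed.

Lemma nr_le x y : (x <= y)%num -> nr x <= nr y.
Proof. by move=> h; rewrite !nrE ler_nat; lia. Qed.

Lemma nr_gt0 x : (0 < x)%num -> 0 < nr x.
Proof. by move=> h; rewrite nrE ltr0n; lia. Qed.

Lemma nr_one_gt0 : 0 < nr fx_one.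
Proof. exact: nr_gt0. Qed.

Lemma nr_div_up a b : (0 < b)%num -> nr a / nr b <= nr (a / b + 1)%num.
Proof.
move=> b0; rewrite ler_pdivrMr ?nr_gt0 // -nrM; apply: nr_le.
have := N.mul_succ_div_gt a b; move: (a / b)%num => q; nia.
Qed.

Lemma nr_div_down a b : (0 < b)%num -> nr (a / b)%num <= nr a / nr b.
Proof.
move=> b0; rewrite ler_pdivlMr ?nr_gt0 // -nrM; apply: nr_le.
have := N.mul_div_le a b; move: (a / b)%num => q; nia.
Qed.

Lemma fx_ge0 x : 0 <= fx x.
Proof. by rewrite divr_ge0 ?nr_ge0. Qed.

Lemma fxD x y : fx (x + y)%num = fx x + fx y.
Proof. by rewrite /fx nrD mulrDl. Qed.

Lemma fxM x y : fx (x * y)%num = nr x * fx y.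
Proof. by rewrite /fx nrM mulrA. Qed.

Lemma fx_le x y : (x <= y)%num -> fx x <= fx y.
Proof. by move=> h; rewrite ler_wpM2r ?invr_ge0 ?nr_ge0 ?nr_le. Qed.

Lemma fx_oneE : fx fx_one = 1.
Proof. by rewrite /fx divff // gt_eqF ?nr_one_gt0. Qed.

Lemma fx_mulP a b x y : 0 <= a -> 0 <= b -> a <= fx x -> b <= fx y -> a * b <= fx (fx_mul x y).
Proof.
move=> a0 b0 ax by_; apply: le_trans (ler_pM a0 b0 ax by_) _.
have D0 := nr_one_gt0.
have -> : fx x * fx y = nr (x * y)%num / nr fx_one / nr fx_one.
  by rewrite /fx nrM; field; rewrite gt_eqF.
by rewrite /fx_mul /fx ler_wpM2r ?invr_ge0 ?nr_ge0 // nr_div_up.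
Qed.

Lemma fx_divP a b x y : 0 <= a -> (0 < y)%num -> a <= fx x -> fx y <= b -> a / b <= fx (fx_div x y).
Proof.
move=> a0 y0 ax yb; have D0 := nr_one_gt0; have y0' := nr_gt0 y0.
have fy0 : 0 < fx y by rewrite divr_gt0.
have b0 : 0 < b by exact: lt_le_trans yb.
apply: (@le_trans _ _ (fx x / fx y)).
  apply: ler_pM => //; first by rewrite invr_ge0 ltW.
  by rewrite lef_pV2 ?posrE.
have -> : fx x / fx y = nr (x * fx_one)%num / nr y / nr fx_one.
  by rewrite /fx nrM; field; rewrite !gt_eqF.
by rewrite /fx_div /fx ler_wpM2r ?invr_ge0 ?nr_ge0 // nr_div_up.
Qed.

Lemma nr25 : nr 25 = 25. Proof. by rewrite nrE; congr (_%:R); vm_compute. Qed.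
Lemma nr26 : nr 26 = 26. Proof. by rewrite nrE; congr (_%:R); vm_compute. Qed.

Lemma fx_powP n : (26 / 25) ^+ n <= fx (fx_pow n).
Proof.
elim: n => [|n IH]; first by rewrite expr0 fx_oneE.
rewrite exprSr; apply: le_trans (ler_wpM2r _ IH) _; first by lra.
rewrite /fx [fx_pow n.+1]/= mulrAC ler_wpM2r ?invr_ge0 ?nr_ge0 //.
by have := @nr_div_up (fx_pow n * 26) 25 erefl; rewrite nrM nr25 nr26 mulrA.
Qed.

Lemma fx_powVP n : ((26 / 25) ^+ n)^-1 <= fx (fx_powV n).
Proof.
elim: n => [|n IH]; first by rewrite expr0 fx_oneE invr1.
rewrite exprSr invfM invf_div.
apply: le_trans (ler_wpM2r _ IH) _; first by lra.
rewrite /fx [fx_powV n.+1]/= mulrAC ler_wpM2r ?invr_ge0 ?nr_ge0 //.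
by have := @nr_div_up (fx_powV n * 25) 26 erefl; rewrite nrM nr25 nr26 mulrA.
Qed.

Lemma fx_pow_factP n t x : 0 <= t -> t <= fx x -> t ^+ n / n`!%:R <= fx (fx_pow_fact n x).
Proof.
move=> t0 tx; elim: n => [|n IH]; first by rewrite expr0 fact0 divr1 fx_oneE.
have f0 : 0 < n`!%:R :> R by rewrite ltr0n fact_gt0.
have n0 : 0 < n.+1%:R :> R by rewrite ltr0n.
have -> : t ^+ n.+1 / n.+1`!%:R = t ^+ n / n`!%:R * (t / n.+1%:R).
  rewrite exprSr factS natrM; move: (n.+1%:R) (n`!%:R) n0 f0 => m f m0 f0.
  by field; rewrite !gt_eqF.
apply: (@le_trans _ _ (fx (fx_pow_fact n x) * (fx x / n.+1%:R))).
  apply: ler_pM => //; rewrite ?mulr_ge0 ?exprn_ge0 ?invr_ge0 ?(ltW f0) ?(ltW n0) //.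
  by rewrite ler_wpM2r // invr_ge0 ltW.
have D0 := nr_one_gt0.
have -> : fx (fx_pow_fact n x) * (fx x / n.+1%:R) =
   nr (fx_pow_fact n x * x)%num / nr (fx_one * N.of_nat n.+1)%num / nr fx_one.
  rewrite !nrM nr_of_nat /fx; move: (n.+1%:R) n0 => m m0.
  by field; rewrite !gt_eqF.
rewrite /fx ler_wpM2r ?invr_ge0 ?nr_ge0 //; apply: nr_div_up.
by rewrite /fx_one; lia.
Qed.

Definition table_theta : R := fx fx_theta.
Definition table_ell (k c : nat) : R := k%:R * (ln ((26 / 25) ^+ c) + table_theta).
Definition table_slow (k c b : nat) : R :=
  if b == 0%N then 1
  else if b == 2%N then fx (fx_slow (fx_ell k c)) else expR (- table_ell k c).

Lemma table_thetaE : table_theta = 1 / (100 * 100).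
Proof.
rewrite /table_theta /fx (_ : fx_one = 10000 * 10000)%num // nrM /fx_theta.
rewrite (_ : 10000 = 100 * 100)%num // nrM.
have -> : nr 100 = 100 by rewrite nrE; congr (_%:R); vm_compute.
by field.
Qed.

(** 0.03925 is 32 times 157/128000, and e^x >= (1 + x / 32)^32 is sharp enough here. *)
Lemma ln_base_le : ln (26 / 25) <= fx 3925000.
Proof.
have -> : fx 3925000 = 32%:R * (157 / (128 * 1000)).
  rewrite /fx (_ : fx_one = 4 * 1000 * 25 * 1000)%num // (_ : 3925000 = 157 * 25 * 1000)%num // !nrM.
  have -> : nr 157 = 157 by rewrite nrE; congr (_%:R); vm_compute.
  have -> : nr 25 = 25 by rewrite nrE; congr (_%:R); vm_compute.
  have -> : nr 4 = 4 by rewrite nrE; congr (_%:R); vm_compute.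
  have -> : nr 1000 = 1000 by rewrite nrE; congr (_%:R); vm_compute.
  by field.
rewrite -[leRHS]expRK expRM_natl ler_ln ?posrE ?exprn_gt0 ?expR_gt0 ?divr_gt0 //.
apply: (@le_trans _ _ ((1 + 157 / (128 * 1000)) ^+ 32)); first by lra.
by rewrite lerXn2r ?nnegrE ?expR_ge0 ?expR_ge1Dx ?addr_ge0 ?divr_ge0 ?mulr_ge0.
Qed.

Lemma ln_base_ge : table_theta <= ln (26 / 25).
Proof.
have : ln (25 / 26) <= 25 / 26 - 1 :> R by apply: ln_le_sub1; lra.
rewrite -[25 / 26]invf_div lnV ?posrE; last by lra.
by rewrite table_thetaE; lra.
Qed.

Lemma table_ell_le k c : table_ell k c <= fx (fx_ell k c).
Proof.
rewrite /table_ell /fx_ell /fx nrM nr_of_nat -mulrA ler_wpM2l //.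
rewrite -/(fx _) fxD lerD2r lnXn; last by rewrite divr_gt0.
by rewrite -[leLHS]mulr_natl /fx nrM nr_of_nat -mulrA ler_wpM2l // ln_base_le.
Qed.

Definition table_term (k c b : nat) : R :=
  table_ell k c ^+ b.+1 / b.+1`!%:R / table_slow k c b.

Lemma table_theta_gt0 : 0 < table_theta.
Proof. by rewrite table_thetaE; lra. Qed.

Lemma table_ell_ge0 k c : 0 <= table_ell k c.
Proof.
have t0 := table_theta_gt0; rewrite mulr_ge0 // addr_ge0 ?(ltW t0) // ln_ge0 // exprn_ege1 //.
by lra.
Qed.

Lemma nrB x y : (y <= x)%num -> nr (x - y)%num = nr x - nr y.
Proof. by move=> h; rewrite -{2}[x](N.sub_add _ _ h) nrD addrK. Qed.

Lemma fxB x y : (y <= x)%num -> fx (x - y)%num = fx x - fx y.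
Proof. by move=> h; rewrite /fx nrB // mulrBl. Qed.

Lemma fx_slow_le x : (x <= fx_one)%num -> (x + fx_theta < fx_one + x * x / (2 * fx_one))%num ->
  fx (fx_slow x) + table_theta <= 1 - fx x + fx x ^+ 2 / 2.
Proof.
move=> x1 xp; rewrite /fx_slow fxB; last by lia.
rewrite !fxD fx_oneE -/table_theta.
have D0 := nr_one_gt0.
have h : fx (x * x / (2 * fx_one))%num <= fx x ^+ 2 / 2.
  have -> : fx x ^+ 2 / 2 = nr (x * x)%num / nr (2 * fx_one)%num / nr fx_one.
    have e2 : nr 2 = 2 by rewrite nrE; congr (_%:R); vm_compute.
    by rewrite !nrM e2 /fx; field; rewrite gt_eqF.
  by rewrite /fx ler_wpM2r ?invr_ge0 ?nr_ge0 // nr_div_down.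
move: h; move: (fx x) table_theta (fx _) => X t q h; lra.
Qed.

Lemma table_row (k c b : nat) : (0 < k <= 3)%N -> fx_row k c b ->
  [/\ [/\ table_theta <= ln ((26 / 25) ^+ c : R), 1 < (26 / 25) ^+ c :> R & (26 / 25) ^+ c <= 4 :> R],
     0 < table_slow k c b,
     [\/ b = 0%N /\ table_slow k c b <= 1,
       [/\ b = 2, table_ell k c <= 1 &
         table_slow k c b + table_theta <= 1 - table_ell k c + table_ell k c ^+ 2 / 2] |
       table_slow k c b <= expR (- table_ell k c)] &
     table_term k c b <= fx (fx_err k c b)].
Proof.
move=> /andP[k0 k3] /and4P[ob c0 c4 b2].
have mu1 : 1 < 26 / 25 :> R by lra.
have lb := ln_base_ge; have t0 := table_theta_gt0.
have l0 : 0 <= ln (26 / 25) :> R by apply: le_trans lb; exact: ltW.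
have e0 := table_ell_ge0 k c; have el := table_ell_le k c.
have pf := fx_pow_factP b.+1 e0 el.
have T0 : 0 <= table_ell k c ^+ b.+1 / b.+1`!%:R by rewrite divr_ge0 ?exprn_ge0.
split.
- split; last first.
  + apply: le_trans (fx_powP c) _.
    have -> : 4 = fx (4 * fx_one)%num.
      have e4 : nr 4 = 4 by rewrite nrE; congr (_%:R); vm_compute.
      by rewrite /fx nrM e4 mulfK // gt_eqF // nr_one_gt0.
    by apply: fx_le; lia.
  + by rewrite exprn_egt1 // -lt0n.
  rewrite lnXn; last by lra.
  apply: le_trans lb _; rewrite -[leRHS]mulr_natl ler_peMl // ler1n //.
- rewrite /table_slow; case: eqP => // _; case: eqP => [e2|_]; last exact: expR_gt0.
  move: b2; rewrite e2 eqxx => /implyP /(_ isT) /andP[h1 h2]; apply: divr_gt0; last exact: nr_one_gt0.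
  by apply: nr_gt0; rewrite /fx_slow; lia.
- rewrite /table_slow; case: eqP => [e0b|_]; first by constructor 1.
  case: eqP => [e2|_]; last by constructor 3.
  move: b2; rewrite e2 eqxx => /implyP /(_ isT) /andP[h1 h2].
  have X1 : fx (fx_ell k c) <= 1 by rewrite -fx_oneE; apply: fx_le; lia.
  constructor 2; split=> //; first exact: le_trans el X1.
  have := @fx_slow_le (fx_ell k c); set X := fx _ in el X1 *; set s := fx _ => hs.
  have {}hs : s + table_theta <= 1 - X + X ^+ 2 / 2 by apply: hs; lia.
  apply: le_trans hs _; rewrite -subr_ge0; set e := table_ell k c in e0 el *.
  have -> : 1 - e + e ^+ 2 / 2 - (1 - X + X ^+ 2 / 2) = (X - e) * (2 - X - e) / 2 by field.
  by rewrite divr_ge0 // mulr_ge0 ?subr_ge0 //; clear -el X1; lra.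
rewrite /table_term /table_slow /fx_err; case: eqP => [e0b|_].
  by rewrite e0b expr1 !divr1.
case: eqP => [e2|_].
  move: b2; rewrite e2 eqxx => /implyP /(_ isT) /andP[h1 h2].
  rewrite e2 in pf T0; apply: fx_divP => //; rewrite /fx_slow; lia.
rewrite expRN invrK; apply: fx_mulP => //; first exact: expR_ge0.
have kt : k%:R * table_theta <= 2^-1.
  have : k%:R * table_theta <= 3 * table_theta by rewrite ler_wpM2r ?(ltW t0) // ler_nat.
  by move/le_trans; apply; rewrite table_thetaE; lra.
have kt0 : 0 <= k%:R * table_theta by rewrite mulr_ge0 // ltW.
have -> : table_ell k c = (k * c)%:R * ln (26 / 25) + k%:R * table_theta.
  by rewrite /table_ell lnXn ?divr_gt0 // mulrDr -[_ *+ c]mulr_natl mulrA natrM.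
rewrite expRD expRM_natl lnK ?posrE ?divr_gt0 //.
apply: fx_mulP; rewrite ?expR_ge0 ?fx_powP ?exprn_ge0 ?divr_ge0 //.
apply: le_trans (expR_le_inv _) _; first by clear -kt; lra.
have -> : fx (fx_one + 2 * N.of_nat k * fx_theta) = 1 + 2 * (k%:R * table_theta).
  have e2 : nr 2 = 2 by rewrite nrE; congr (_%:R); vm_compute.
  by rewrite fxD fx_oneE fxM nrM nr_of_nat e2 -/table_theta -mulrA.
move: (k%:R * table_theta) kt kt0 => t kt kt0.
rewrite -[leLHS]mul1r ler_pdivrMr; last by clear -kt; lra.
rewrite -subr_ge0.
have -> : (1 + 2 * t) * (1 - t) - 1 = t * (1 - 2 * t) by ring.
by rewrite mulr_ge0 //; clear -kt; lra.
Qed.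

(** Raising the truncation from n to n + 2 multiplies the term by ell^2 / ((n + 2) (n + 3)), at most
    9/36 since ell <= 3 and n >= 4; halving is all that is needed. *)
Lemma table_tail k b j : (0 < k <= 3)%N -> (3 < b)%N -> fx_row k 18 b ->
    (fx_ell k 18 <= 3 * fx_one)%num ->
  table_term k 18 (b + 2 * j) <= fx (fx_err k 18 b) * 2^-1 ^+ j.
Proof.
move=> k03 b3 row e3; have [_ _ _ t_b] := table_row k03 row.
have e0 := table_ell_ge0 k 18; have E3 : table_ell k 18 <= 3.
  apply: le_trans (table_ell_le k 18) _.
  have -> : 3 = fx (3 * fx_one)%num.
    have e4 : nr 3 = 3 by rewrite nrE; congr (_%:R); vm_compute.
    by rewrite /fx nrM e4 mulfK // gt_eqF // nr_one_gt0.
  exact: fx_le.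
elim: j => [|j IH]; first by rewrite muln0 addn0 expr0 mulr1.
rewrite exprSr mulrA; apply: le_trans (ler_wpM2r _ IH); last by rewrite invr_ge0.
rewrite /table_term /table_slow !ifN_eq; try lia.
have -> : (b + 2 * j.+1 = (b + 2 * j).+2)%N by lia.
have : (3 < b + 2 * j)%N by lia.
move: (b + 2 * j)%N => n n3; set e := table_ell k 18 in e0 E3 *.
have x0 : 0 <= (expR (- e))^-1 by rewrite invr_ge0 expR_ge0.
rewrite [leRHS]mulrAC ler_wpM2r // (factS n.+2) (factS n.+1) !exprSr (natrM _ n.+3) (natrM _ n.+2).
have f0 : 0 < n.+1`!%:R :> R by rewrite ltr0n fact_gt0.
have n2 : 6 <= n.+2%:R :> R by rewrite ler_nat.
have n3' : 6 <= n.+3%:R :> R by rewrite ler_nat; lia.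
have m0 : 0 <= e ^+ n * e by rewrite mulr_ge0 ?exprn_ge0.
move: (n.+2%:R) (n.+3%:R) (n.+1`!%:R) n2 n3' f0 (e ^+ n * e) m0 => p q f p6 q6 f0 w w0.
have p0 : 0 < p by clear -p6; lra.
have q0 : 0 < q by clear -q6; lra.
have -> : w * e * e / (q * (p * f)) = w / f * (e * e / (p * q)).
  by field; rewrite !gt_eqF.
rewrite ler_wpM2l ?divr_ge0 ?(ltW f0) //.
rewrite ler_pdivrMr ?mulr_gt0 //.
have ee : e * e <= 3 * 3 by rewrite ler_pM.
have pq : 6 * 6 <= p * q by rewrite ler_pM.
by clear -ee pq; lra.
Qed.

End tables.

Section table_sieve.
Variable R : realType.
Local Open Scope ring_scope.
Notation fx := (@fx R).

(** The default value 18 of [nth] is the exponent of all blocks beyond the table. *)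
Definition table_c (tab : seq (nat * nat)) i := nth 18 (map fst tab) i.
Definition table_b (tab : seq (nat * nat)) b i :=
  if (i < size tab)%N then nth 0%N (map snd tab) i else (b + 2 * (i - size tab))%N.

Lemma table_b_cons x tab b i : table_b (x :: tab) b i.+1 = table_b tab b i.
Proof. by rewrite /table_b /= ltnS subSS. Qed.

Lemma table_row_all k tab b i : all (fun x => fx_row k x.1 x.2) tab -> (3 < b)%N ->
  fx_row k 18 b -> fx_row k (table_c tab i) (table_b tab b i).
Proof.
move=> /allP rows b3 row; rewrite /table_c /table_b; case: ltnP => h.
  rewrite (nth_map (0, 0)%N) // (nth_map (0, 0)%N) //.
  by apply: rows; rewrite mem_nth.
rewrite nth_default ?size_map //; case/and4P: row => ob c0 c4 _.
apply/and4P; split=> //; last by apply/implyP => /eqP; lia.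
by rewrite oddD oddM /= addbF.
Qed.

Lemma sum_half_le m : \sum_(0 <= i < m) 2^-1 ^+ i <= 2 :> R.
Proof.
suff -> : \sum_(0 <= i < m) 2^-1 ^+ i = 2 - 2 * 2^-1 ^+ m :> R.
  by rewrite gerBl mulr_ge0 // exprn_ge0 // invr_ge0.
elim: m => [|m IH]; first by rewrite big_geq // expr0; ring.
by rewrite big_nat_recr //= IH exprS; field.
Qed.

Lemma table_err_le k tab b m : (0 < k <= 3)%N -> all (fun x => fx_row k x.1 x.2) tab ->
    (3 < b)%N -> fx_row k 18 b -> (fx_ell k 18 <= 3 * fx_one)%num ->
  \sum_(0 <= i < size tab + m) table_term R k (table_c tab i) (table_b tab b i) <=
  fx (foldr (fun x s => fx_err k x.1 x.2 + s) (2 * fx_err k 18 b) tab)%num.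
Proof.
move=> k03 rows b3 row e3; elim: tab rows => [_|x tab IH /andP[xrow rows]].
  rewrite add0n -[foldr _ _ _]/(2 * fx_err k 18 b)%num fxM nrE.
  have -> : (N.to_nat 2)%:R = 2 :> R by congr (_%:R); vm_compute.
  apply: (@le_trans _ _ (\sum_(0 <= i < m) fx (fx_err k 18 b) * 2^-1 ^+ i)).
    apply: ler_sum => i _; rewrite /table_c /table_b nth_nil /= subn0.
    exact: table_tail.
  by rewrite -mulr_sumr mulrC ler_wpM2r ?fx_ge0 // sum_half_le.
rewrite [size _]/= addSn big_nat_recl // -[foldr _ _ _]/(fx_err k x.1 x.2 + foldr (fun x s => fx_err k x.1 x.2 + s) (2 * fx_err k 18 b) tab)%num fxD; apply: lerD.
  by have [] := table_row R k03 xrow.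
rewrite (eq_bigr (fun i => table_term R k (table_c tab i) (table_b tab b i))); first exact: IH.
by move=> i _; rewrite table_b_cons.
Qed.

Lemma sum_tail_level b m : \sum_(0 <= i < m) (b + 2 * i)%:R * 2^-1 ^+ i <= (2 * b + 4)%:R :> R.
Proof.
suff -> : \sum_(0 <= i < m) (b + 2 * i)%:R * 2^-1 ^+ i =
    (2 * b + 4)%:R - (2 * b + 4 * m + 4)%:R * 2^-1 ^+ m :> R.
  by rewrite gerBl mulr_ge0 // exprn_ge0 // invr_ge0.
elim: m => [|m IH]; first by rewrite big_geq // expr0 muln0 addn0 mulr1 subrr.
rewrite big_nat_recr //= IH exprS !natrD !natrM -[m.+1%:R]natr1.
by field.
Qed.

Lemma table_level_le tab b C m :
  \sum_(0 <= i < size tab + m) (table_b tab b i)%:R /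
     (26 / 25) ^+ (C + \sum_(0 <= j < i) table_c tab j) <= fx (fx_level C tab b).
Proof.
have mu0 : 0 < 26 / 25 :> R by rewrite divr_gt0.
have pV := @fx_powVP R.
elim: tab C => [|[c b'] tab IH] C.
  rewrite add0n -[fx_level _ _ _]/(N.of_nat (2 * b + 4) * fx_powV C)%num fxM nr_of_nat.
  apply: (@le_trans _ _ ((2 * b + 4)%:R * ((26 / 25) ^+ C)^-1)); last by rewrite ler_wpM2l.
  apply: le_trans (ler_wpM2r _ (sum_tail_level b m)); last by rewrite invr_ge0 exprn_ge0 ?ltW.
  rewrite mulr_suml; apply: ler_sum => i _; rewrite /table_b ltn0 subn0.
  have -> : (\sum_(0 <= j < i) table_c [::] j = 18 * i)%N.
    by rewrite (eq_bigr (fun _ => 18%N)) ?sum_nat_const_nat ?subn0 1?mulnC // => j _; exact: nth_nil.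
  rewrite exprD invfM mulrCA [leLHS]mulrC ler_wpM2r ?invr_ge0 ?exprn_ge0 ?(ltW mu0) //.
  rewrite ler_wpM2l //.
  rewrite exprM -exprVn lerXn2r ?nnegrE ?invr_ge0 ?exprn_ge0 ?(ltW mu0) //.
  by rewrite lef_pV2 ?posrE ?exprn_gt0 //; lra.
rewrite [size _]/= addSn big_nat_recl // -[fx_level _ _ _]/(N.of_nat b' * fx_powV C + fx_level (C + c) tab b)%num fxD; apply: lerD.
  by rewrite big_geq // addn0 fxM nr_of_nat ler_wpM2l.
apply: le_trans (IH (C + c)%N); apply: ler_sum => i _.
by rewrite table_b_cons big_nat_recl // [table_c _ 0]/= addnA.
Qed.

Lemma sum_le_shift (F : nat -> R) s r : (forall i, 0 <= F i) ->
  \sum_(0 <= i < r) F i <= \sum_(0 <= i < s + r) F i.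
Proof.
by move=> F0; rewrite addnC [leRHS](@big_cat_nat _ _ _ r) ?leq_addr //= lerDl sumr_ge0.
Qed.

Theorem table_sieve k tab b lev (eps : R) : sieve_table k tab b lev -> 0 < eps ->
  exists Z0 : nat, forall (z : nat) (bad : nat -> pred nat), (Z0 <= z)%N ->
    (forall p x, bad p (x %% p)%N = bad p x) ->
    (forall p, prime p -> (bad_residues bad p <= k)%N /\ (bad_residues bad p < p)%N) ->
    forall X : nat, expR ((1 + lev%:R / 100 + eps) * lnn R z) <= X%:R ->
    exists2 x, (x < X)%N & forall p, prime p -> (p < z)%N -> ~~ bad p x.
Proof.
move=> /and5P[k03 rows b3 row /and3P[/N.leb_le e3 /N.leb_le errs /N.leb_le levs]].
have rowi i := table_row R k03 (table_row_all i rows b3 row).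
have /andP[k0 _] := k03.
pose lam i : R := (26 / 25) ^+ table_c tab i.
have t0 := table_theta_gt0 R.
have t1 : table_theta R <= 1 by rewrite table_thetaE; lra.
(* [delta] is one unit 10^-8, the spare 1 in the error test of [sieve_table]. *)
have d0 : 0 < fx 1 by rewrite divr_gt0 ?nr_gt0.
apply: (@brun_hooley_sieve R k (table_theta R) (fx 1) (lev%:R / 100) lam
  (table_b tab b) (fun i => table_slow R k (table_c tab i) (table_b tab b i))) => //.
- by move=> i; have [] := rowi i.
- by move=> i; have /and4P[] := table_row_all i rows b3 row.
- by move=> i; have [_ ? ? _] := rowi i.
- move=> r; rewrite lerBrDr.
  apply: (@le_trans _ _ (fx (foldr (fun x s => fx_err k x.1 x.2 + s) (2 * fx_err k 18 b) tab + 1)%num)); last first.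
    by rewrite -(fx_oneE R) fx_le.
  rewrite fxD lerD2r; apply: le_trans (table_err_le r k03 rows b3 row e3).
  apply: sum_le_shift => i; have [_ S0 _ _] := rowi i.
  by rewrite !mulr_ge0 ?exprn_ge0 ?invr_ge0 ?(ltW S0) // table_ell_ge0.
- move=> r.
  have E i : scale lam i = (26 / 25) ^+ (0 + \sum_(0 <= j < i) table_c tab j).
    rewrite add0n /scale; elim: i => [|i IH]; first by rewrite !big_geq.
    by rewrite !big_nat_recr //= IH exprD.
  apply: (@le_trans _ _ (fx (fx_level 0 tab b))); last first.
    rewrite N.mul_comm in levs; have := fx_le R levs.
    rewrite !fxM fx_oneE mulr1 nr_of_nat.
    have -> : nr R 100 = 100 by rewrite nrE; congr (_%:R); vm_compute.
    by rewrite ler_pdivlMr // mulrC.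
  apply: le_trans (table_level_le tab b 0 r).
  apply: (@le_trans _ _ (\sum_(0 <= i < r) (table_b tab b i)%:R / (26 / 25) ^+ (0 + \sum_(0 <= j < i) table_c tab j))).
    by apply: ler_sum => i _; rewrite E.
  by apply: sum_le_shift => i; rewrite divr_ge0 // exprn_ge0 // divr_ge0.
Qed.

End table_sieve.

(* Found by numerical optimisation of the level. *)
Definition table2 := [:: (6, 0); (11, 2); (9, 2); (8, 2); (15, 4); (13, 4); (19, 6); (18, 6); (24, 8)].
Definition table3 := [:: (2, 0); (7, 2); (7, 2); (6, 2); (6, 2); (10, 4); (9, 4); (13, 6); (13, 6);
  (17, 8); (15, 8)].

Lemma table2_ok : sieve_table 2 table2 6 605.
Proof. by vm_compute. Qed.

Lemma table3_ok : sieve_table 3 table3 8 995.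
Proof. by vm_compute. Qed.

(** * The arithmetic of the construction *)

Lemma dvdn_linear_mod p A B x : (p %| A * (x %% p) + B) = (p %| A * x + B).
Proof. by rewrite /dvdn -modnDml modnMmr modnDml. Qed.

Lemma count_linear_le1 p A B : prime p -> ~~ (p %| A) ->
  count (fun x => p %| A * x + B) (iota 0 p) <= 1.
Proof.
move=> pp pA; rewrite -size_filter.
set s := filter _ _.
have us : uniq s by rewrite filter_uniq ?iota_uniq.
have inj x y : x \in s -> y \in s -> x <= y -> x = y.
  rewrite !mem_filter !mem_iota /= !add0n => /andP[hx _] /andP[hy yp] xy.
  have : p %| (A * y + B) - (A * x + B) by apply: dvdn_sub.
  rewrite subnDr -mulnBr Euclid_dvdM // (negbTE pA) /= => pd.
  have [yx0|] := posnP (y - x); first lia.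
  by move=> yx0; have := dvdn_leq yx0 pd; lia.
case: s us inj => [|x [|y s]] //= /andP[]; rewrite inE negb_or => /andP[xy _] _ inj.
exfalso; move/eqP: xy; apply.
case: (leqP x y) => h; first by apply: inj; rewrite ?inE ?eqxx ?orbT.
by symmetry; apply: inj; rewrite ?inE ?eqxx ?orbT // ltnW.
Qed.

Lemma countU_le (T : Type) (A B : pred T) s : count (predU A B) s <= count A s + count B s.
Proof. by rewrite -(count_predUI A B s) leq_addr. Qed.

Lemma good_of_primes q n : 0 < n ->
  (forall p, prime p -> p %| n -> q <= p \/ exists2 a, q <= p ^ a & p ^ a %| n) -> good q n.
Proof.
move=> n0 h; split=> // p pp pn; have p1 := prime_gt1 pp.
case: (h p pp pn) => [qp|[a qa pa]].
  apply: leq_trans qp _; rewrite -[X in X <= _]expn1 leq_exp2l //.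
  by rewrite -pfactor_dvdn // expn1.
by apply: leq_trans qa _; rewrite leq_exp2l // -pfactor_dvdn.
Qed.

Lemma modular_solution m t N : 0 < m -> coprime t m -> exists s, s * t = N %[mod m].
Proof.
move=> m0 co; have [a _] := Bezoutl t m0.
rewrite gcdnC (eqP co) => /dvdnP[c hc].
(* Bezout gives a t = -1 modulo m; the factor m - 1 stands for -1. *)
exists ((m - 1) * a * N).
have e : (m - 1) * a * N * t + c * N * m = a * N * t * m + N.
  have -> : c * N * m = (c * m) * N by lia.
  rewrite -hc; case: m m0 {co hc} => // m _; rewrite subn1 /=; lia.
by rewrite -(modnMDl (c * N)) addnC e modnMDl.
Qed.

(** The conclusion of [table_sieve] at fixed z and X, which keeps the arithmetic of the construction
    free of real numbers. *)
Definition sieve_bound (k z X : nat) : Prop := forall bad : nat -> pred nat,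
  (forall p x, bad p (x %% p) = bad p x) ->
  (forall p, prime p -> bad_residues bad p <= k /\ bad_residues bad p < p) ->
  exists2 x, x < X & forall p, prime p -> p < z -> ~~ bad p x.

Lemma odd_prime_gt2 p : prime p -> odd p -> 2 < p.
Proof. by move=> /prime_gt1; case: p => [|[|[|]]]. Qed.

Lemma exists_power b z : 1 < b -> 0 < z -> exists a, z <= b ^ a <= b * z.
Proof.
move=> b1 z0; exists (up_log b z).
have h1 := up_logP z b1; rewrite h1 /=.
have [z1|z1] := leqP z 1.
  have -> : z = 1 by lia.
  by rewrite up_log1 muln1 ltnW.
by have := up_log_gtn b1 z1; case: (up_log b z) => [|a] /=; rewrite ?expnS; nia.
Qed.

(* Here m + 1 = 2^a k, where k and 2^a k - 1 are sifted. *)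
Lemma good_pair q z a X : 3 < z -> q <= z -> z <= 2 ^ a -> sieve_bound 2 z X ->
  exists m, [/\ 0 < m, m < 2 ^ a * X, good q m, good q m.+1 &
    odd m /\ forall p, prime p -> p < z -> ~~ (p %| m)].
Proof.
move=> z3 qz za sv; have a0 : 0 < a by case: (a) za; lia.
(* Here [p.-1] stands for -1, so the second form is 2^a x - 1. The prime 2 is left out: it divides m
   + 1 to a power at least 2^a and does not divide m. *)
pose bad p x := [&& odd p, p < z & (p %| 1 * x + 0) || (p %| 2 ^ a * x + p.-1)].
have bad_mod p x : bad p (x %% p) = bad p x.
  by rewrite /bad !dvdn_linear_mod.
have n2 p : prime p -> odd p -> ~~ (p %| 2 ^ a).
  move=> pp op; rewrite Euclid_dvdX // negb_and dvdn_prime2 //.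
  by have := odd_prime_gt2 pp op; case: eqP => // ->.
have badP p : prime p -> bad_residues bad p <= 2 /\ bad_residues bad p < p.
  move=> pp; rewrite /bad_residues.
  have [op|/negbTE ep] := boolP (odd p); last first.
    rewrite (eq_count (a2 := pred0)) ?count_pred0 ?prime_gt0 // => x.
    by rewrite /bad ep.
  have p2 := odd_prime_gt2 pp op.
  suff h : count (bad p) (iota 0 p) <= 2 by split=> //; exact: leq_ltn_trans h p2.
  apply: (@leq_trans (count (predU (fun x => p %| 1 * x + 0) (fun x => p %| 2 ^ a * x + p.-1)) (iota 0 p))).
    by apply: sub_count => x /and3P[].
  apply: leq_trans (countU_le _ _ _) _; rewrite -[2]/(1 + 1) leq_add ?count_linear_le1 ?n2 //.
  by rewrite dvdn1; lia.
have [k kX kP] := sv bad bad_mod badP.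
have nk p : prime p -> odd p -> p < z -> ~~ (p %| k) && ~~ (p %| 2 ^ a * k + p.-1).
  move=> pp op pz; have := kP p pp pz; rewrite /bad op pz /= negb_or.
  by rewrite mul1n addn0.
(* 3 is sifted, and a number prime to 3 is not 0. *)
have k0 : 0 < k by have := nk 3 isT isT z3; case: (k).
pose m := (2 ^ a * k).-1.
have mE : m.+1 = 2 ^ a * k by rewrite prednK // muln_gt0 expn_gt0.
have a2 : 2 ^ a = 2 * 2 ^ a.-1 by rewrite -expnS prednK.
have om : odd m by have := congr1 odd mE; rewrite a2 !oddM /=; case: (odd m).
have pm p : prime p -> p < z -> ~~ (p %| m).
  move=> pp pz; have [op|ep] := boolP (odd p); last first.
    have [->|] := even_prime pp; last by rewrite (negbTE ep).
    by rewrite dvdn2 om.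
  have /andP[_] := nk p pp op pz; apply: contra => h.
  have -> : 2 ^ a * k + p.-1 = m + p by rewrite -mE; have := prime_gt0 pp; lia.
  by rewrite dvdn_addl.
exists m; split=> //.
- by rewrite lt0n; apply/negP => /eqP e; have := om; rewrite e.
- by rewrite mE leq_pmul2l ?expn_gt0 // ltnW.
- apply: good_of_primes => [|p pp pm']; first by case: (m) om.
  left; apply: leq_trans qz _; rewrite leqNgt; apply/negP => pz.
  by have := pm p pp pz; rewrite pm'.
- apply: good_of_primes => // p pp; rewrite mE => pm'.
  have [op|ep] := boolP (odd p).
    left; apply: leq_trans qz _; rewrite leqNgt; apply/negP => pz.
    have /andP[h _] := nk p pp op pz.
    by move: pm'; rewrite Euclid_dvdM // (negbTE h) orbF (negbTE (n2 p pp op)).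
  have [->|] := even_prime pp; last by rewrite (negbTE ep).
  by right; exists a; [exact: leq_trans za|rewrite dvdn_mulr].
Qed.

(** The size hypothesis is (m + 1) m' t' + m h + h <= n with m, m' and t' replaced by their upper
    bounds; it yields m' t' + h <= t. *)
Lemma moils_construction k h n z X2 X3 p0 : 0 < h -> h <= k.+3 -> 0 < k ->
    prime p0 -> k.+3 <= p0 -> p0 < z -> sieve_bound 2 z X2 -> sieve_bound 3 z X3 ->
    (2 * z * X2).+1 * (2 * z * (2 * z * X2) * X3 * (3 * z)) + 2 * z * X2 * h + h <= n ->
  k <= moils_max n h.
Proof.
move=> h0 hk k0 pp0 qp0 p0z sv2 sv3 size_n.
set q := k.+3 in hk qp0.
have q3 : 3 < q by rewrite /q; lia.
have qz : q <= z by exact: leq_trans qp0 (ltnW p0z).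
have z3 : 3 < z by exact: leq_trans qz.
have z0 : 0 < z by lia.
have [a /andP[za az]] := @exists_power 2 z isT z0.
have [c /andP[zc cz]] := @exists_power 3 z isT z0.
have a0 : 0 < a by case: (a) za; lia.
have c0 : 0 < c by case: (c) zc; lia.
have [m [m0 mX gm gm1 [om mz]]] := good_pair z3 qz za sv2.
pose N := n - h.
(* With m' = 1 modulo 3, the number t' + 2 N = t' - N must be prime to 3: a power of 3 serves when 3
   does not divide N, the prime [p0] when it does. *)
have [t' [ot' qt' t'z gt' [co_t' key3 t'p]]] : exists t', [/\ odd t', q <= t', t' <= 3 * z, good q t' &
    [/\ coprime t' m, ~~ (3 %| t' + 2 * N) & forall p, prime p -> p %| t' -> p = p0 \/ (p = 3 /\ ~~ (3 %| N))]].
  have [N3|N3] := boolP (3 %| N).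
    exists p0; split=> //.
    - by case/even_prime: pp0 => // e; move: qp0; rewrite e; lia.
    - by apply: leq_trans (ltnW p0z) _; rewrite leq_pmull.
    - apply: good_of_primes => [|p pp]; first exact: prime_gt0.
      by rewrite dvdn_prime2 // => /eqP ->; left.
    split; first by rewrite prime_coprime // mz.
      rewrite dvdn_addl ?dvdn_mull // dvdn_prime2 //.
      by apply/eqP => e; move: qp0; rewrite -e; lia.
    by move=> p pp; rewrite dvdn_prime2 // => /eqP ->; left.
  exists (3 ^ c); split=> //.
  - by rewrite oddX orbT.
  - exact: leq_trans zc.
  - apply: good_of_primes => [|p pp]; first by rewrite expn_gt0.
    rewrite Euclid_dvdX // dvdn_prime2 // => /andP[/eqP -> _]; right.
    by exists c => //; exact: leq_trans zc.
  split.
  - by rewrite coprimeXl // prime_coprime // mz.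
  - by rewrite dvdn_addr ?Euclid_dvdM //; case: (c) c0 => // c' _; rewrite expnS dvdn_mulr.
  - by move=> p pp; rewrite Euclid_dvdX // dvdn_prime2 // => /andP[/eqP -> _]; right.
have t'0 : 0 < t' by lia.
(* Taking m' = s modulo m makes m divide N - m' t', and the quotient will be t. *)
have [s sE] := modular_solution N m0 co_t'.
have n2 p : prime p -> odd p -> ~~ (p %| 2 ^ a).
  move=> pp op; rewrite Euclid_dvdX // negb_and dvdn_prime2 //.
  by have := odd_prime_gt2 pp op; case: eqP => // ->.
have cop : coprime (2 ^ a) m by rewrite coprimeXl // coprime2n.
(* Modulo 2^a, m' is 0 or -1, so 2^a divides m' or m' + 1; the choice makes N - m' t' odd, hence t
   odd. *)
pose rho := if odd N then 0 else 2 ^ a - 1.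
pose Q := 2 ^ a * m.
have Q0 : 0 < Q by rewrite muln_gt0 expn_gt0.
pose r := chinese (2 ^ a) m rho s %% Q.
have rQ : r < Q by rewrite ltn_mod.
have r2 : r = rho %[mod 2 ^ a].
  by rewrite /r /Q modn_dvdm ?dvdn_mulr // chinese_modl.
have rm : r = s %[mod m].
  by rewrite /r /Q modn_dvdm ?dvdn_mull // chinese_modr.
have nQ p : prime p -> odd p -> p < z -> ~~ (p %| Q).
  by move=> pp op pz; rewrite /Q Euclid_dvdM // negb_or n2 // mz.
(* The third form is t' m' - N = - m t modulo p. The prime [p0] is exempt: it is at least [q], hence
   harmless as a divisor, and it may be t' itself, which would make the form degenerate. *)
pose bad p x := [&& odd p, p < z, p != p0 & [|| p %| Q * x + r, p %| Q * x + r.+1 |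
  p %| (t' * Q) * x + (t' * r + N * p.-1)]].
have bad_mod p x : bad p (x %% p) = bad p x by rewrite /bad !dvdn_linear_mod.
have badP p : prime p -> bad_residues bad p <= 3 /\ bad_residues bad p < p.
  move=> pp; rewrite /bad_residues.
  have [/and3P[op pz pp0']|/negbTE nb] := boolP [&& odd p, p < z & p != p0]; last first.
    rewrite (eq_count (a2 := pred0)) ?count_pred0 ?prime_gt0 // => x.
    by rewrite /bad; move: nb; case: (odd p); case: (p < z); case: (p != p0).
  have p2 := odd_prime_gt2 pp op; have pQ := nQ p pp op pz.
  have [p3|p3] := eqVneq p 3; last first.
    suff le3 : count (bad p) (iota 0 p) <= 3.
      split=> //; apply: leq_ltn_trans le3 _; move: op p2 p3; case: (p) => [|[|[|[|]]]] //.
    have pt' : ~~ (p %| t').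
      apply/negP => /(t'p p pp) [e|[e _]]; first by rewrite e eqxx in pp0'.
      by rewrite e eqxx in p3.
    apply: (@leq_trans (count (predU (fun x => p %| Q * x + r) (predU (fun x => p %| Q * x + r.+1)
       (fun x => p %| (t' * Q) * x + (t' * r + N * p.-1)))) (iota 0 p))).
      by apply: sub_count => x /and4P[].
    apply: leq_trans (countU_le _ _ _) _; rewrite -[3]/(1 + 2) leq_add ?count_linear_le1 //.
    apply: leq_trans (countU_le _ _ _) _; rewrite -[2]/(1 + 1) leq_add ?count_linear_le1 //.
    by rewrite Euclid_dvdM // negb_or pt'.
  suff lt3 : count (bad p) (iota 0 p) < 3 by split; [exact: ltnW|rewrite [X in _ < X]p3].
  (* The class m' = 1 modulo 3 survives: 3 divides neither m' nor m' + 1, nor t' m' - N = t' - N by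
     the choice of t'. *)
  have [x x3 xE] : exists2 x, x < 3 & (Q * x + r) %% 3 = 1.
    move: pQ; rewrite p3 /dvdn; have h1 := ltn_pmod Q (isT : 0 < 3); have h2 := ltn_pmod r (isT : 0 < 3) => Q3.
    have [x [x3 hx]] : exists x, x < 3 /\ (Q %% 3 * x + r %% 3) %% 3 = 1.
      move: h1 h2 Q3; case: (Q %% 3) => [|[|[|//]]] //; case: (r %% 3) => [|[|[|//]]] // _ _ _;
        try (by exists 0); try (by exists 1); by exists 2.
    by exists x => //; rewrite -[RHS]hx modnDmr -[RHS]modnDml modnMml modnDml.
  have nbx : ~~ bad p x.
    have f1 : ~~ (3 %| Q * x + r) by rewrite /dvdn xE.
    have f2 : ~~ (3 %| Q * x + r.+1) by rewrite addnS -(addn1 (Q * x + r)) /dvdn -modnDml xE.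
    have f3 : ~~ (3 %| t' * Q * x + (t' * r + N * 3.-1)).
      have -> : t' * Q * x + (t' * r + N * 3.-1) = t' * (Q * x + r) + 2 * N.
        by rewrite mulnDr mulnA -addnA [2 * N]mulnC.
      by rewrite /dvdn -modnDml -modnMmr xE muln1 modnDml.
    by rewrite /bad p3 (negbTE f1) (negbTE f2) (negbTE f3) !andbF.
  have : count (bad p) (iota 0 p) + count (predC (bad p)) (iota 0 p) = p.
    by rewrite count_predC size_iota.
  have : 0 < count (predC (bad p)) (iota 0 p).
    by rewrite -has_count; apply/hasP; exists x => //; rewrite mem_iota p3.
  by move: (count (bad p) _) (count _ _) p3 => u v; clear; lia.
have [x xX xP] := sv3 bad bad_mod badP.
pose m' := Q * x + r.
have nb p : prime p -> odd p -> p < z -> p != p0 ->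
    [&& ~~ (p %| m'), ~~ (p %| m'.+1) & ~~ (p %| t' * m' + N * p.-1)].
  move=> pp op pz pp0'; have := xP p pp pz; rewrite /bad op pz pp0' /= !negb_or addnS.
  by rewrite -/m' (_ : t' * Q * x + (t' * r + N * p.-1) = t' * m' + N * p.-1) // /m' mulnDr mulnA addnA.
have n30 : 3 != p0 by apply/eqP => e; move: qp0; rewrite -e; lia.
have m'0 : 0 < m' by have := nb 3 isT isT z3 n30; case: (m').
have m'r : m' = rho %[mod 2 ^ a] by rewrite /m' /Q -mulnA mulnC modnMDl.
have m's : m' * t' = N %[mod m].
  rewrite -sE -modnMml -[RHS]modnMml; congr ((_ * _) %% _).
  by rewrite /m' /Q -rm mulnAC modnMDl.
have a2 : 2 ^ a = 2 * 2 ^ a.-1 by rewrite -expnS prednK.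
have om' : odd m' = ~~ odd N.
  have <- : odd rho = ~~ odd N.
    rewrite /rho; case: (odd N) => //=; rewrite oddB ?expn_gt0 //.
    by rewrite a2 oddM.
  have := congr1 (fun u => odd (u %% 2)) m'r.
  by rewrite a2 !modn_dvdm ?dvdn_mulr // !modn2; case: (odd m'); case: (odd rho).
have mM : m <= 2 * z * X2 by apply: ltnW; apply: leq_trans mX _; rewrite leq_mul2r az orbT.
have m'M : m' <= 2 * z * (2 * z * X2) * X3.
  apply: (@leq_trans (Q * X3)).
    by apply: (@leq_trans (Q * x.+1)); [rewrite mulnS /m' addnC leq_add2r ltnW|rewrite leq_mul2l xX orbT].
  by rewrite leq_mul2r /Q leq_mul ?orbT.
have mt'M : m' * t' <= 2 * z * (2 * z * X2) * X3 * (3 * z) by exact: leq_mul.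
have size1 : m.+1 * (m' * t') + m * h + h <= n.
  by apply: leq_trans size_n; rewrite leq_add2r leq_add ?leq_mul.
have hn : h <= n by exact: leq_trans (leq_addl _ _) size1.
have m'N : m' * t' <= N.
  rewrite /N leq_subRL // addnC; apply: leq_trans size1.
  by rewrite mulSn -!addnA leq_add2l addnA leq_addl.
have [t tE] : exists t, N - m' * t' = t * m.
  by apply/dvdnP; move/eqP: m's; rewrite eq_sym eqn_mod_dvd.
have NE : N = m * t + m' * t' by rewrite mulnC -tE subnK.
have tge : m' * t' + h <= t.
  rewrite -(leq_pmul2l m0); move: size1 NE; rewrite /N mulnDr mulSn.
  move: (m * (m' * t')) (m' * t') (m * h) (m * t) => A W C D; clear; lia.
have t0 : 0 < t by apply: leq_trans tge; rewrite addn_gt0 h0 orbT.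
have nE : n = m * t + (m' * t' + h) by rewrite addnA -NE /N subnK.
have ot : odd t.
  have := congr1 odd NE; rewrite oddD !oddM om ot' om' andbT /=.
  by case: (odd t); case: (odd N).
have ge_q p u : prime p -> odd p -> p %| u -> (p < z -> p != p0 -> ~~ (p %| u)) -> q <= p.
  move=> pp op pu h1; have [->|pp0'] := eqVneq p p0; first exact: qp0.
  rewrite leqNgt; apply/negP => pq; have := h1 (leq_trans pq qz) pp0'.
  by rewrite pu.
rewrite nE; apply: good_moils_max => //.
- exact: leq_trans hk qt'.
- apply: good_of_primes => // p pp pt; left.
  have op : odd p by have := dvdn_odd pt ot.
  apply: (@ge_q p t) => // pz pp0'; apply/negP => _.
  have /and3P[_ _] := nb p pp op pz pp0'; apply/negP; rewrite negbK.
  have -> : t' * m' + N * p.-1 = N * p - m * t.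
    have -> : N * p = m * t + (t' * m' + N * p.-1).
      by rewrite -{1}(prednK (prime_gt0 pp)) mulnS {1}NE [t' * m']mulnC addnA.
    by rewrite addKn.
  by apply: dvdn_sub; [exact: dvdn_mull|exact: dvdn_mull].
- apply: good_of_primes => // p pp pm'.
  have [op|ep] := boolP (odd p).
    by left; apply: (@ge_q p m') => // pz pp0'; case/and3P: (nb p pp op pz pp0').
  have [e2|] := even_prime pp; last by rewrite (negbTE ep).
  right; exists a; first by rewrite e2; exact: leq_trans za.
  have oN : odd N by move: pm'; rewrite e2 dvdn2 om' negbK.
  by rewrite e2 /dvdn m'r /rho oN mod0n.
- apply: good_of_primes => // p pp pm'.
  have [op|ep] := boolP (odd p).
    by left; apply: (@ge_q p m'.+1) => // pz pp0'; case/and3P: (nb p pp op pz pp0').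
  have [e2|] := even_prime pp; last by rewrite (negbTE ep).
  right; exists a; first by rewrite e2; exact: leq_trans za.
  have oN : ~~ odd N by move: pm'; rewrite e2 dvdn2 /= om' negbK.
  rewrite e2 /dvdn -addn1 -modnDml m'r modnDml /rho (negbTE oN) subnK ?expn_gt0 //.
  by rewrite modnn.
Qed.

(** * Choice of the parameters and comparison of sizes *)

Local Open Scope ring_scope.

(** Without a prime the Mertens sums at a and b agree, whence ln b - 3 <= ln a + 2; so 5 = 2 + 3. *)
Lemma prime_between (R : realType) (a b : nat) : (0 < a)%N -> lnn R a + 5 < lnn R b ->
  exists2 p, prime p & (a < p <= b)%N.
Proof.
move=> a0 ab; have b0 : (0 < b)%N.
  by rewrite lt0n; apply/eqP => e; move: ab; rewrite e [lnn R 0]ln0 //; have := lnn_ge0 R a; lra.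
have ab' : (a <= b)%N.
  rewrite leqNgt; apply/negP => ba; have := lnn_le R b0 (ltnW ba); lra.
case: (boolP (has prime (index_iota a.+1 b.+1))) => [/hasP[p]|/hasPn np].
  by rewrite mem_index_iota => ? pp; exists p.
have h1 := mertens_sum_le R a0; have h2 := mertens_sum_ge R b0.
suff e : mertens_sum R b = mertens_sum R a by move: h1 h2 ab; rewrite e; clear; lra.
rewrite /mertens_sum (@big_cat_nat _ _ _ a.+1) //= [X in _ + X]big1_seq ?addr0 // => p /andP[pp].
by move=> /np; rewrite pp.
Qed.

Lemma expR_gt_const (R : realType) (c C : R) : 0 < c ->
  exists2 Y : R, 1 <= Y & forall y, Y <= y -> C < expR (c * y).
Proof.
move=> c0; have [Y Y1 YP] := expR_gt_poly C 0 c0; exists Y => // y /YP.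
by rewrite expr0 mulr1.
Qed.

Lemma truncn_bounds (R : realType) (x : R) : 0 <= x ->
  (Num.truncn x)%:R <= x /\ x < (Num.truncn x)%:R + 1.
Proof. by move=> x0; have /andP[h1 h2] := truncn_itv x0; rewrite natr1. Qed.

(** Taking eps = 1/100 turns [lev] into [lev.+1]; the levels 605 and 995 thus give the exponents
    7.06 and 10.96. *)
Lemma sieve_bound_table (R : realType) k tab b lev : sieve_table k tab b lev ->
  exists Z : nat, forall z, (Z <= z)%N -> exists2 X : nat, sieve_bound k z X &
    X%:R <= 2 * expR ((lev.+1%:R / 100 + 1) * lnn R z).
Proof.
move=> ok; have e0 : 0 < 100^-1 :> R by rewrite invr_gt0.
have [Z ZP] := table_sieve ok e0; exists Z => z Zz.
set E := expR _; have E0 : 0 <= E by exact: expR_ge0.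
have E1 : 1 <= E.
  rewrite -expR0 ler_expR mulr_ge0 ?lnn_ge0 // addr_ge0 // divr_ge0 //.
have [h1 h2] := truncn_bounds E0.
exists (Num.truncn E).+1; last by rewrite -[leLHS]natr1; move: h1 E1; clear; lra.
move=> bad bm bp; apply: ZP => //.
have -> : 1 + lev%:R / 100 + 100^-1 = lev.+1%:R / 100 + 1 :> R.
  by rewrite -[lev.+1%:R]natr1; field.
by rewrite -/E -[leRHS]natr1 ltW.
Qed.

Theorem theorem4p1 (R : realType) (h : nat) (h_gt0 : (0 < h)%N) :
  exists n0 : nat, forall n : nat, (n0 <= n)%N ->
    (n%:R : R) `^ (1 / (296 / 10)) < (moils_max n h)%:R.
Proof.
have [Z2 Z2P] := sieve_bound_table R table2_ok.
have [Z3 Z3P] := sieve_bound_table R table3_ok.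
(* z will be about n^v with v = 1/29.5. As v exceeds 1/29.6, z outgrows any multiple of the number
   of squares; as v is below 1/29.08, the size condition holds. *)
pose c : R := 1 / (296 / 10); pose v : R := 2 / 59.
have c0 : 0 < c by rewrite /c; lra.
have v0 : 0 < v by rewrite /v; lra.
have vc : 0 < v - c by rewrite /v /c; lra.
(* 29.08 = 2 * 8.06 + 10.96 + 2: the exponents of m, counted twice, of the sieve of dimension 3, and
   of 2^a and t' together. *)
pose w : R := 2908 / 100 * v.
have w1 : 0 < 1 - w by rewrite /w /v; lra.
(* In turn: z passes the thresholds of both sieves; a prime fits between k + 2 and z, with the
   factor e^5 asked by [prime_between]; n dominates the size condition; h is below k. *)
have [Y1 Y11 Y1P] := expR_gt_const ((maxn Z2 Z3)%:R + 1) v0.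
have [Y2 _ Y2P] := expR_gt_const (4 * expR 5 + 2) vc.
have [Y3 _ Y3P] := expR_gt_const (240 + 5 * h%:R) w1.
have [Y4 _ Y4P] := expR_gt_const h%:R c0.
have [n0 n0P] := lnn_unbounded (Num.max Y1 (Num.max Y2 (Num.max Y3 Y4))).
exists n0 => n nn; have := n0P n nn; rewrite !ge_max; set y := lnn R n.
move=> /and4P[/[dup] y1 /Y1P z_big /Y2P p_big /Y3P s_big /Y4P h_big].
have y0 : 0 < y by apply: lt_le_trans y1; apply: lt_le_trans Y11.
have nE : n%:R = expR y.
  rewrite lnK // posrE ltr0n lt0n; apply/negP => /eqP n00.
  by move: y0; rewrite /y n00 /lnn ln0 // ltxx.
pose E t := expR (t * y).
have ED s t : E (s + t) = E s * E t by rewrite /E mulrDl expRD.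
have E1 t : 0 <= t -> 1 <= E t by move=> t0; rewrite -expR0 ler_expR mulr_ge0 // ltW.
have -> : n%:R `^ (1 / (296 / 10)) = E c.
  by rewrite /powR nE gt_eqF ?expR_gt0 // expRK.
rewrite -/(E _) in z_big p_big s_big h_big.
have [k1 k2] := truncn_bounds (expR_ge0 (c * y)); rewrite -/(E c) in k1 k2.
pose k := (Num.truncn (E c)).+1.
have kE : k%:R = (Num.truncn (E c))%:R + 1 :> R by rewrite -natr1.
have Ek : E c < k%:R by rewrite kE.
apply: lt_le_trans Ek _; rewrite ler_nat.
have [z1 z2] := truncn_bounds (expR_ge0 (v * y)); rewrite -/(E v) in z1 z2.
pose z := Num.truncn (E v); rewrite -/z in z1 z2.
have zZ : (maxn Z2 Z3 <= z)%N.
  rewrite -ltnS -(ltr_nat R) -[ltRHS]natr1.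
  by apply: lt_trans (lt_trans z_big z2); rewrite ltrDl.
have [X2 sv2 X2P] := Z2P z (leq_trans (leq_maxl _ _) zZ).
have [X3 sv3 X3P] := Z3P z (leq_trans (leq_maxr _ _) zZ).
have Ec1 : 1 <= E c by apply: E1; exact: ltW.
have Ev1 : 1 <= E v by apply: E1; exact: ltW.
have EvE : (4 * expR 5 + 2) * E c <= E v.
  have -> : E v = E (v - c) * E c by rewrite -ED subrK.
  by rewrite ler_wpM2r ?(le_trans _ Ec1) // ltW.
have e5 : 0 <= expR 5 * E c by rewrite mulr_ge0 // ?expR_ge0 // (le_trans _ Ec1).
have z4 : 4 * (expR 5 * E c) < z%:R - 1.
  by move: EvE Ec1 z2; clear; lra.
have z0 : (0 < z)%N by rewrite -(ltr_nat R); move: z4 e5; clear; lra.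
have zP : z.-1%:R = z%:R - 1 :> R by rewrite -subn1 natrB.
have [p0 pp0 /andP[kp p0z]] : exists2 p, prime p & (k.+2 < p <= z.-1)%N.
  apply: (@prime_between R) => //.
  have k4 : k.+2%:R <= 4 * E c.
    by rewrite -[k.+2]addn2 natrD kE; move: k1 Ec1; clear; lra.
  have k0' : 0 < k.+2%:R :> R by rewrite ltr0n.
  have zz : expR 5 * k.+2%:R < z.-1%:R :> R.
    rewrite zP; apply: le_lt_trans z4.
    by rewrite mulrCA ler_wpM2l ?expR_ge0.
  have h1 : ln (expR 5 * k.+2%:R) < ln z.-1%:R :> R.
    rewrite ltr_ln ?posrE ?mulr_gt0 ?expR_gt0 //.
    by apply: le_lt_trans zz; rewrite mulr_ge0 ?expR_ge0.
  by move: h1; rewrite lnM ?posrE ?expR_gt0 // expRK addrC.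
have Lz : lnn R z <= v * y.
  by rewrite -[leRHS]expRK ler_ln ?posrE ?expR_gt0 ?ltr0n.
have lev100 (l : nat) : l%:R / 100 + 1 = (l + 100)%:R / 100 :> R.
  by rewrite natrD mulrDl divff // pnatr_eq0.
have X2E : X2%:R <= 2 * E (706 / 100 * v).
  apply: le_trans X2P _; rewrite ler_pM2l // ler_expR.
  rewrite lev100.
  by rewrite -[leRHS]mulrA ler_wpM2l ?divr_ge0.
have X3E : X3%:R <= 2 * E (1096 / 100 * v).
  apply: le_trans X3P _; rewrite ler_pM2l // ler_expR.
  rewrite lev100.
  by rewrite -[leRHS]mulrA ler_wpM2l ?divr_ge0.
apply: (@moils_construction k h n z X2 X3 p0) => //.
- apply: (@leq_trans k); last by rewrite -addn3 leq_addr.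
  by rewrite ltnW // -(ltr_nat R); apply: lt_trans h_big _; rewrite kE.
- by rewrite -[z]prednK.
have hz : z%:R <= E v by [].
have hr0 : 0 <= h%:R :> R by [].
pose A := E (806 / 100 * v); pose G := E (1096 / 100 * v).
have A1 : 1 <= A by apply: E1; rewrite mulr_ge0 ?divr_ge0 ?(ltW v0).
have G1 : 1 <= G by apply: E1; rewrite mulr_ge0 ?divr_ge0 ?(ltW v0).
have AE : E v * E (706 / 100 * v) = A by rewrite -ED /A; congr E; lra.
have zX : (2 * z * X2)%:R <= 4 * A.
  rewrite !natrM -AE.
  have -> : 4 * (E v * E (706 / 100 * v)) = 2 * E v * (2 * E (706 / 100 * v)) by ring.
  by rewrite ler_pM ?mulr_ge0 // ler_pM2l.
have W : A * A * (E v * E v) * G = E w.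
  by rewrite -!ED /w; congr E; lra.
have Ww : E w * E (1 - w) = expR y.
  by rewrite -ED addrC subrK /E mul1r.
rewrite -(ler_nat R) nE -Ww natrD natrD (natrM _ _ h) (natrM _ _.+1).
(* 5 A bounds 2 z X2 + 1, and 48 = 2 * 4 * 2 * 3 collects the constants in the bound for m' t'. *)
apply: (@le_trans _ _ (5 * A * (48 * (E v * E v * A * G)) + 5 * A * h%:R)).
  rewrite -addrA; apply: lerD.
    apply: ler_pM => //; first by rewrite -natr1; move: zX A1; clear; lra.
    rewrite (natrM _ _ (3 * z)) (natrM _ _ X3) (natrM _ (2 * z)).
    have -> : 48 * (E v * E v * A * G) = 2 * E v * (4 * A) * (2 * G) * (3 * E v) by ring.
    rewrite !ler_pM ?mulr_ge0 // ?natrM ?ler_pM2l //.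
  have : (2 * z * X2)%:R * h%:R <= 4 * A * h%:R by rewrite ler_wpM2r.
  have : 1 * h%:R <= A * h%:R by rewrite ler_wpM2r.
  by clear; lra.
have Ap : 0 <= A by apply: le_trans A1.
have AW : A <= E w.
  rewrite -W; have -> : A * A * (E v * E v) * G = A * (A * (E v * E v) * G) by ring.
  rewrite ler_peMr //; apply: mulr_ege1 => //; apply: mulr_ege1 => //.
  by apply: mulr_ege1.
apply: (@le_trans _ _ (E w * (240 + 5 * h%:R))); last first.
  by rewrite ler_wpM2l ?expR_ge0 // ltW.
have -> : 5 * A * (48 * (E v * E v * A * G)) = 240 * E w by rewrite -W; ring.
have : A * h%:R <= E w * h%:R by rewrite ler_wpM2r.
by clear; lra.
Qed.
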